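(* Let $f\in\mathrm{BL}([0,1])$. For each $\mu_0\in\mathcal{M}^+([0,1])$ and each $v:\mathcal{M}([0,1])\times[0,1]\to\mathbb{R}$ satisfying the Velocity Assumption (see context), a unique mild solution with initial value $\mu_0$ of $$\frac{\partial}{\partial t}\mu_t+\frac{\partial}{\partial x}\bigl(v[\mu_t]\,\mu_t\bigr)=f\cdot\mu_t$$ exists for all time $t\ge0$; that is, there is a unique map $\mu:[0,\infty)\to\mathcal{M}^+([0,1])$ such that for every $T>0$ the restriction $\mu|_{[0,T]}$ is the unique mild solution on $[0,T]$ with initial value $\mu_0$.
   Context: **Norms.** $\mathcal{M}([0,1])$ is the space of finite (signed) Borel measures on $[0,1]$, $\mathcal{M}^+([0,1])$ the cone of positive ones, $\|\cdot\|_{\mathrm{TV}}$ the total variation norm. $\mathrm{BL}([0,1])$ is the space of real-valued bounded Lipschitz functions on $[0,1]$ with norm $\|\phi\|_{\mathrm{BL}}=\|\phi\|_\infty+|\phi|_{\mathrm{L}}$, where $|\phi|_{\mathrm{L}}$ is the (smallest) Lipschitz constant. $\|\mu\|_{\mathrm{BL}}^*:=\sup\{|\int\phi\,d\mu| : \phi\in\mathrm{BL}([0,1]),\ \|\phi\|_{\mathrm{BL}}\le 1\}$. $C([0,T];\mathcal{M}([0,1]))$ denotes maps $t\mapsto\mu_t$ into $\mathcal{M}([0,1])$ that are continuous for $\|\cdot\|_{\mathrm{BL}}^*$. **Stopped flow.** For $w\in\mathrm{BL}([0,1])$ and $x_0\in[0,1]$, let $x(\cdot;x_0)$ be the unique maximal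 solution, for $t\ge 0$ and with values in $[0,1]$, of $\dot x=w(x)$, $x(0)=x_0$, with maximal interval of existence $I_{x_0}\subset[0,\infty)$, and let $\tau_\partial(x_0)=\sup I_{x_0}\in[0,\infty]$ (so $\tau_\partial(x_0)=0$ if $x_0$ is a boundary point where $w$ points outwards). Define $\Phi^w_t(x_0)=x(t;x_0)$ if $t\in I_{x_0}$ and $\Phi^w_t(x_0)=x(\tau_\partial(x_0);x_0)$ otherwise, and $P^w_t\mu:=\Phi^w_t\#\mu=\mu\circ(\Phi^w_t)^{-1}$ for $\mu\in\mathcal{M}([0,1])$. **Solution operator for fixed velocity.** For $w,f\in\mathrm{BL}([0,1])$ and each $\nu\in\mathcal{M}([0,1])$ it is known that on every interval $[0,T]$ there is a unique map $t\mapsto\mu_t\in\mathcal{M}([0,1])$ that is $\|\cdot\|_{\mathrm{BL}}^*$-continuous, $\|\cdot\|_{\mathrm{TV}}$-bounded and satisfies $\mu_t=P^w_t\nu+\int_0^tP^w_{t-s}(f\cdot\mu_s)\,ds$ for all $t\in[0,T]$ (Bochner integral in the completion of $\mathcal{M}([0,1])$ for $\|\cdot\|_{\mathrm{BL}}^*$); here $f\cdot\mu$ is the measure with density $f$ with respect to $\mu$. Put $Q^w_t\nu:=\mu_t$. (The function $f$ is fixed and suppressed in the notation.) **Velocity Assumption.** Write $v[\mu]:=v(\mu,\cdot)$. (i) $v[\mu]\in\mathrm{BL}([0,1])$ for each $\mu\in\mathcal{M}([0,1])$; and for any $R>0$ there are constants $K_R,L_R,M_R$ such that for all $\mu,\nu\in\mathcal{M}([0,1])$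 with $\|\mu\|_{\mathrm{TV}}\le R$, $\|\nu\|_{\mathrm{TV}}\le R$: (ii) $\|v[\mu]\|_\infty\le K_R$; (iii) $|v[\mu]|_{\mathrm{L}}\le L_R$; (iv) $\|v[\mu]-v[\nu]\|_\infty\le M_R\|\mu-\nu\|_{\mathrm{BL}}^*$. **Euler approximation.** A partition of $[0,T]$ is a finite set $\alpha=\{t_0,\dots,t_N\}$, $N\ge1$, with $0=t_0<t_1<\dots<t_N=T$. The Euler approximation with partition $\alpha$ and initial value $\mu_0$ is the trajectory $\mu\in C([0,T];\mathcal{M}([0,1]))$ that equals $\mu_0$ at $t=0$ and is given by $\mu_t:=Q^{v_j}_{t-t_j}\mu_{t_j}$ for $t\in(t_j,t_{j+1}]$, where $v_j:=v[\mu_{t_j}]$, $j=0,\dots,N-1$. **Admissible sequence of partitions.** A sequence $(\alpha_k)_{k\in\mathbb{N}}$ of partitions $\alpha_k=\{t^k_0<\dots<t^k_{N_k}\}$ of $[0,T]$ is admissible if $M^{(k)}:=\max_{0\le j\le N_k-1}(t^k_{j+1}-t^k_j)$ is nonincreasing in $k$ and $M^{(k)}\to0$ as $k\to\infty$. **Mild solution (nonlinear equation).** For any admissible sequence $(\alpha_k)_{k\in\mathbb{N}}$ of partitions of $[0,T]$, let $\mu^k$ be the Euler approximation with partition $\alpha_k$ and initial value $\mu_0$. Any limit, in the metric $\sup_{t\in[0,T]}\|\mu_t-\nu_t\|_{\mathrm{BL}}^*$, of a subsequence of $(\mu^k)_{k\in\mathbb{N}}$, for any such $(\alpha_k)$,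 is called a mild solution on $[0,T]$ with initial value $\mu_0$. *)

(* Defs.v *)
From HB Require Import structures.
From mathcomp Require Import all_boot all_order all_algebra.
From mathcomp Require Import interval_inference.
From mathcomp Require Import all_classical all_reals all_analysis.

Set Implicit Arguments.
Unset Strict Implicit.
Unset Printing Implicit Defensive.

Import Order.TTheory GRing.Theory Num.Theory.
Import numFieldNormedType.Exports.

Local Open Scope classical_set_scope.
Local Open Scope ring_scope.
Local Open Scope charge_scope.

(* The space [0,1].  Its Borel sigma-algebra is the trace of the one of R,
   i.e. the sigma-algebra generated by the inclusion [0,1] -> R. *)
Definition unit_itv (R : realType) : Type := {i01 R}.

HB.instance Definition _ (R : realType) :=
  Choice.copy (unit_itv R) {i01 R}.
HB.instance Definition _ (R : realType) :=
  isPointed.Build (unit_itv R) (0%:i01 : {i01 R}).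

Definition unit_itv_val (R : realType) (x : unit_itv R) : R :=
  (x : {i01 R})%:num.

Definition I01 (R : realType) : Type :=
  g_sigma_algebra_preimageType (@unit_itv_val R).

HB.instance Definition _ (R : realType) := Measurable.on (I01 R).

Definition I01val {R : realType} (x : I01 R) : R := unit_itv_val x.

(* The measures in M([0,1]) are charges.  The value of a charge on a
   non-measurable set is irrelevant, so equality in M([0,1]) is [eqM] and not
   Leibniz equality. *)
Notation Meas R := (charge (I01 R) R).

Definition eqM {R : realType} (mu nu : Meas R) : Prop :=
  forall A, measurable A -> mu A = nu A.

(* [x0] when no element satisfies P *)
Definition choose_or {T : Type} (x0 : T) (P : set T) : T :=
  if pselect (exists x, P x) is left exP then sval (cid exP) else x0.

Section measures.
Context {R : realType}.
Implicit Types (mu nu : Meas R) (phi : I01 R -> R).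

Definition hahn_sets mu : set (I01 R) * set (I01 R) :=
  let: exist P exN := cid (Hahn_decomposition mu) in (P, sval (cid exN)).

Lemma hahn_setsP mu :
  hahn_decomposition mu (hahn_sets mu).1 (hahn_sets mu).2.
Proof.
by rewrite /hahn_sets; case: cid => P exN /=; case: cid.
Qed.

Definition TVnorm mu : \bar R := charge_variation (hahn_setsP mu) setT.

Definition charge_integral mu (D : set (I01 R)) phi : \bar R :=
  (\int[jordan_pos (hahn_setsP mu)]_(x in D) (phi x)%:E -
   \int[jordan_neg (hahn_setsP mu)]_(x in D) (phi x)%:E)%E.

Definition pairing mu phi : R := fine (charge_integral mu setT phi).

(* The charge that agrees with a given set function on measurable sets. *)
Definition to_charge (m : set (I01 R) -> \bar R) : Meas R :=
  choose_or (czero : Meas R)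
    [set mu | forall A, measurable A -> mu A = m A].

(* f . mu *)
Definition density (f : I01 R -> R) mu : Meas R :=
  to_charge (fun A => charge_integral mu A f).

End measures.

Section bounded_lipschitz.
Context {R : realType}.
Implicit Types (phi : I01 R -> R).

Definition supnorm phi : \bar R := ereal_sup (range (fun x => `|phi x|%:E)).

(* +oo when phi is not Lipschitz *)
Definition lip_const phi : \bar R :=
  ereal_inf [set L%:E | L in [set L : R | 0 <= L /\
    forall x y, `|phi x - phi y| <= L * `|I01val x - I01val y|]].

Definition BLnorm phi : \bar R := (supnorm phi + lip_const phi)%E.

Definition BL : set (I01 R -> R) := [set phi | (BLnorm phi < +oo)%E].

(* A functional on BL([0,1]) is represented by a total function on I01 R -> R
   of which only the values on BL matter.  M([0,1]) embeds into the functionals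
   by [pairing], and ||mu||_BL^* is the dual norm of [pairing mu]. *)
Definition functional := (I01 R -> R) -> R.
Implicit Types L : functional.

Definition dual_norm L : \bar R :=
  ereal_sup [set `|L phi|%:E | phi in [set phi | (BLnorm phi <= 1)%E]].

(* || mu - nu ||_BL^* *)
Definition BLdist (mu nu : Meas R) : \bar R :=
  dual_norm (pairing mu \- pairing nu).

Definition linear_on_BL L : Prop :=
  forall (a : R) phi psi, BL phi -> BL psi ->
    L (fun x => a * phi x + psi x) = a * L phi + L psi.

(* The completion of M([0,1]) for the norm || . ||_BL^*, realised as the
   closure of M([0,1]) in the (complete) dual of BL([0,1]). *)
Definition completion : set functional :=
  [set L | linear_on_BL L /\
    forall e : R, 0 < e ->
      exists mu : Meas R, (dual_norm (L \- pairing mu)%R <= e%:E)%E].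

End bounded_lipschitz.
Arguments functional R : clear implicits.

Section bochner.
Context {R : realType}.

(* Simple functions on D with values in the completion: sum_i 1_{A_i} L_i. *)
Record simple_function (D : set R) := SimpleFunction {
  sf_size : nat;
  sf_set : 'I_sf_size -> set R;
  sf_val : 'I_sf_size -> functional R;
  sf_measurable : forall i, measurable (sf_set i);
  sf_sub : forall i, sf_set i `<=` D;
  sf_completion : forall i, completion (sf_val i) }.

Definition sf_fun (D : set R) (s : simple_function D) (r : R) :
    functional R :=
  fun phi => \sum_(i < sf_size s) \1_(sf_set i) r * sf_val i phi.

Definition sf_integral (D : set R) (s : simple_function D) : functional R :=
  fun phi =>
    \sum_(i < sf_size s) fine (lebesgue_measure (sf_set i)) * sf_val i phi.

(* F is Bochner integrable on the bounded interval D, with integral L.  The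
   a.e. convergence is the strong measurability of F. *)
Definition is_bochner_integral (D : set R) (F : R -> functional R)
    (L : functional R) : Prop :=
  exists s : nat -> simple_function D,
  [/\ {ae lebesgue_measure, forall r, D r ->
        dual_norm (F r \- sf_fun (s n) r) @[n --> \oo] --> 0%E},
      (\int[lebesgue_measure]_(r in D) dual_norm (F r \- sf_fun (s n) r)%R)%E
        @[n --> \oo] --> 0%E &
      dual_norm (L \- sf_integral (s n)) @[n --> \oo] --> 0%E].

End bochner.

Section stopped_flow.
Context {R : realType}.
Implicit Types (w : I01 R -> R) (J : set R) (x : R -> I01 R).

(* Derivatives are relative to J: one-sided at its end points, and no condition
   when J = {0}. *)
Definition is_ode_solution w (x0 : I01 R) J x : Prop :=
  [/\ is_interval J, J `<=` [set t | 0 <= t], J 0, x 0 = x0 &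
    forall t, J t ->
      (I01val (x s) - I01val (x t)) / (s - t) @[s --> within J t^'] --> w (x t)].

Definition is_maximal_solution w (x0 : I01 R) J x : Prop :=
  is_ode_solution w x0 J x /\
  forall J' x', is_ode_solution w x0 J' x' -> J `<=` J' ->
    (forall t, J t -> x' t = x t) -> J' = J.

Definition maximal_solution w (x0 : I01 R) : set R * (R -> I01 R) :=
  choose_or ([set 0], fun=> x0) [set Jx | is_maximal_solution w x0 Jx.1 Jx.2].

Definition exit_time w (x0 : I01 R) : \bar R :=
  ereal_sup (EFin @` (maximal_solution w x0).1).

(* If t is not in J then J is bounded and the exit time is finite. *)
Definition stopped_flow w (t : R) (x0 : I01 R) : I01 R :=
  let: (J, x) := maximal_solution w x0 in
  if t \in J then x t else x (fine (exit_time w x0)).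

(* P^w_t *)
Definition transport w (t : R) (mu : Meas R) : Meas R :=
  to_charge (pushforward mu (stopped_flow w t)).

End stopped_flow.

Section trajectories.
Context {R : realType}.
Implicit Types (f w : I01 R -> R) (mu : R -> Meas R) (T : R).

(* A trajectory on [0,T] is a function on R of which only the values on [0,T]
   matter. *)
Definition BL_continuous T mu : Prop :=
  forall t, 0 <= t <= T ->
    BLdist (mu s) (mu t) @[s --> within `[0, T] (nbhs t)] --> 0%E.

Definition TV_bounded T mu : Prop :=
  exists C : R, forall t, 0 <= t <= T -> (TVnorm (mu t) <= C%:E)%E.

(* The last condition is the variation of constants formula
     mu_t = P^w_t nu + \int_0^t P^w_(t-s) (f . mu_s) ds
   in the completion. *)
Definition is_linear_solution f w (nu : Meas R) T mu : Prop :=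
  [/\ BL_continuous T mu, TV_bounded T mu &
    forall t, 0 <= t <= T ->
      is_bochner_integral `[0, t]
        (fun s => pairing (transport w (t - s) (density f (mu s))))
        (pairing (mu t) \- pairing (transport w t nu))].

(* Q^w_t nu, read off the solution on [0,t] *)
Definition linear_operator f w (t : R) (nu : Meas R) : Meas R :=
  choose_or (fun=> czero : Meas R)
    [set mu | is_linear_solution f w nu t mu] t.

End trajectories.

Section nonlinear.
Context {R : realType}.
Implicit Types (f : I01 R -> R) (v : Meas R -> I01 R -> R).
Implicit Types (mu : R -> Meas R) (T : R) (a : seq R).

Definition velocity_assumption v : Prop :=
  (forall m, BL (v m)) /\
  forall r : R, 0 < r -> exists K L M : R, forall m n : Meas R,
    (TVnorm m <= r%:E)%E -> (TVnorm n <= r%:E)%E ->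
    [/\ (supnorm (v m) <= K%:E)%E,
        (lip_const (v m) <= L%:E)%E &
        (supnorm (v m \- v n)%R <= M%:E * BLdist m n)%E].

(* The partition {0 = t_0 < t_1 < ... < t_N = T} is encoded, as in
   [itv_partition], by the sequence t_1, ..., t_N. *)
Definition partition_point a (j : nat) : R := nth 0 (0 :: a) j.

Definition mesh a : R :=
  \big[Num.max/0]_(j < size a) (partition_point a j.+1 - partition_point a j).

Definition is_euler_approximation f v T (mu0 : Meas R) a mu : Prop :=
  [/\ BL_continuous T mu, eqM (mu 0) mu0 &
    forall (j : nat) (t : R), (j < size a)%N ->
      partition_point a j < t <= partition_point a j.+1 ->
      eqM (mu t)
        (linear_operator f (v (mu (partition_point a j)))
          (t - partition_point a j) (mu (partition_point a j)))].

Definition admissible T (a : nat -> seq R) : Prop :=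
  [/\ forall k, itv_partition 0 T (a k),
      nonincreasing_seq (mesh \o a) &
      mesh (a k) @[k --> \oo] --> (0 : R)].

Definition is_mild_solution f v T (mu0 : Meas R) mu : Prop :=
  BL_continuous T mu /\
  exists (a : nat -> seq R) (muk : nat -> R -> Meas R) (sigma : nat -> nat),
    [/\ admissible T a,
        forall k, is_euler_approximation f v T mu0 (a k) (muk k),
        increasing_seq sigma &
        ereal_sup [set BLdist (muk (sigma k) t) (mu t) | t in `[0, T]]
          @[k --> \oo] --> 0%E].

Definition is_unique_mild_solution f v T (mu0 : Meas R) mu : Prop :=
  is_mild_solution f v T mu0 mu /\
  forall nu : R -> Meas R, is_mild_solution f v T mu0 nu ->
    forall t, 0 <= t <= T -> eqM (nu t) (mu t).

(* mu : [0,oo) -> M^+([0,1]); the values at negative times are irrelevant. *)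
Definition is_global_mild_solution f v (mu0 : Meas R) mu : Prop :=
  (forall t, 0 <= t -> (mu t).-positive_set [set: I01 R]) /\
  forall T, 0 < T -> is_unique_mild_solution f v T mu0 mu.

End nonlinear.

(* Main.v *)
(** A particle started at [x] moves with the stopped flow and multiplies its mass by
    [exp (\int f)] along its path. The equation with fixed velocity [w] is therefore solved
    by [Q^w_t nu = Phi^w_t # (exp (\int_0^t f (Phi^w_s x) ds) nu)], and a Gronwall argument in
    the dual norm shows that this is its only solution.

    In one dimension the stopped flow is the flow of the constant extension of [w] to the
    real line followed by the projection onto [[0, 1]], hence Lipschitz in the starting point
    and in the velocity. An Euler approximation from [mu0] is thus the image of [mu0] under a
    map sending [x] to (position, log-mass). These maps live in a complete space, where two
    Euler schemes with steps [h] and [h'] stay at distance [C (h + h')] by Gronwall's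
    inequality, the velocity depending on the map through the measure it produces. All
    schemes therefore converge uniformly, with a rate, to one map, and the limit measure is
    its image of [mu0]; no compactness or representation theorem for measures is needed. *)

From HB Require Import structures.
Require Import Defs.
From mathcomp Require Import all_boot all_order all_algebra.
From mathcomp Require Import interval_inference ring lra.
From mathcomp Require Import all_classical all_reals all_analysis.
From mathcomp Require Import measurable_realfun.

Set Implicit Arguments.
Unset Strict Implicit.
Unset Printing Implicit Defensive.

Import Order.TTheory GRing.Theory Num.Theory.
Import numFieldNormedType.Exports.

Local Open Scope classical_set_scope.
Local Open Scope ring_scope.
Local Open Scope charge_scope.

(** * Gronwall's inequality by continuous induction *)

Section gronwall.
Context {R : realType}.

(** The space of measures is not complete for the dual norm, so a Cauchy sequence of Euler
    approximations has no evident limit in it; a uniformly Cauchy sequence of maps into [0, 1] x R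
    has one. Logarithms of masses are recorded because they add up along a trajectory, and because
    the weights [expR] obtained from them are positive, so that a positive [mu0] yields positive
    measures. The bound [expR (F * T) * tv mu0] on the total variation of every scheme fixes in
    advance the radius at which the velocity assumption is used, hence all constants. The velocity
    is nonlocal: it depends on all particles at once. Estimates have to be uniform in the starting
    point, so Gronwall's inequality is set up for a family of functions. The operators [P] and [Q]
    and the density are choices with a default value, and each has to be identified, up to equality
    on measurable sets, before the scheme can be lifted to states; for [Q] this is where uniqueness
    for the linear equation enters. Mild solutions are unique because the rate of convergence
    depends on a partition only through its mesh. *)

Lemma real_induction (P : R -> Prop) (a b : R) : P a ->
  (forall t : R, a <= t < b -> (forall s, a <= s <= t -> P s) ->
    exists2 d : R, 0 < d & forall s : R, t < s < t + d -> s <= b -> P s) ->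
  (forall t, a < t <= b -> (forall s, a <= s < t -> P s) -> P t) ->
  forall t, a <= t <= b -> P t.
Proof.
move=> Pa right left t /andP[a_t tb].
pose S := [set u | a <= u <= b /\ forall s, a <= s <= u -> P s].
have ab : a <= b := le_trans a_t tb.
have Sa : S a.
  split; first by rewrite lexx.
  by move=> s /andP[? ?]; have -> : s = a by apply/eqP; rewrite eq_le; apply/andP.
have supS : has_sup S.
  by split; [exists a | exists b => u [/andP[]]].
pose m := sup S.
have am : a <= m by apply: ub_le_sup => //; exact: supS.2.
have mb : m <= b.
  by apply: ge_sup; [exists a | move=> u [/andP[]]].
have below s : a <= s < m -> P s.
  move=> /andP[a_s sm]; have [u Su su] := sup_gt supS.1 sm.
  by apply: Su.2; rewrite a_s ltW.
have Pm : P m.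
  have [am'|] := ltP a m; first by apply: left => //; rewrite am' mb.
  by move=> ma; have -> : m = a by apply/eqP; rewrite eq_le ma am.
have Pm' s : a <= s <= m -> P s.
  rewrite le_eqVlt (le_eqVlt s) => /andP[/orP[/eqP<- //|a_s]] /orP[/eqP-> //|sm].
  by apply: below; rewrite (ltW a_s).
have [mltb|] := ltP m b; last first.
  by move=> bm; apply: Pm'; rewrite a_t (le_trans tb).
have [d d0 Pd] := right m ltac:(by rewrite am mltb) Pm'.
pose u := Num.min b (m + d / 2).
have mu : m < u by rewrite lt_min mltb ltrDl divr_gt0.
suff : S u by move=> /(ub_le_sup supS.2); rewrite leNgt mu.
split; first by rewrite (le_trans am (ltW mu)) ge_min lexx.
move=> s /andP[a_s su]; have [sm|ms] := leP s m; first by apply: Pm'; rewrite a_s.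
apply: Pd; last by apply: le_trans su _; rewrite ge_min lexx.
rewrite ms /=; apply: le_lt_trans su _; rewrite gt_min; apply/orP; right.
by rewrite ltrD2l; lra.
Qed.

(* The local hypothesis and the conclusion are uniform in [i], so that the
   supremum over [i] never has to be formed. *)
Lemma gronwall (I : Type) (D : I -> R -> R) (a b L c r0 : R) :
  0 <= L -> 0 <= c -> 0 <= r0 ->
  (forall i (t : R), a < t <= b -> forall e : R, 0 < e ->
    exists2 d : R, 0 < d & forall s : R, a <= s -> t - d < s < t -> D i t <= D i s + e) ->
  (forall i, D i a <= r0) ->
  (forall t r : R, a <= t < b -> 0 <= r -> (forall i, D i t <= r) -> forall e : R, 0 < e ->
    exists2 d : R, 0 < d & forall s : R, t < s < t + d -> s <= b -> forall i,
      D i s <= expR (L * (s - t)) * (r + (c + e) * (s - t))) ->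
  forall t, a <= t <= b -> forall i, D i t <= expR (L * (t - a)) * (r0 + c * (t - a)).
Proof.
move=> L0 c0 r00 left D0 right.
(* The local hypothesis holds only up to [e], so the induction is run with slack [e] in the source;
   dividing [e] by [k] makes the total slack at most [e]. *)
suff main e : 0 < e -> forall t, a <= t <= b -> forall i,
    D i t <= expR (L * (t - a)) * (r0 + (c + e) * (t - a)).
  move=> t atb i; have /andP[a_t _] := atb; apply/ler_addgt0Pr => e e0.
  pose k := expR (L * (t - a)) * (t - a) + 1.
  have k0 : 0 < k by rewrite ltr_wpDl// mulr_ge0 ?expR_ge0// subr_ge0.
  apply: le_trans (main (e / k) (divr_gt0 e0 k0) t atb i) _.
  rewrite -subr_ge0.
  rewrite [X in 0 <= X](_ : _ = e / k).
    by rewrite divr_ge0 ?ltW.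
  have ke : e = e / k * k by rewrite divfK// gt_eqF.
  by rewrite {1}ke /k; ring.
move=> e0.
pose g t := expR (L * (t - a)) * (r0 + (c + e) * (t - a)).
have g0 t : a <= t -> 0 <= g t.
  move=> a_t; apply: mulr_ge0; first exact: expR_ge0.
  by apply: addr_ge0 => //; apply: mulr_ge0; rewrite ?subr_ge0// addr_ge0// ltW.
have gm s t : a <= s -> s <= t -> g s <= g t.
  move=> a_s st; apply: ler_pM; first exact: expR_ge0.
  - by apply: addr_ge0 => //; apply: mulr_ge0; rewrite ?subr_ge0// addr_ge0// ltW.
  - by rewrite ler_expR ler_wpM2l// lerD2r.
  - by rewrite lerD2l ler_wpM2l ?lerD2r// addr_ge0// ltW.
apply: real_induction => [i|t atb IH|t /andP[a_t tb] IH i].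
- by rewrite subrr !mulr0 addr0 expR0 mul1r.
- have /andP[a_t tb] := atb.
  have gt i : D i t <= g t by apply: IH; rewrite a_t lexx.
  have [d d0 Hd] := right t (g t) atb (g0 t a_t) gt e e0.
  exists d => // s tsd sb i.
  apply: le_trans (Hd s tsd sb i) _.
  have /andP[ts _] := tsd.
  rewrite [leRHS](_ : _ = expR (L * (s - t)) * (g t + expR (L * (t - a)) * ((c + e) * (s - t)))).
    apply: ler_wpM2l; first exact: expR_ge0.
    rewrite lerD2l; apply: ler_peMl.
      by rewrite mulr_ge0// ?subr_ge0 ?ltW// ltr_wpDl.
    by rewrite -expR0 ler_expR mulr_ge0// subr_ge0.
  rewrite (_ : L * (s - a) = L * (s - t) + L * (t - a)); last by ring.
  by rewrite expRD /g; ring.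
- apply/ler_addgt0Pr => h h0.
  have [d d0 Hd] := left i t ltac:(by rewrite a_t tb) h h0.
  pose s := Num.max a (t - d / 2).
  have a_s : a <= s by rewrite le_max lexx.
  have st : s < t by rewrite gt_max a_t/=; lra.
  have ds : t - d < s by rewrite lt_max; apply/orP; right; lra.
  apply: le_trans (Hd s a_s ltac:(by rewrite ds st)) _.
  rewrite lerD2r; apply: le_trans (gm s t a_s (ltW st)).
  by apply: IH; rewrite a_s.
Qed.

(** Derivative relative to [J] as a first-order expansion: without division or punctured
    neighbourhoods it restricts at once to subsets of [J], which covers one-sided derivatives at end
    points. *)
Definition rel_deriv (J : set R) (y : R -> R) (t v : R) :=
  forall e : R, 0 < e -> exists2 d : R, 0 < d &
    forall s, J s -> `|s - t| < d -> `|y s - y t - (s - t) * v| <= e * `|s - t|.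

Implicit Types (J : set R) (y z : R -> R) (t u v a : R).

Lemma rel_derivS (J J' : set R) y t v : J' `<=` J -> rel_deriv J y t v -> rel_deriv J' y t v.
Proof. by move=> JJ H e e0; have [d d0 Hd] := H e e0; exists d => // s /JJ; exact: Hd. Qed.

Lemma rel_derivP (J : set R) y t v :
  (y s - y t) / (s - t) @[s --> within J t^'] --> v <-> rel_deriv J y t v.
Proof.
split.
- move=> /cvgrPdist_le H e e0; have := H e e0.
  rewrite near_withinE => /= -[d /= d0 Hd]; exists d => // s Js std.
  have [->|st] := eqVneq s t; first by rewrite !subrr mul0r subr0 normr0 mulr0.
  have := Hd s; rewrite /= distrC => /(_ std st Js).
  have st0 : s - t != 0 by rewrite subr_eq0.
  rewrite distrC -(ler_pM2r (x := `|s - t|)) ?normr_gt0// -normrM mulrBl divfK//.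
  by rewrite (mulrC v).
- move=> H; apply/cvgrPdist_le => e e0; have [d d0 Hd] := H e e0.
  rewrite near_withinE; exists d => //= s std st Js.
  have st0 : s - t != 0 by rewrite subr_eq0.
  have := Hd s Js; rewrite (distrC s t) => /(_ std).
  rewrite (distrC v) (distrC t) => h; rewrite -(ler_pM2r (x := `|s - t|)) ?normr_gt0//.
  by rewrite -normrM mulrBl divfK// (mulrC v).
Qed.

Lemma is_derive_rel_deriv (J : set R) y (t v : R) : is_derive t 1 y v -> rel_deriv J y t v.
Proof.
move=> [dy <-] e e0.
have : (fun h : R => h^-1 *: ((y \o shift t) (h *: 1) - y t)) @ 0^' --> 'D_1 y t := dy.
move=> /cvgrPdist_le /(_ e e0) [d /= d0 Hd]; exists d => // s _ sd.
have [->|st] := eqVneq s t; first by rewrite !subrr mul0r subr0 normr0 mulr0.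
have st0 : s - t != 0 by rewrite subr_eq0.
have := Hd (s - t); rewrite /= sub0r normrN => /(_ sd st0).
rewrite [_ *: 1]mulr1 subrK.
set D := 'D_1 y t; rewrite (_ : _ *: _ = (y s - y t) / (s - t)); last by rewrite mulrC.
rewrite distrC -(ler_pM2r (x := `|s - t|)) ?normr_gt0// -normrM mulrBl divfK//.
by rewrite (mulrC D).
Qed.

Lemma rel_deriv_cont (J : set R) y t v : rel_deriv J y t v ->
  forall e : R, 0 < e -> exists2 d : R, 0 < d & forall s, J s -> `|s - t| < d -> `|y s - y t| <= e.
Proof.
move=> H e e0; have [d d0 Hd] := H 1 ltr01.
pose k := `|v| + 1.
have k0 : 0 < k by rewrite ltr_wpDl.
exists (Num.min d (e / k)) => [|s Js]; first by rewrite lt_min d0 divr_gt0.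
rewrite lt_min => /andP[sd se].
have := Hd s Js sd; rewrite mul1r => h.
rewrite (_ : y s - y t = (y s - y t - (s - t) * v) + (s - t) * v); last by ring.
apply: le_trans (ler_normD _ _) _.
rewrite normrM; apply: le_trans (lerD h (lexx _)) _.
by have := ltW se; rewrite ler_pdivlMr// /k; lra.
Qed.

Lemma rel_derivD (J : set R) y z t v u : rel_deriv J y t v -> rel_deriv J z t u ->
  rel_deriv J (fun s => y s + z s) t (v + u).
Proof.
move=> Hy Hz e e0; have e2 : 0 < e / 2 by rewrite divr_gt0.
have [d d0 Hd] := Hy _ e2; have [d' d0' Hd'] := Hz _ e2.
exists (Num.min d d') => [|s Js]; first by rewrite lt_min d0.
rewrite lt_min => /andP[sd sd'].
rewrite /= (_ : _ + _ - _ - _ = (y s - y t - (s - t) * v) + (z s - z t - (s - t) * u));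
  last by ring.
apply: le_trans (ler_normD _ _) _.
by have := Hd s Js sd; have := Hd' s Js sd'; lra.
Qed.

Lemma rel_derivN (J : set R) y t v : rel_deriv J y t v ->
  rel_deriv J (fun s => - y s) t (- v).
Proof.
move=> Hy e e0; have [d d0 Hd] := Hy _ e0; exists d => // s Js sd.
rewrite /= (_ : _ - _ - _ = - (y s - y t - (s - t) * v)); last by ring.
by rewrite normrN Hd.
Qed.

Lemma rel_derivB (J : set R) y z t v u : rel_deriv J y t v -> rel_deriv J z t u ->
  rel_deriv J (fun s => y s - z s) t (v - u).
Proof. by move=> Hy Hz; apply: rel_derivD => //; exact: rel_derivN. Qed.

Lemma rel_deriv_affine (J : set R) (c v a : R) t : rel_deriv J (fun s => c + (s - a) * v) t v.
Proof.
move=> e e0; exists 1 => // s _ _.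
rewrite /= (_ : _ - _ - _ = 0); last by ring.
by rewrite normr0 mulr_ge0 ?normr_ge0 ?ltW.
Qed.

Lemma rel_deriv_shift (J : set R) y a t v : rel_deriv J y (t + a) v ->
  rel_deriv [set s | J (s + a)] (fun s => y (s + a)) t v.
Proof.
move=> H e e0; have [d d0 Hd] := H _ e0; exists d => // s Js sd.
have E : s - t = (s + a) - (t + a) by ring.
by rewrite E; apply: Hd => //; rewrite -E.
Qed.

(** [|u|] need not be differentiable, but over a short time it grows by at most
    [(s - r) * (L * q + c)] plus a small error, and [1 + x <= expR x] turns this into the local
    hypothesis of [gronwall]. *)
Lemma rel_deriv_gronwall (u du : R -> R) (a b L c : R) :
  0 <= L -> 0 <= c ->
  (forall t : R, a <= t <= b -> rel_deriv `[a, b] u t (du t)) ->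
  (forall t : R, a <= t <= b -> `|du t| <= L * `|u t| + c) ->
  forall t, a <= t <= b -> `|u t| <= expR (L * (t - a)) * (`|u a| + c * (t - a)).
Proof.
move=> L0 c0 Hd Hb t atb.
apply: (@gronwall unit (fun _ t => `|u t|) a b L c `|u a|) => //.
- move=> _ r /andP[ar rb] e e0.
  have [d d0 H] := rel_deriv_cont (Hd r ltac:(by rewrite (ltW ar))) e0.
  exists d => // s a_s /andP[ds sr].
  have sd' : - (s - r) < d by rewrite opprB ltrBlDl addrC -ltrBlDl.
  have := H s ltac:(by rewrite /= in_itv/= a_s (le_trans (ltW sr))).
  rewrite ler0_norm; last by rewrite subr_le0 ltW.
  move=> /(_ sd') h.
  by have := lerB_dist (u r) (u s); rewrite distrC; lra.
- move=> r q /andP[ar rb] q0 Hq e e0; have arb : a <= r <= b by rewrite ar ltW.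
  have [d d0 H] := Hd r arb e e0; exists d => // s /andP[rs sd] sb _.
  have rs0 : 0 <= s - r by rewrite subr_ge0 ltW.
  have sd' : s - r < d by rewrite ltrBlDl.
  have := H s ltac:(by rewrite /= in_itv/= sb (le_trans ar (ltW rs))).
  rewrite ger0_norm// => /(_ sd') h.
  have {}Hq := Hq tt.
  have h1 : `|u s| <= q + (s - r) * (L * q + c) + e * (s - r).
    rewrite (_ : u s = u r + (s - r) * du r + (u s - u r - (s - r) * du r)); last by ring.
    apply: le_trans (ler_normD _ _) _; apply: lerD => //.
    apply: le_trans (ler_normD _ _) _; apply: lerD => //.
    rewrite normrM ger0_norm// ler_wpM2l//.
    by apply: le_trans (Hb r arb) _; rewrite lerD2r ler_wpM2l.
  apply: le_trans h1 _.
  have h2 : 1 + L * (s - r) <= expR (L * (s - r)) by exact: expR_ge1Dx.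
  have h3 : 0 <= L * (s - r) by rewrite mulr_ge0.
  have h4 : 0 <= (c + e) * (s - r) by rewrite mulr_ge0// addr_ge0// ltW.
  apply: (@le_trans _ _ ((1 + L * (s - r)) * (q + (c + e) * (s - r)))); last first.
    by apply: ler_wpM2r => //; rewrite addr_ge0.
  rewrite -subr_ge0 [X in 0 <= X](_ : _ = L * (s - r) * ((c + e) * (s - r))); last by ring.
  by rewrite mulr_ge0.
Qed.

Lemma rel_deriv_le (u du : R -> R) (a b c : R) :
  a <= b -> 0 <= c ->
  (forall t : R, a <= t <= b -> rel_deriv `[a, b] u t (du t)) ->
  (forall t : R, a <= t <= b -> `|du t| <= c) -> `|u b - u a| <= c * (b - a).
Proof.
move=> ab c0 Hd Hb.
have H := @rel_deriv_gronwall (fun t => u t - u a) du a b 0 c (lexx _) c0.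
have := H _ _ b; rewrite subrr normr0 add0r mul0r expR0 mul1r; apply.
- move=> t /Hd; move=> h e e0; have [d d0 H'] := h e e0; exists d => // s Js sd.
  by rewrite opprB addrA subrK; exact: H'.
- by move=> t /Hb; rewrite mul0r add0r.
- by rewrite ab lexx.
Qed.

(** The derivative is controlled only at or above the level [m]. Strictly below it continuity keeps
    [u] under [m] for a short time, which is enough because [gronwall] only has to propagate
    nonnegative bounds. *)
Lemma barrier (u du : R -> R) (a b m L : R) : a <= b -> 0 <= L -> u a <= m ->
  (forall t : R, a <= t <= b -> rel_deriv `[a, b] u t (du t)) ->
  (forall t : R, a <= t <= b -> m <= u t -> du t <= L * (u t - m)) -> u b <= m.
Proof.
move=> ab L0 uam Hd Hb; rewrite -subr_le0.
have -> : 0 = expR (L * (b - a)) * (0 + 0 * (b - a)) by rewrite mul0r addr0 mulr0.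
apply: (@gronwall unit (fun _ t => u t - m) a b L 0 0) => //; last first.
- by rewrite ab lexx.
- move=> r q /andP[ar rb] q0 Hq e e0; have arb : a <= r <= b by rewrite ar ltW.
  have {}Hq := Hq tt.
  have [urm|mur] := ltP (u r) m.
    have mu0 : 0 < m - u r by rewrite subr_gt0.
    have [d d0 H] := rel_deriv_cont (Hd r arb) mu0.
    exists d => // s /andP[rs sd] sb _.
    have sd' : `|s - r| < d by rewrite ger0_norm ?subr_ge0 1?ltW// ltrBlDl.
    have h := H s ltac:(by rewrite /= in_itv/= sb (le_trans ar (ltW rs))) sd'.
    have {}h := le_trans (ler_norm _) h.
    apply: (@le_trans _ _ 0); first by lra.
    rewrite mulr_ge0// ?expR_ge0// addr_ge0// mulr_ge0//.
      by rewrite add0r ltW.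
    by rewrite subr_ge0 ltW.
  have [d d0 H] := Hd r arb e e0; exists d => // s /andP[rs sd] sb _.
  have rs0 : 0 <= s - r by rewrite subr_ge0 ltW.
  have sd' : s - r < d by rewrite ltrBlDl.
  have := H s ltac:(by rewrite /= in_itv/= sb (le_trans ar (ltW rs))).
  rewrite ger0_norm// => /(_ sd') /(le_trans (ler_norm _)) h.
  have h1 : (s - r) * du r <= (s - r) * (L * q).
    rewrite ler_wpM2l//; apply: le_trans (Hb r arb mur) _.
    by rewrite ler_wpM2l.
  have h2 : 1 + L * (s - r) <= expR (L * (s - r)) by exact: expR_ge1Dx.
  have h3 : 0 <= L * (s - r) by rewrite mulr_ge0.
  have h4 : 0 <= (0 + e) * (s - r) by rewrite mulr_ge0// add0r ltW.
  apply: (@le_trans _ _ ((1 + L * (s - r)) * (q + (0 + e) * (s - r)))); last first.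
    by apply: ler_wpM2r => //; rewrite addr_ge0.
  have h5 : 0 <= L * (s - r) * ((0 + e) * (s - r)) by rewrite mulr_ge0.
  by lra.
- by rewrite subr_le0.
- move=> _ r /andP[ar rb] e e0.
  have [d d0 H] := rel_deriv_cont (Hd r ltac:(by rewrite (ltW ar))) e0.
  exists d => // s a_s /andP[ds sr].
  have sd' : - (s - r) < d by rewrite opprB ltrBlDl addrC -ltrBlDl.
  have := H s ltac:(by rewrite /= in_itv/= a_s (le_trans (ltW sr))).
  rewrite ler0_norm; last by rewrite subr_le0 ltW.
  by move=> /(_ sd'); rewrite distrC => /(le_trans (ler_norm _)); lra.
Qed.

End gronwall.

(** * Picard iteration *)

Section flow.
Context {R : realType}.

Lemma cauchy_lim (u : nat -> R) (e : nat -> R) (N : nat) :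
  (forall n m, (N <= n <= m)%N -> `|u n - u m| <= e n) -> e n @[n --> \oo] --> 0 ->
  forall n, (N <= n)%N -> `|u n - lim (u @ \oo)| <= e n.
Proof.
move=> ue e0; have cu : cvgn u.
  apply/cauchy_cvgP/cauchy_ballP => eps eps0.
  move/cvgrPdist_lt : e0 => /(_ (eps / 2) ltac:(by rewrite divr_gt0)) [N' _ HN].
  pose n0 := maxn N N'; have Nn0 : (N <= n0)%N := leq_maxl _ _.
  have HN' : `|e n0| < eps / 2.
    by have := HN n0 (leq_maxr _ _); rewrite /= sub0r normrN.
  exists ([set u n | n in [set n | (n0 <= n)%N]], [set u n | n in [set n | (n0 <= n)%N]]).
    by split; exists n0 => // n /= Nn; exists n.
  move=> [_ _] /= [[n Nn <-] [m Nm <-]]; rewrite /ball /=.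
  have := ler_norm (e n0); have := ue n0 n; have := ue n0 m; rewrite Nn0 Nn Nm.
  move=> /(_ isT) h1 /(_ isT) h2.
  have := ler_distD (u n0) (u n) (u m); rewrite (distrC (u n) (u n0)); lra.
move=> n Nn; apply/ler_addgt0Pr => eps eps0.
have /cvgrPdist_le/(_ eps eps0) [N' _ HN] : u m @[m --> \oo] --> lim (u @ \oo) by [].
have := HN (maxn n N') (leq_maxr _ _).
have := ue n (maxn n N'); rewrite Nn leq_maxl => /(_ isT).
have := ler_distD (u (maxn n N')) (u n) (lim (u @ \oo)).
rewrite /= (distrC (u (maxn n N')) (lim _)); lra.
Qed.

Lemma le_cvg0 (a b : R) (e : nat -> R) : (forall n, a <= b + e n) ->
  e n @[n --> \oo] --> 0 -> a <= b.
Proof.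
move=> ab e0; apply/ler_addgt0Pr => d d0.
move/cvgrPdist_le : e0 => /(_ d d0) [N _ /(_ N (leqnn N))].
by rewrite /= sub0r normrN => /(le_trans (ler_norm _)); have := ab N; lra.
Qed.

Lemma cvg_geo0 (c : R) : c * (1 / 2) ^+ n @[n --> \oo] --> (0 : R).
Proof.
rewrite -[0](mulr0 c); apply: cvgMr.
by apply: cvg_expr; rewrite ger0_norm ?divr_ge0//; lra.
Qed.

Lemma prim_ex (h : R -> R) (K : R) : 0 <= K ->
  (forall s t : R, 0 <= s -> 0 <= t -> `|h s - h t| <= K * `|s - t|) ->
  exists H : R -> R, H 0 = 0 /\ forall t : R, 0 <= t -> rel_deriv [set s | 0 <= s] H t (h t).
Proof.
(* Extending [h] by [h 0] to negative times and integrating from -1 makes 0 an interior point, so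
   that the two-sided fundamental theorem of calculus also applies at [t = 0]. *)
move=> K0' hK; pose h' s := h (Num.max s 0).
have ch' : continuous h'.
  move=> x; apply/cvgrPdist_le => e e0.
  have K0 : 0 < K + 1 by rewrite ltr_wpDl.
  exists (e / (K + 1)) => /=; first by rewrite divr_gt0.
  move=> y /= xy; apply: le_trans (hK _ _ _ _) _; rewrite ?le_max ?lexx ?orbT//.
  have xy' : `|Num.max x 0 - Num.max y 0| <= `|x - y|.
    have := ler_norm (x - y); have := ler_norm (- (x - y)); rewrite normrN ler_norml.
    by case: (leP x 0); case: (leP y 0); lra.
  apply: (@le_trans _ _ ((K + 1) * `|x - y|)).
    by apply: ler_pM => //; rewrite lerDl.
  by rewrite mulrC -ler_pdivlMr// ltW.
pose F x := \int[lebesgue_measure]_(t in `[-1, x]) h' t.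
exists (fun x => F x - F 0); split; first by rewrite subrr.
move=> t t0.
have [] := @continuous_FTC1_closed R h' (-1) t (t + 1).
- by rewrite ltrDl.
- apply: continuous_compact_integrable; first exact: segment_compact.
  by apply: continuous_subspaceT => x; exact: ch'.
- by apply: lt_le_trans t0; rewrite oppr_lt0.
- exact: ch'.
- move=> dF; rewrite derive1E => DF.
  have : rel_deriv [set s | 0 <= s] F t (h t).
    apply: is_derive_rel_deriv; split => //; rewrite DF /h'; congr h.
    by apply/max_idPl.
  by move=> H e e0; have [d d0 Hd] := H e e0; exists d => // s s0 sd; rewrite opprB addrA subrK;
    exact: Hd.
Qed.

Definition prim (h : R -> R) : R -> R := choose_or (fun=> 0)
  [set H | H 0 = 0 /\ forall t : R, 0 <= t -> rel_deriv [set s | 0 <= s] H t (h t)].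

Lemma choose_orP T (x0 : T) (P : set T) : (exists x, P x) -> P (choose_or x0 P).
Proof. by rewrite /choose_or => exP; case: pselect => // ex; case: cid. Qed.

Lemma primP (h : R -> R) (K : R) : 0 <= K ->
  (forall s t : R, 0 <= s -> 0 <= t -> `|h s - h t| <= K * `|s - t|) ->
  prim h 0 = 0 /\ forall t : R, 0 <= t -> rel_deriv [set s | 0 <= s] (prim h) t (h t).
Proof. by move=> K0 hK; apply: (@choose_orP _ (fun=> 0) _ (prim_ex K0 hK)). Qed.

Lemma clamp_ge0 (z : R) : 0 <= Num.max 0 (Num.min z 1).
Proof. by rewrite le_max lexx. Qed.

Lemma clamp_le1 (z : R) : Num.max 0 (Num.min z 1) <= 1.
Proof. by rewrite ge_max ler01 ge_min lexx orbT. Qed.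

Definition clamp (z : R) : I01 R := Itv01 (clamp_ge0 z) (clamp_le1 z).

Lemma I01val_ge0 (x : I01 R) : 0 <= I01val x.
Proof. by rewrite /I01val /unit_itv_val. Qed.

Lemma I01val_le1 (x : I01 R) : I01val x <= 1.
Proof. by rewrite /I01val /unit_itv_val. Qed.

Lemma I01val_inj : injective (@I01val R).
Proof. by move=> x y xy; apply: val_inj. Qed.

Lemma clampE (z : R) : I01val (clamp z) = Num.max 0 (Num.min z 1).
Proof. by []. Qed.

Lemma clampK (x : I01 R) : clamp (I01val x) = x.
Proof.
apply: I01val_inj; rewrite clampE.
by move: (I01val_ge0 x) (I01val_le1 x) => /max_idPr + /min_idPl => + ->.
Qed.

Lemma clamp_val (z : R) : 0 <= z <= 1 -> I01val (clamp z) = z.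
Proof. by case/andP => /max_idPr z0 /min_idPl z1; rewrite clampE z1. Qed.

Lemma clamp_lip (y z : R) : `|I01val (clamp y) - I01val (clamp z)| <= `|y - z|.
Proof.
rewrite !clampE ler_norml.
have := ler_norm (y - z); have := ler_norm (- (y - z)); rewrite normrN.
case: (leP y 1); case: (leP z 1) => ? ?.
all: try case: (leP 0 y) => ?; try case: (leP 0 z) => ?; try case: (leP (0:R) 1) => ?; lra.
Qed.

Lemma clamp_eq0 (z : R) : z <= 0 -> I01val (clamp z) = 0.
Proof.
by move=> z0; rewrite clampE (min_idPl (le_trans z0 ler01)); apply/max_idPl.
Qed.

Lemma clamp_eq1 (z : R) : 1 <= z -> I01val (clamp z) = 1.
Proof. by move=> z1; rewrite clampE (min_idPr z1); apply/max_idPr. Qed.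

Definition sup_le (phi : I01 R -> R) (a : R) := forall x, `|phi x| <= a.

Definition lip_le (phi : I01 R -> R) (b : R) :=
  forall x y, `|phi x - phi y| <= b * `|I01val x - I01val y|.

Lemma sup_le_ge0 phi a : sup_le phi a -> 0 <= a.
Proof. by move=> h; apply: le_trans (h (clamp 0)). Qed.

Lemma lip_le_ge0 phi b : lip_le phi b -> 0 <= b.
Proof.
move=> /(_ (clamp 0) (clamp 1)) /(le_trans (normr_ge0 _)).
by rewrite clamp_eq0// clamp_eq1// sub0r normrN normr1 mulr1.
Qed.

Section picard.
Variables (w : I01 R -> R) (K L x0 : R).
Hypotheses (wK : sup_le w K) (wL : lip_le w L) (L0 : 0 < L).
Let nonneg := [set s : R | 0 <= s].

Let K0 : 0 <= K := sup_le_ge0 wK.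

Definition Lip (y : R -> R) :=
  forall s t : R, 0 <= s -> 0 <= t -> `|y s - y t| <= K * `|s - t|.

Definition picard (y : R -> R) (t : R) := x0 + prim (fun s => w (clamp (y s))) t.

Let wy_lip y : Lip y -> forall s t : R, 0 <= s -> 0 <= t ->
  `|w (clamp (y s)) - w (clamp (y t))| <= (L * K) * `|s - t|.
Proof.
move=> yK s t s0 t0; apply: le_trans (wL _ _) _; rewrite -mulrA ler_wpM2l ?(ltW L0)//.
exact: le_trans (clamp_lip _ _) (yK _ _ s0 t0).
Qed.

Lemma picard0 y : Lip y -> picard y 0 = x0.
Proof.
move=> /wy_lip h; have [] := primP _ h; first by rewrite mulr_ge0// ltW.
by rewrite /picard => -> _; rewrite addr0.
Qed.

Lemma picard_deriv y : Lip y -> forall t : R, 0 <= t ->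
  rel_deriv nonneg (picard y) t (w (clamp (y t))).
Proof.
move=> /wy_lip h t t0; have [] := primP _ h; first by rewrite mulr_ge0// ltW.
move=> _ /(_ t t0) H e e0; have [d d0 Hd] := H e e0; exists d => // s s0 sd.
by rewrite /picard opprD addrACA subrr add0r; exact: Hd.
Qed.

Lemma rel_deriv_Lip (y dy : R -> R) (C : R) : 0 <= C ->
  (forall t : R, 0 <= t -> rel_deriv nonneg y t (dy t)) ->
  (forall t : R, 0 <= t -> `|dy t| <= C) ->
  forall s t : R, 0 <= s -> 0 <= t -> `|y s - y t| <= C * `|s - t|.
Proof.
move=> C0 Hd Hb s t s0 t0; wlog st : s t s0 t0 / s <= t.
  move=> W; have [/W|/ltW/W] := leP s t; first exact.
  by rewrite distrC (distrC t); apply.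
rewrite distrC (distrC s) (ger0_norm (_ : 0 <= t - s)) ?subr_ge0//.
apply: (rel_deriv_le (du := dy)) => // r /andP[sr _].
  apply: rel_derivS (Hd r (le_trans s0 sr)) => u /=.
  by rewrite in_itv/= => /andP[su _]; exact: le_trans su.
exact: Hb (le_trans s0 sr).
Qed.

Lemma picard_Lip y : Lip y -> Lip (picard y).
Proof.
move=> yK; apply: (rel_deriv_Lip (dy := fun t => w (clamp (y t)))) => //.
exact: picard_deriv.
Qed.

Lemma rel_deriv_expR (J : set R) (c t : R) :
  rel_deriv J (fun s => expR (c * s)) t (c * expR (c * t)).
Proof.
apply: is_derive_rel_deriv.
have h : is_derive t 1 ( *%R c) c.
  have := @is_deriveZ R R R id c t 1 1 (is_derive_id _ _).
  by rewrite [_ *: 1]mulr1.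
by have := is_derive1_comp (is_derive_expR (c * t)) h; rewrite (mulrC _ c).
Qed.

(* The weight [expR (2 L t)] makes the Picard map a contraction on the half-line. *)
Lemma picard_contract y z (c : R) : 0 <= c -> Lip y -> Lip z ->
  (forall t, 0 <= t -> `|y t - z t| <= c * expR (2 * L * t)) ->
  forall t, 0 <= t -> `|picard y t - picard z t| <= c / 2 * expR (2 * L * t).
Proof.
move=> c0 yK zK yz.
suff main y' z' : Lip y' -> Lip z' ->
    (forall t, 0 <= t -> `|y' t - z' t| <= c * expR (2 * L * t)) ->
    forall t, 0 <= t -> picard y' t - picard z' t <= c / 2 * expR (2 * L * t).
  move=> t t0; rewrite ler_norml (main y z)// andbT lerNl opprB (main z y)// => s s0.
  by rewrite distrC; exact: yz.
move: y' z' => {yK zK yz}y {}z yK zK yz t t0; rewrite -subr_le0.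
pose u s := (picard y s - picard z s) - c / 2 * expR (2 * L * s).
pose du s := (w (clamp (y s)) - w (clamp (z s))) - c / 2 * (2 * L * expR (2 * L * s)).
(* The derivative of the subtracted bound is [c * L * expR (2 * L * t)], exactly the Lipschitz bound
   on the difference of the two velocities. Hence [du <= 0], and [u] starts at or below 0. *)
apply: (@barrier R u du 0 t 0 0) => //.
- by rewrite /u !picard0// subrr sub0r oppr_le0 mulr_ge0 ?expR_ge0// divr_ge0.
- move=> s /andP[s0 _].
  have sub : `[0, t] `<=` nonneg by move=> r /=; rewrite in_itv/= => /andP[].
  apply: rel_derivS sub _.
  apply: rel_derivB; first by apply: rel_derivB; exact: picard_deriv.
  move=> e e0; have k0 : 0 < c / 2 + 1 by rewrite ltr_wpDl// divr_ge0.
  have [d d0 Hd] := rel_deriv_expR setT (2 * L) s (divr_gt0 e0 k0).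
  exists d => // r _ rs; have := Hd r I rs => h.
  rewrite (_ : _ - _ = c / 2 * (expR (2 * L * r) - expR (2 * L * s) - (r - s) * (2 * L * expR (2
    * L * s)))); last by ring.
  rewrite normrM ger0_norm ?divr_ge0//.
  apply: le_trans (ler_wpM2l (_ : 0 <= c / 2) h) _; first by rewrite divr_ge0.
  rewrite mulrA; apply: ler_wpM2r => //; rewrite mulrCA ler_piMr ?(ltW e0)// ltW//.
  by rewrite ltr_pdivrMr// mul1r ltrDl.
- move=> s /andP[s0 _] _; rewrite mul0r /du subr_le0.
  apply: le_trans (ler_norm _) _; apply: le_trans (wL _ _) _.
  rewrite [leRHS](_ : _ = L * (c * expR (2 * L * s))); last by field.
  rewrite ler_wpM2l ?(ltW L0)//; exact: le_trans (clamp_lip _ _) (yz _ s0).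
Qed.

Lemma picard_solution : exists y : R -> R, y 0 = x0 /\
  forall t, 0 <= t -> rel_deriv nonneg y t (w (clamp (y t))).
Proof.
pose y n := iter n picard (fun=> x0).
have yK n : Lip (y n).
  elim: n => [|n]; last exact: picard_Lip.
  by move=> s t _ _; rewrite subrr normr0 mulr_ge0.
(* With this [c] the first increment is at most [K * t = c * (2 * L * t)], which lies below
   [c * expR (2 * L * t)]. *)
pose c := K / (2 * L).
have c0 : 0 <= c by rewrite divr_ge0// mulr_ge0// ltW.
have step n t : 0 <= t -> `|y n.+1 t - y n t| <= c / 2 ^+ n * expR (2 * L * t).
  elim: n t => [|n IH] t t0.
    have /(_ t 0 t0 (lexx _)) := yK 1%N; rewrite subr0 (_ : y 1%N 0 = x0);
      last exact: picard0 (yK 0%N).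
    move=> /le_trans; apply; rewrite expr0 divr1 ger0_norm//.
    rewrite (_ : K * t = c * (2 * L * t)); last by rewrite /c; field; rewrite gt_eqF.
    apply: ler_wpM2l => //; apply: le_trans (expR_ge1Dx _); lra.
  have := @picard_contract (y n.+1) (y n) _ _ (yK _) (yK _) IH t t0.
  by rewrite exprS invfM mulrA -(mulrAC c); apply; rewrite divr_ge0.
have cauchy t : 0 <= t -> forall n m, (0 <= n <= m)%N ->
    `|y n t - y m t| <= 2 * c * expR (2 * L * t) * (1 / 2) ^+ n.
  move=> t0 n m /= nm.
  suff : `|y n t - y m t| <= 2 * c * expR (2 * L * t) * ((1 / 2) ^+ n - (1 / 2) ^+ m).
    move=> /le_trans; apply; rewrite ler_wpM2l//.
      by rewrite mulr_ge0 ?expR_ge0// mulr_ge0.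
    by rewrite gerBl exprn_ge0// divr_ge0.
  elim: m nm => [|m IH]; first by rewrite leqn0 => /eqP ->; rewrite !subrr normr0 mulr0.
  rewrite leq_eqVlt => /orP[/eqP->|]; first by rewrite !subrr normr0 mulr0.
  rewrite ltnS => /IH {IH} h; apply: le_trans (ler_distD (y m t) _ _) _.
  apply: le_trans (lerD h (_ : _ <= c * (1 / 2) ^+ m * expR (2 * L * t))) _.
    by rewrite distrC div1r exprVn; exact: step.
  rewrite exprS; set q := (1 / 2) ^+ m; set q' := (1 / 2) ^+ n; set E := expR _; lra.
pose z t := lim (y n t @[n --> \oo]).
have zy n t : 0 <= t -> `|y n t - z t| <= 2 * c * expR (2 * L * t) * (1 / 2) ^+ n.
  by move=> t0; apply: (cauchy_lim (cauchy t t0)) => //; exact: cvg_geo0.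
have zK : Lip z.
  move=> s t s0 t0.
  pose C := 2 * c * expR (2 * L * s) + 2 * c * expR (2 * L * t).
  apply: (@le_cvg0 _ _ (fun n => C * (1 / 2) ^+ n)) => [n|]; last exact: cvg_geo0.
  have := ler_distD (y n s) (z s) (z t); have := ler_distD (y n t) (y n s) (z t).
  have := zy n s s0; have := zy n t t0; have := yK n s t s0 t0.
  rewrite (distrC (z s) (y n s)) /C; lra.
have zfix t : 0 <= t -> picard z t = z t.
  move=> t0; apply/eqP; rewrite -subr_eq0 -normr_le0.
  apply: (@le_cvg0 _ _ (fun n => 2 * c * expR (2 * L * t) * (1 / 2) ^+ n)) => [n|];
    last exact: cvg_geo0.
  have cn : 0 <= 2 * c * (1 / 2) ^+ n
    by rewrite mulr_ge0 ?(mulr_ge0 (ler0n _ 2))//; apply: exprn_ge0; lra.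
  have h s : 0 <= s -> `|z s - y n s| <= 2 * c * (1 / 2) ^+ n * expR (2 * L * s).
    by move=> s0; rewrite distrC mulrAC; exact: zy.
  have h3 : `|picard z t - y n.+1 t| <= _ := picard_contract cn zK (yK n) h t0.
  have := zy n.+1 t t0; rewrite exprS => h2.
  apply: le_trans (ler_distD (y n.+1 t) _ _) _; rewrite add0r.
  apply: le_trans (lerD h3 h2) _.
  by set q := (1 / 2) ^+ n; set E := expR _; lra.
(* [picard z] has the required derivative by construction and agrees with [z] at nonnegative
   times. *)
exists (picard z); split; first exact: picard0.
by move=> t t0; rewrite zfix//; exact: picard_deriv.
Qed.
End picard.
End flow.

(** * The stopped flow *)

Section flow.
Context {R : realType}.
Implicit Types (phi w f : I01 R -> R) (x : I01 R).
Let nonneg := [set s : R | 0 <= s].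

Lemma supnormP phi (a : R) : (supnorm phi <= a%:E)%E <-> sup_le phi a.
Proof.
split => [h x|h].
  have : (`|phi x|%:E <= a%:E)%E by apply: le_trans h; apply: ereal_sup_ubound; exists x.
  by rewrite lee_fin.
by apply: ge_ereal_sup => _ [x _ <-]; rewrite lee_fin.
Qed.

Lemma lip_constP phi (b : R) : (lip_const phi <= b%:E)%E <-> lip_le phi b.
Proof.
split => [h x y|h]; last first.
  by apply: ereal_inf_lbound; exists b => //; split => //; exact: lip_le_ge0 h.
have [->|xy] := eqVneq x y; first by rewrite !subrr normr0 mulr0.
have d0 : 0 < `|I01val x - I01val y|.
  by rewrite normr_gt0 subr_eq0; apply: contra_neq xy => /(@I01val_inj R).
rewrite -ler_pdivrMr// -lee_fin; apply: le_trans h.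
apply: le_ereal_inf_tmp => _ [c [_ hc] <-].
by rewrite lee_fin ler_pdivrMr.
Qed.

Lemma supnorm_ge0 phi : (0 <= supnorm phi)%E.
Proof.
apply: le_trans (_ : `|phi (clamp 0)|%:E <= _)%E; first by rewrite lee_fin.
by apply: ereal_sup_ubound; exists (clamp 0).
Qed.

Lemma lip_const_ge0 phi : (0 <= lip_const phi)%E.
Proof. by apply: le_ereal_inf_tmp => _ [c [c0 _] <-]; rewrite lee_fin. Qed.

Lemma BLnorm_le phi (a b : R) : sup_le phi a -> lip_le phi b -> (BLnorm phi <= (a + b)%:E)%E.
Proof. by move=> /supnormP ha /lip_constP hb; rewrite EFinD; exact: leeD. Qed.

Lemma BLnorm_leP phi (c : R) : (BLnorm phi <= c%:E)%E ->
  exists a b : R, [/\ 0 <= a, 0 <= b, a + b <= c, sup_le phi a & lip_le phi b].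
Proof.
rewrite /BLnorm; have := supnorm_ge0 phi; have := lip_const_ge0 phi.
case ea : (supnorm phi) => [a||]; case eb : (lip_const phi) => [b||] //= b0 a0.
rewrite -EFinD lee_fin => abc; exists a, b; split => //.
- by apply/supnormP; rewrite ea.
- by apply/lip_constP; rewrite eb.
Qed.

Lemma BLP phi : BL phi <-> exists a b : R, sup_le phi a /\ lip_le phi b.
Proof.
split=> [h|[a [b [ha hb]]]]; last by apply: le_lt_trans (BLnorm_le ha hb) _; rewrite ltry.
have fin : (BLnorm phi <= (fine (BLnorm phi))%:E)%E.
  by rewrite fineK// ge0_fin_numE// adde_ge0 ?supnorm_ge0 ?lip_const_ge0.
by have [a [b [_ _ _ ha hb]]] := BLnorm_leP fin; exists a, b.
Qed.

Lemma lip_leW phi (b c : R) : b <= c -> lip_le phi b -> lip_le phi c.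
Proof. by move=> bc h x y; apply: le_trans (h x y) _; rewrite ler_wpM2r. Qed.

Definition ext_solution w x (y : R -> R) := y 0 = I01val x /\
  forall t : R, 0 <= t -> rel_deriv nonneg y t (w (clamp (y t))).

(* The trajectory of the constant extension of [w] to the real line. *)
Definition ext_flow w x : R -> R := choose_or (fun=> 0) (ext_solution w x).

Definition flow w (t : R) x : I01 R := clamp (ext_flow w x t).

Lemma ext_flowP w x : BL w -> ext_solution w x (ext_flow w x).
Proof.
move=> /BLP[K [L [wK wL]]]; apply: choose_orP.
apply: (@picard_solution R w K (L + 1)) => //; first by apply: lip_leW wL; rewrite lerDl.
by rewrite ltr_wpDl// (lip_le_ge0 wL).
Qed.

Lemma ext_flow0_ge0 w x : BL w -> 0 <= ext_flow w x 0.
Proof. by move=> /(ext_flowP x)[-> _]; exact: I01val_ge0. Qed.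

Lemma ext_flow0_le1 w x : BL w -> ext_flow w x 0 <= 1.
Proof. by move=> /(ext_flowP x)[-> _]; exact: I01val_le1. Qed.

Lemma itv_nonneg (a b : R) : 0 <= a -> `[a, b] `<=` nonneg.
Proof. by move=> a0 s /=; rewrite in_itv/= => /andP[as_ _]; exact: le_trans a0 as_. Qed.

(** Formulated on a compact interval, so that it also applies to time-shifted trajectories and to
    solutions that exist only for a finite time. *)
Lemma solution_dist w w' (L c : R) (y y' : R -> R) (b : R) : lip_le w L -> 0 <= b ->
  (forall x, `|w x - w' x| <= c) ->
  (forall t : R, 0 <= t <= b -> rel_deriv `[0, b] y t (w (clamp (y t)))) ->
  (forall t : R, 0 <= t <= b -> rel_deriv `[0, b] y' t (w' (clamp (y' t)))) ->
  `|y b - y' b| <= expR (L * b) * (`|y 0 - y' 0| + c * b).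
Proof.
move=> wL b0 wc hy hy'.
have c0 : 0 <= c by apply: le_trans (wc (clamp 0)).
pose u t := y t - y' t; pose du t := w (clamp (y t)) - w' (clamp (y' t)).
have := @rel_deriv_gronwall R u du 0 b L c (lip_le_ge0 wL) c0 _ _ b.
rewrite subr0; apply; last by rewrite b0 lexx.
  by move=> t tb; apply: rel_derivB; [exact: hy|exact: hy'].
move=> t tb; rewrite /du (_ : _ - _ = (w (clamp (y t)) - w (clamp (y' t))) +
  (w (clamp (y' t)) - w' (clamp (y' t)))); last by ring.
apply: le_trans (ler_normD _ _) _; apply: lerD => //.
apply: le_trans (wL _ _) _; apply: ler_wpM2l; first exact: lip_le_ge0 wL.
exact: clamp_lip.
Qed.

Lemma solution_unique w (y y' : R -> R) (b : R) : BL w -> 0 <= b ->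
  (forall t : R, 0 <= t <= b -> rel_deriv `[0, b] y t (w (clamp (y t)))) ->
  (forall t : R, 0 <= t <= b -> rel_deriv `[0, b] y' t (w (clamp (y' t)))) ->
  y 0 = y' 0 -> y b = y' b.
Proof.
move=> /BLP[K [L [wK wL]]] b0 hy hy' yy'; apply/eqP; rewrite -subr_eq0 -normr_le0.
have := @solution_dist w w L 0 y y' b wL b0 _ hy hy'.
rewrite yy' subrr normr0 mul0r addr0 mulr0; apply => x.
by rewrite subrr normr0.
Qed.

Lemma ext_flow_deriv w x (a b : R) : BL w -> 0 <= a -> forall t : R, a <= t <= b ->
  rel_deriv `[a, b] (ext_flow w x) t (w (clamp (ext_flow w x t))).
Proof.
move=> bw a0 t /andP[a_t _]; have [_ H] := ext_flowP x bw.
by apply: rel_derivS (H t (le_trans a0 a_t)); exact: itv_nonneg.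
Qed.

Lemma flow_dist w w' (L c : R) x x' (t : R) : BL w -> BL w' -> lip_le w L -> 0 <= t ->
  (forall z, `|w z - w' z| <= c) ->
  `|I01val (flow w t x) - I01val (flow w' t x')| <=
    expR (L * t) * (`|I01val x - I01val x'| + c * t).
Proof.
move=> bw bw' wL t0 wc; apply: le_trans (clamp_lip _ _) _.
have [+ _] := ext_flowP x bw; have [+ _] := ext_flowP x' bw'; move=> <- <-.
by apply: (solution_dist wL t0 wc); apply: ext_flow_deriv.
Qed.

Lemma flow0 w x : BL w -> flow w 0 x = x.
Proof. by move=> bw; rewrite /flow (ext_flowP x bw).1 clampK. Qed.

Lemma flow_lip_time w (K : R) x (s t : R) : BL w -> sup_le w K -> 0 <= s -> 0 <= t ->
  `|I01val (flow w s x) - I01val (flow w t x)| <= K * `|s - t|.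
Proof.
move=> bw wK s0 t0; apply: le_trans (clamp_lip _ _) _.
apply: (rel_deriv_Lip (dy := fun t => w (clamp (ext_flow w x t)))) => //.
  exact: sup_le_ge0 wK.
by have [] := ext_flowP x bw.
Qed.

(** * Behaviour of the extended trajectories at the end points of [0, 1] *)

Section boundary.
Variables (w : I01 R -> R) (x : I01 R) (r t : R).
Hypotheses (bw : BL w) (r0 : 0 <= r) (rt : r <= t).
Let y := ext_flow w x.

Let hy : forall s : R, r <= s <= t -> rel_deriv `[r, t] y s (w (clamp (y s))).
Proof. exact: ext_flow_deriv. Qed.

Let hNy : forall s : R, r <= s <= t ->
  rel_deriv `[r, t] (fun s => - y s) s (- w (clamp (y s))).
Proof. by move=> s /hy/rel_derivN. Qed.

(** At and above 1 the extended velocity is the constant [w (clamp 1)], so its sign alone decides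
    whether 1 can be crossed upwards. *)
Lemma le1_invariant : w (clamp 1) <= 0 -> y r <= 1 -> y t <= 1.
Proof.
move=> w1 yr; apply: (barrier rt (lexx 0) yr hy) => s _ y1.
by rewrite mul0r (_ : clamp (y s) = clamp 1)//; apply: I01val_inj; rewrite !clamp_eq1.
Qed.

Lemma ge0_invariant : 0 <= w (clamp 0) -> 0 <= y r -> 0 <= y t.
Proof.
move=> w1; rewrite -oppr_le0 => yr; rewrite -oppr_le0.
apply: (barrier rt (lexx 0) yr hNy) => s _; rewrite oppr_ge0 => y1.
by rewrite mul0r oppr_le0 (_ : clamp (y s) = clamp 0)//; apply: I01val_inj; rewrite !clamp_eq0.
Qed.

(** Below 1 the velocity may be negative, but by the Lipschitz bound only by [L] times the distance
    to 1, which is the rate that [barrier] tolerates. *)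
Lemma ge1_absorbing : 0 <= w (clamp 1) -> 1 <= y r -> 1 <= y t.
Proof.
have /BLP[K [L [wK wL]]] := bw.
move=> w1; rewrite -lerN2 => yr; rewrite -lerN2.
apply: (barrier rt (lip_le_ge0 wL) yr hNy) => s _; rewrite lerN2 => y1.
have := wL (clamp 1) (clamp (y s)).
have /(ler_wpM2l (lip_le_ge0 wL)) := clamp_lip 1 (y s).
rewrite (ger0_norm (_ : 0 <= 1 - y s)) ?subr_ge0//.
have := ler_norm (w (clamp 1) - w (clamp (y s))); lra.
Qed.

Lemma le0_absorbing : w (clamp 0) <= 0 -> y r <= 0 -> y t <= 0.
Proof.
have /BLP[K [L [wK wL]]] := bw.
move=> w1 yr; apply: (barrier rt (lip_le_ge0 wL) yr hy) => s _ y1.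
have := wL (clamp (y s)) (clamp 0).
have /(ler_wpM2l (lip_le_ge0 wL)) := clamp_lip (y s) 0.
rewrite (ger0_norm (_ : 0 <= y s - 0)) ?subr0//.
have := ler_norm (w (clamp (y s)) - w (clamp 0)); lra.
Qed.

End boundary.

(** Having exceeded 1 at some time rules out [w (clamp 1) <= 0] by [le1_invariant]; with the
    opposite sign the region above 1 is absorbing. *)
Lemma exit1 w x (r t : R) : BL w -> 0 <= r -> r <= t -> 1 < ext_flow w x r ->
  1 <= ext_flow w x t.
Proof.
move=> bw r0 rt yr; have [w1|/ltW w1] := leP (w (clamp 1)) 0.
  have := le1_invariant bw (lexx 0) r0 w1 (ext_flow0_le1 x bw).
  by rewrite leNgt yr.
by apply: (ge1_absorbing bw r0 rt w1); exact: ltW.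
Qed.

Lemma exit0 w x (r t : R) : BL w -> 0 <= r -> r <= t -> ext_flow w x r < 0 ->
  ext_flow w x t <= 0.
Proof.
move=> bw r0 rt yr; have [w1|/ltW w1] := leP 0 (w (clamp 0)).
  have := ge0_invariant bw (lexx 0) r0 w1 (ext_flow0_ge0 x bw).
  by rewrite leNgt yr.
by apply: (le0_absorbing bw r0 rt w1); exact: ltW.
Qed.

(** If the extended trajectory is inside [0, 1] at time [s], restarting it continues it, by
    uniqueness. If it is outside, [clamp] restarts it from an end point, and both trajectories
    remain beyond that end point, so they have the same clamped value. *)
Lemma flowD w x (s t : R) : BL w -> 0 <= s -> 0 <= t ->
  flow w t (flow w s x) = flow w (s + t) x.
Proof.
move=> bw s0 t0.
have sst : s <= s + t by rewrite lerDl.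
have [ys0|ys0] := ltP (ext_flow w x s) 0.
  have w0 : w (clamp 0) <= 0.
    rewrite leNgt; apply/negP => /ltW w0.
    have := ge0_invariant bw (lexx 0) s0 w0 (ext_flow0_ge0 x bw).
    by rewrite leNgt ys0.
  apply: I01val_inj; rewrite !clamp_eq0//; first exact: exit0 ys0.
  apply: (le0_absorbing bw (lexx 0) t0 w0); rewrite (ext_flowP _ bw).1 clamp_eq0//.
  exact: ltW.
have [ys1|ys1] := ltP 1 (ext_flow w x s).
  have w1 : 0 <= w (clamp 1).
    rewrite leNgt; apply/negP => /ltW w1.
    have := le1_invariant bw (lexx 0) s0 w1 (ext_flow0_le1 x bw).
    by rewrite leNgt ys1.
  apply: I01val_inj; rewrite !clamp_eq1//; first exact: exit1 ys1.
  apply: (ge1_absorbing bw (lexx 0) t0 w1); rewrite (ext_flowP _ bw).1 clamp_eq1//.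
  exact: ltW.
rewrite /flow; congr clamp.
rewrite (addrC s); apply: (@solution_unique w _ (fun r => ext_flow w x (r + s))) => //.
- exact: ext_flow_deriv.
- move=> r /andP[rr _].
  have [_ /(_ (r + s) (addr_ge0 rr s0)) /rel_deriv_shift] := ext_flowP x bw.
  apply: rel_derivS => q /(itv_nonneg (lexx _)) q0; exact: addr_ge0.
- by rewrite add0r (ext_flowP _ bw).1 clamp_val// ys0.
Qed.

(** * The maximal solution and the stopped flow *)

Section stopped.
Variables (w : I01 R -> R) (x : I01 R).
Hypothesis bw : BL w.
Let y := ext_flow w x.
(** The times before and at which the extended trajectory has not left [0, 1]; this turns out to be
    the maximal interval of existence. *)
Let J0 : set R := [set t | 0 <= t /\ forall s, 0 <= s <= t -> 0 <= y s <= 1].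

Let J00 : J0 0.
Proof.
split => // s s0; have -> : s = 0 by apply/eqP; rewrite eq_le andbC.
by rewrite /y ext_flow0_ge0// ext_flow0_le1.
Qed.

(** [clamp] undoes the inclusion of [0, 1], so a solution with values in [0, 1] also solves the
    extended equation, and uniqueness identifies it. *)
Lemma ode_solution_ext_flow J z : is_ode_solution w x J z ->
  forall t, J t -> I01val (z t) = y t.
Proof.
move=> [Jitv Jpos J0' z0 dz] t Jt; have t0 : 0 <= t := Jpos t Jt.
have sub : `[0, t] `<=` J.
  by move=> s /=; rewrite in_itv/= => st; exact: (Jitv _ _ J0' Jt _ st).
apply: (@solution_unique w (I01val \o z) y t bw t0).
- move=> s st; apply: (rel_derivS sub).
  have Js : J s by apply: sub; rewrite /= in_itv.
  by rewrite /= clampK; apply/rel_derivP; exact: dz.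
- exact: ext_flow_deriv.
- by rewrite /= z0 /y (ext_flowP x bw).1.
Qed.

Let solution_sub J z : is_ode_solution w x J z -> J `<=` J0.
Proof.
move=> sol t Jt; have [Jitv Jpos J0' _ _] := sol.
split=> [|s st]; first exact: Jpos.
have Js : J s by exact: (Jitv _ _ J0' Jt _ st).
by rewrite -(ode_solution_ext_flow sol Js) I01val_ge0 I01val_le1.
Qed.

Let J0_solution : is_ode_solution w x J0 (clamp \o y).
Proof.
split => //.
- move=> a b [a0 _] [b0 hb] c /andP[ac cb]; split => [|s /andP[s0 sc]].
    exact: le_trans ac.
  by apply: hb; rewrite s0 (le_trans sc).
- by move=> t [].
- by rewrite /= /y (ext_flowP x bw).1 clampK.
- move=> t J0t; apply/rel_derivP => e e0; have [t0 _] := J0t.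
  have [_ /(_ t t0 e e0) [d d0 Hd]] := ext_flowP x bw.
  have yJ s : J0 s -> I01val (clamp (y s)) = y s.
    by move=> [s0 hs]; rewrite clamp_val// hs// s0 lexx.
  exists d => // s J0s sd.
  change (`|I01val (clamp (y s)) - I01val (clamp (y t)) - (s - t) * w (clamp (y t))|
    <= e * `|s - t|).
  by rewrite !yJ//; apply: Hd => //; have [] := J0s.
Qed.

Let maximalP : is_maximal_solution w x (maximal_solution w x).1 (maximal_solution w x).2.
Proof.
apply: (@choose_orP _ _ [set Jx | is_maximal_solution w x Jx.1 Jx.2]).
exists (J0, clamp \o y); split; first exact: J0_solution.
move=> J' z sol sub _; apply/seteqP; split => //; exact: solution_sub sol.
Qed.

(** Every solution lives on a subset of [J0] and agrees there with [ext_flow], which is itself a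
    solution on [J0]; maximality leaves only [J0]. *)
Lemma maximal_solutionE : (maximal_solution w x).1 = J0 /\
  forall t, J0 t -> (maximal_solution w x).2 t = clamp (y t).
Proof.
case: maximalP; case: (maximal_solution w x) => J z /= sol max.
have JJ0 : J = J0.
  apply/esym/(max _ (clamp \o y)) => //; first exact: solution_sub sol.
  by move=> t Jt /=; rewrite -(ode_solution_ext_flow sol Jt) clampK.
split=> // t; rewrite -JJ0 => Jt.
by rewrite -(ode_solution_ext_flow sol Jt) clampK.
Qed.

Lemma J0P t : 0 <= t -> ~ J0 t -> exists2 s, 0 <= s <= t & ~~ (0 <= y s <= 1).
Proof.
move=> t0 nJ; apply: contrapT => h; apply: nJ; split => // s st.
by apply: contrapT => /negP hs; apply: h; exists s.
Qed.

(* Once the extended trajectory has left [0, 1], it stays beyond the same end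
   point, so stopping amounts to clamping. *)
Lemma stopped_flowE t : 0 <= t -> stopped_flow w t x = flow w t x.
Proof.
move=> t0; rewrite /stopped_flow /exit_time.
have [] := maximal_solutionE; case: (maximal_solution w x) => J z /= -> hz.
case: ifPn => [/set_mem/hz//|]; rewrite notin_setE => nJt.
have [s0 /andP[s00 s0t] ys0] := J0P t0 nJt.
have bound r : J0 r -> r <= s0.
  move=> [r0 hr]; rewrite leNgt; apply/negP => sr.
  by move: ys0; rewrite hr// s00 ltW.
have supJ : has_sup J0 by split; [exists 0; exact: J00 | exists s0 => r /bound].
pose m := sup J0.
have m0 : 0 <= m by apply: ub_le_sup => //; exact: supJ.2.
have mt : m <= t by apply: ge_sup; [exists 0; exact: J00|move=> r /bound /le_trans; apply].
rewrite (_ : ereal_sup _ = m%:E) /=; last first.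
  by rewrite ereal_sup_EFin //; case: supJ.
have below r : 0 <= r -> r < m -> 0 <= y r <= 1.
  move=> r0 rm; have [q [q0 hq] rq] := sup_gt supJ.1 rm.
  by apply: hq; rewrite r0 ltW.
have ycont (e : R) : 0 < e -> exists2 d : R, 0 < d &
    forall r, 0 <= r -> `|r - m| < d -> `|y r - y m| <= e.
  move=> e0; have [_ /(_ m m0)] := ext_flowP x bw.
  by move=> /rel_deriv_cont /(_ e e0).
(* The supremum is attained, since [0, 1] is closed and the trajectory is continuous. *)
have Jm : J0 m.
  split => // s /andP[s0' sm]; move: sm; rewrite le_eqVlt => /orP[/eqP->|]; last exact: below.
  have [m00|m_gt0] := leP m 0.
    have -> : m = 0 by apply/eqP; rewrite eq_le m00.
    by rewrite /y ext_flow0_ge0// ext_flow0_le1.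
  suff near_m (e : R) : 0 < e -> - e <= y m <= 1 + e.
    apply/andP; split; apply/ler_addgt0Pr => e e0; have /andP[] := near_m e e0; lra.
  move=> e0; have [d d0 Hd] := ycont e e0.
  pose r := Num.max 0 (m - d / 2).
  have r0 : 0 <= r by rewrite le_max lexx.
  have rm : r < m by rewrite gt_max m_gt0/=; lra.
  have dr : m - d < r by rewrite lt_max; apply/orP; right; lra.
  have rd : `|r - m| < d by rewrite ler0_norm ?subr_le0 ?(ltW rm)//; lra.
  have := Hd r r0 rd; have /andP[] := below r r0 rm.
  rewrite ler_norml => ? ? /andP[]; lra.
rewrite hz// /flow.
have mt' : m < t.
  by rewrite lt_neqAle mt andbT; apply/eqP => mE; apply: nJt; rewrite -mE.
(* No time after [m] lies in [J0], so the trajectory is outside [0, 1] at times arbitrarily close to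
   [m] on the right. *)
have exits (q : R) : m < q -> q <= t -> exists2 s, m < s <= q & ~~ (0 <= y s <= 1).
  move=> mq qt; have nJq : ~ J0 q by move=> /(ub_le_sup supJ.2); rewrite leNgt mq.
  have [s /andP[s0' sq] ys] := J0P (le_trans m0 (ltW mq)) nJq.
  exists s => //; rewrite sq andbT ltNge; apply/negP => sm.
  by move: ys; have [_ hm] := Jm; rewrite hm// s0'.
have [s1 /andP[ms1 s1t] ys1] := exits t mt' (lexx _).
have s10 : 0 <= s1 := le_trans m0 (ltW ms1).
have /andP[ym0 ym1] : 0 <= y m <= 1 by have [_ ->] := Jm; rewrite // m0 lexx.
move: ys1; rewrite negb_and -!ltNge => /orP[ys1|ys1].
- have yt : y t <= 0 by apply: exit0 ys1.
  suff ym : y m <= 0 by apply: I01val_inj; rewrite !clamp_eq0.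
  (* If [y m] were positive, an exit shortly after [m] would be through 1, and [exit1] would keep
     the trajectory at or above 1 up to [s1], where it is negative. *)
  rewrite leNgt; apply/negP => ym.
  have [d d0 Hd] := ycont (y m / 2) ltac:(by rewrite divr_gt0).
  pose q := Num.min s1 (m + d / 2).
  have mq : m < q by rewrite lt_min ms1 ltrDl divr_gt0.
  have qs : q <= s1 by rewrite ge_min lexx.
  have [s /andP[ms sq] ys] := exits q mq (le_trans qs s1t).
  have sd : s <= m + d / 2 by apply: le_trans sq _; rewrite ge_min lexx orbT.
  have s_0 : 0 <= s := le_trans m0 (ltW ms).
  have sm : `|s - m| < d by rewrite ger0_norm ?subr_ge0 ?(ltW ms)//; lra.
  have := Hd s s_0 sm; rewrite ler_norml => /andP[h _].
  move: ys; rewrite negb_and -!ltNge => /orP[ys|ys]; first by lra.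
  have := exit1 bw s_0 (le_trans sq qs) ys; rewrite -/y => h1; lra.
- have yt : 1 <= y t by apply: exit1 ys1.
  suff ym : 1 <= y m by apply: I01val_inj; rewrite !clamp_eq1.
  rewrite leNgt; apply/negP => ym.
  have ym' : 0 < (1 - y m) / 2 by rewrite divr_gt0// subr_gt0.
  have [d d0 Hd] := ycont _ ym'.
  pose q := Num.min s1 (m + d / 2).
  have mq : m < q by rewrite lt_min ms1 ltrDl divr_gt0.
  have qs : q <= s1 by rewrite ge_min lexx.
  have [s /andP[ms sq] ys] := exits q mq (le_trans qs s1t).
  have sd : s <= m + d / 2 by apply: le_trans sq _; rewrite ge_min lexx orbT.
  have s_0 : 0 <= s := le_trans m0 (ltW ms).
  have sm : `|s - m| < d by rewrite ger0_norm ?subr_ge0 ?(ltW ms)//; lra.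
  have := Hd s s_0 sm; rewrite ler_norml => /andP[_ h].
  move: ys; rewrite negb_and -!ltNge => /orP[ys|ys]; last by lra.
  have := exit0 bw s_0 (le_trans sq qs) ys; rewrite -/y => h1; lra.
Qed.

End stopped.

End flow.

(** * Pairing charges with functions *)

Section measures.
Context {R : realType}.
Implicit Types (mu nu : Meas R) (phi psi : I01 R -> R).

Lemma measurable_I01val : measurable_fun setT (@I01val R).
Proof. by move=> _ B mB; exists B. Qed.

Lemma continuous_of_lip (g : R -> R) (b : R) :
  (forall x y, `|g x - g y| <= b * `|x - y|) -> continuous g.
Proof.
move=> gb x; apply/cvgrPdist_le => e e0.
have k0 : 0 < `|b| + 1 by rewrite ltr_wpDl.
exists (e / (`|b| + 1)) => /=; first by rewrite divr_gt0.
move=> y /= xy; apply: le_trans (gb _ _) _.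
apply: (@le_trans _ _ ((`|b| + 1) * `|x - y|)).
  by apply: ler_wpM2r => //; have := ler_norm b; lra.
by rewrite mulrC -ler_pdivlMr// ltW.
Qed.

Lemma lip_measurable phi (b : R) : lip_le phi b -> measurable_fun setT phi.
Proof.
move=> hb; rewrite (_ : phi = (phi \o clamp) \o @I01val R); last first.
  by apply/funext => x /=; rewrite clampK.
apply: measurableT_comp measurable_I01val.
apply: continuous_measurable_fun; apply: (@continuous_of_lip _ b) => x y.
apply: le_trans (hb _ _) _; rewrite ler_wpM2l ?(lip_le_ge0 hb)//.
exact: clamp_lip.
Qed.

Lemma lip_I01_measurable (h : I01 R -> I01 R) (b : R) :
  (forall x y, `|I01val (h x) - I01val (h y)| <= b * `|I01val x - I01val y|) ->
  measurable_fun setT h.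
Proof.
move=> hb _ _ [B mB <-].
have := lip_measurable (hb : lip_le (@I01val R \o h) b) measurableT mB.
by rewrite !setTI.
Qed.

(** On this class both Jordan integrals are finite, so the [fine] in [pairing] loses nothing and
    [pairing] is linear. *)
Definition bounded_measurable phi := measurable_fun setT phi /\ exists a, sup_le phi a.

Lemma BL_bounded_measurable phi : BL phi -> bounded_measurable phi.
Proof. by move=> /BLP[a [b [ha hb]]]; split; [exact: lip_measurable hb|exists a]. Qed.

Lemma bounded_measurable_lin (c : R) phi psi : bounded_measurable phi ->
  bounded_measurable psi -> bounded_measurable (fun x => c * phi x + psi x).
Proof.
move=> [mp [a ha]] [mq [b hb]]; split.
  by apply: measurable_funD => //; apply: measurable_funM => //; exact: measurable_cst.
exists (`|c| * a + b) => x; apply: le_trans (ler_normD _ _) _.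
by apply: lerD => //; rewrite normrM ler_wpM2l.
Qed.

Lemma bounded_measurableM phi psi : bounded_measurable phi ->
  bounded_measurable psi -> bounded_measurable (fun x => phi x * psi x).
Proof.
move=> [mp [a ha]] [mq [b hb]]; split; first exact: measurable_funM.
by exists (a * b) => x; rewrite normrM ler_pM.
Qed.

Lemma bounded_measurable_comp phi (h : I01 R -> I01 R) : measurable_fun setT h ->
  bounded_measurable phi -> bounded_measurable (phi \o h).
Proof.
by move=> mh [mp [a ha]]; split; [exact: measurableT_comp|exists a => x /=].
Qed.

Lemma bounded_measurable_cst (c : R) : bounded_measurable (fun=> c).
Proof. by split; [exact: measurable_cst|exists `|c| => x]. Qed.

Lemma bounded_measurable_indic (A : set (I01 R)) : measurable A ->
  bounded_measurable (\1_A : I01 R -> R).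
Proof.
move=> mA; split; first exact: measurable_indic.
by exists 1 => x; rewrite indicE; case: (_ \in _); rewrite ?normr1 ?normr0.
Qed.

Lemma bounded_measurable_integrable (m : {finite_measure set (I01 R) -> \bar R}) phi :
  bounded_measurable phi -> m.-integrable setT (EFin \o phi).
Proof.
move=> [mp [a ha]]; apply: measurable_bounded_integrable => //.
  by rewrite -ge0_fin_numE// fin_num_measure.
exists a; split; first by rewrite num_real.
by move=> b ab x _; exact: le_trans (ha x) (ltW ab).
Qed.

Local Notation mpos mu := (jordan_pos (hahn_setsP mu)).
Local Notation mneg mu := (jordan_neg (hahn_setsP mu)).

Lemma pairingE mu phi : bounded_measurable phi ->
  pairing mu phi = \int[mpos mu]_x phi x - \int[mneg mu]_x phi x.
Proof.
move=> mp; rewrite /pairing /charge_integral fineB//; apply: integrable_fin_num => //.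
  exact: bounded_measurable_integrable.
exact: bounded_measurable_integrable.
Qed.

Lemma pairing_lin mu (c : R) phi psi : bounded_measurable phi -> bounded_measurable psi ->
  pairing mu (fun x => c * phi x + psi x) = c * pairing mu phi + pairing mu psi.
Proof.
move=> mp mq; rewrite !pairingE//; last exact: bounded_measurable_lin.
have H (m : {finite_measure set (I01 R) -> \bar R}) :
    \int[m]_x (c * phi x + psi x) = c * \int[m]_x phi x + \int[m]_x psi x.
  have ip := bounded_measurable_integrable m mp; have iq := bounded_measurable_integrable m mq.
  rewrite RintegralD// ?RintegralZl//.
  have := bounded_measurable_integrable m (bounded_measurable_lin c mp (bounded_measurable_cst 0)).
  by under eq_fun do rewrite addr0.
by rewrite !H; ring.
Qed.

Definition tv mu : R := fine (TVnorm mu).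

Lemma TVnormE mu : TVnorm mu = (tv mu)%:E.
Proof. by rewrite fineK// /TVnorm /charge_variation fin_numD !fin_num_measure. Qed.

Lemma tv_ge0 mu : 0 <= tv mu.
Proof. by rewrite -lee_fin -TVnormE adde_ge0. Qed.

Lemma pairing_bound mu phi (a : R) : bounded_measurable phi -> sup_le phi a ->
  `|pairing mu phi| <= a * tv mu.
Proof.
move=> mp pa; rewrite pairingE//.
have H (m : {finite_measure set (I01 R) -> \bar R}) :
    `|\int[m]_x phi x| <= a * fine (m setT).
  have ip := bounded_measurable_integrable m mp.
  apply: le_trans (le_normr_Rintegral _ ip) _ => //.
  rewrite -Rintegral_cst//; apply: le_Rintegral => //.
  - have mabs : bounded_measurable (fun x => `|phi x|).
      by split; [apply: measurableT_comp => //; exact: mp.1|exists a => x; rewrite normr_id].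
    exact: bounded_measurable_integrable mabs.
  - exact: bounded_measurable_integrable (bounded_measurable_cst a).
apply: le_trans (ler_normB _ _) _; apply: le_trans (lerD (H _) (H _)) _.
rewrite -mulrDr /tv /TVnorm /charge_variation fineD//; exact: fin_num_measure.
Qed.

Lemma pairing0 mu : pairing mu (fun=> 0) = 0.
Proof.
apply/eqP; rewrite -normr_le0 -[leRHS](mul0r (tv mu)); apply: pairing_bound.
  exact: bounded_measurable_cst.
by move=> x; rewrite normr0.
Qed.

Lemma pairing_indic mu (A : set (I01 R)) : measurable A ->
  pairing mu (\1_A) = fine (mu A).
Proof.
move=> mA; rewrite /pairing /charge_integral !integral_indic// !setIT.
rewrite (jordan_decomp (hahn_setsP mu) mA) /cadd /= /cscale /=.
by rewrite EFinN mulN1e.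
Qed.

(** The sum counts the positive multiples of [h] up to [s]: it is [s] rounded down to the grid of
    step [h]. *)
Lemma layer_cake (h s : R) (N : nat) : 0 < h -> 0 <= s -> s <= N%:R * h ->
  0 <= s - \sum_(i < N) h * (i.+1%:R * h <= s)%R%:R <= h.
Proof.
move=> h0 s0 sN; pose S n := \sum_(i < n) h * (i.+1%:R * h <= s)%R%:R.
suff main n : [/\ S n <= s, (n%:R * h <= s -> S n = n%:R * h) &
    (s <= n%:R * h -> s <= S n + h)].
  by have [H1 _ /(_ sN) H3] := main N; rewrite -/(S N); apply/andP; split; lra.
elim: n => [|n [IH1 IH2 IH3]].
  rewrite /S big_ord0; split => //; first by rewrite mul0r.
  by rewrite mul0r; lra.
have -> : S n.+1 = S n + h * (n.+1%:R * h <= s)%R%:R by rewrite /S big_ord_recr.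
have nh : n.+1%:R * h = n%:R * h + h by rewrite -natr1; ring.
case: (leP (n.+1%:R * h) s) => hs; rewrite ?mulr1 ?mulr0 ?addr0.
  have Sn : S n = n%:R * h by apply: IH2; rewrite nh in hs; lra.
  by rewrite Sn; split; rewrite -?nh// => ?; lra.
split => //.
move=> _; case: (leP (n%:R * h) s) => ns; first by rewrite IH2//; rewrite nh in hs; lra.
by apply: IH3; exact: ltW.
Qed.

(* Bounded measurable functions are uniform limits of finite combinations of
   indicators; this replaces every change of variables below. *)
Lemma functional_eq mu (L : functional R) (C : R) :
  (forall (c : R) phi psi, bounded_measurable phi -> bounded_measurable psi ->
    L (fun x => c * phi x + psi x) = c * L phi + L psi) ->
  (forall phi a, bounded_measurable phi -> sup_le phi a -> `|L phi| <= a * C) ->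
  (forall A, measurable A -> L (\1_A) = fine (mu A)) ->
  forall phi, bounded_measurable phi -> pairing mu phi = L phi.
Proof.
move=> Llin Lb Lind phi mp; have [mphi [a ha]] := mp.
have a0 : 0 <= a := sup_le_ge0 ha.
have C0 : 0 <= C.
  rewrite -[C]mul1r; apply: le_trans (Lb (fun=> 1) 1 (bounded_measurable_cst 1) _) => //.
  by move=> x; rewrite normr1.
pose G psi := pairing mu psi - L psi.
have Glin c psi psi' : bounded_measurable psi -> bounded_measurable psi' ->
    G (fun x => c * psi x + psi' x) = c * G psi + G psi'.
  by move=> h1 h2; rewrite /G pairing_lin// Llin//; ring.
have Gind A : measurable A -> G (\1_A) = 0.
  by move=> mA; rewrite /G pairing_indic// Lind// subrr.
have Gb psi b : bounded_measurable psi -> sup_le psi b -> `|G psi| <= b * (tv mu + C).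
  move=> h1 h2; apply: le_trans (ler_normB _ _) _; rewrite mulrDr.
  by apply: lerD; [exact: pairing_bound|exact: Lb].
have G0 : G (fun=> 0) = 0.
  apply/eqP; rewrite -normr_le0 -[leRHS](mul0r (tv mu + C)); apply: Gb.
    exact: bounded_measurable_cst.
  by move=> x; rewrite normr0.
suff : `|G phi| <= 0 by rewrite normr_le0 /G subr_eq0 => /eqP.
(* The shift makes [phi + a'] nonnegative for [layer_cake]; taking [a + 1] instead of [a] keeps the
   step [h] positive when [a = 0]. *)
pose a' := a + 1.
have approx (N : nat) : exists psi, [/\ bounded_measurable psi, G psi = 0 &
    sup_le (fun x => -1 * psi x + phi x) (2 * a' / N.+1%:R)].
  pose h := 2 * a' / N.+1%:R.
  have h0 : 0 < h by rewrite divr_gt0// mulr_gt0// ltr_wpDl.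
  pose A i := [set x | i.+1%:R * h <= phi x + a'].
  have mA i : measurable (A i).
    rewrite (_ : A i = phi @^-1` `[i.+1%:R * h - a', +oo[); last first.
      by apply/seteqP; split=> x /=; rewrite in_itv/= andbT lerBlDr.
    by rewrite -[X in measurable X]setTI; exact: mphi.
  pose S n x := \sum_(i < n) h * \1_(A i) x - a'.
  have mS n : bounded_measurable (S n) /\ G (S n) = 0.
    elim: n => [|n [IH1 IH2]].
      have -> : S 0%N = fun x => (- a') * \1_setT x + 0.
        by apply/funext => x; rewrite /S big_ord0 indicT /=; ring.
      have mT := bounded_measurable_indic (@measurableT _ (I01 R)).
      split; first exact: bounded_measurable_lin (bounded_measurable_cst 0).
      by rewrite Glin ?Gind ?G0 ?mulr0 ?addr0//; exact: bounded_measurable_cst.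
    have -> : S n.+1 = fun x => h * \1_(A n) x + S n x.
      by apply/funext => x; rewrite /S big_ord_recr /=; ring.
    split; first exact: bounded_measurable_lin (bounded_measurable_indic _) _.
    by rewrite Glin ?Gind ?IH2 ?mulr0 ?addr0//; exact: bounded_measurable_indic.
  exists (S N.+1); have [H1 H2] := mS N.+1; split => // x.
  have := ha x; rewrite ler_norml => /andP[p1 p2].
  have := @layer_cake h (phi x + a') N.+1 h0.
  have Nh : N.+1%:R * h = 2 * a' by rewrite mulrC divfK.
  rewrite Nh => /(_ ltac:(rewrite /a'; lra) ltac:(rewrite /a'; lra)).
  rewrite -/h (_ : -1 * S N.+1 x + phi x =
    phi x + a' - \sum_(i < N.+1) h * (i.+1%:R * h <= phi x + a')%R%:R).
    by move=> /andP[q1 q2]; rewrite ger0_norm.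
  rewrite /S (eq_bigr (fun i : 'I_N.+1 => h * (i.+1%:R * h <= phi x + a')%R%:R)); first by ring.
  move=> i _; rewrite indicE; congr (_ * (nat_of_bool _)%:R).
  by apply/idP/idP => [/set_mem//|h1]; exact/mem_set.
apply: (@le_cvg0 R _ _ (fun n => 2 * a' * (tv mu + C) * harmonic n)); last first.
  by rewrite -[0](mulr0 (2 * a' * (tv mu + C))); apply: cvgMr; exact: cvg_harmonic.
move=> n; rewrite add0r; have [psi [h1 h2 h3]] := approx n.
have := Gb _ _ (bounded_measurable_lin (-1) h1 mp) h3.
by rewrite Glin// h2 mulr0 add0r mulrAC.
Qed.

Lemma eqM_pairing mu nu phi : eqM mu nu -> bounded_measurable phi ->
  pairing mu phi = pairing nu phi.
Proof.
move=> mn; apply: (@functional_eq mu (pairing nu) (tv nu)).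
- by move=> c f g; exact: pairing_lin.
- by move=> f a; exact: pairing_bound.
- by move=> A mA; rewrite pairing_indic// mn.
Qed.

(** [to_charge] falls back to the zero charge, so a charge with the prescribed values has to be
    exhibited before the choice is of any use. *)
Lemma to_chargeP (m : set (I01 R) -> \bar R) :
  (exists mu, forall A, measurable A -> mu A = m A) ->
  forall A, measurable A -> to_charge m A = m A.
Proof.
move=> exmu; have := @choose_orP _ (czero : Meas R) [set mu | forall A, measurable A ->
  mu A = m A] exmu.
exact.
Qed.

Lemma densityE (f : I01 R -> R) mu A : bounded_measurable f -> measurable A ->
  density f mu A = charge_integral mu A f.
Proof.
move=> mf mA; apply: (@to_chargeP (fun A => charge_integral mu A f)) => //.
pose ipos := bounded_measurable_integrable (mpos mu) mf.
pose ineg := bounded_measurable_integrable (mneg mu) mf.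
exists (cadd (induced_charge ipos) (cscale (-1) (induced_charge ineg))) => B mB.
rewrite -[LHS]/(induced_charge ipos B + (-1)%:E * induced_charge ineg B)%E.
by rewrite EFinN mulN1e.
Qed.

Lemma charge_integralE mu (f : I01 R -> R) A : measurable A ->
  charge_integral mu A f = charge_integral mu setT (fun x => f x * \1_A x).
Proof.
move=> mA; rewrite /charge_integral; congr (_ - _)%E; rewrite integral_mkcond epatch_indic.
  by [].
by [].
Qed.

Lemma pairing_density (f phi : I01 R -> R) mu : bounded_measurable f ->
  bounded_measurable phi -> pairing (density f mu) phi = pairing mu (fun x => f x * phi x).
Proof.
move=> mf; have [_ [a fa]] := mf.
apply: (@functional_eq _ (fun phi => pairing mu (fun x => f x * phi x)) (a * tv mu)).
- move=> c g h mg mh; rewrite -pairing_lin;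
  [|exact: bounded_measurableM|exact: bounded_measurableM].
  by congr pairing; apply/funext => x; ring.
- move=> g b mg gb; rewrite mulrCA mulrA; apply: pairing_bound.
    exact: bounded_measurableM.
  by move=> x; rewrite normrM ler_pM.
- by move=> A mA; rewrite densityE// charge_integralE.
Qed.

Definition push (h : I01 R -> I01 R) mu : Meas R := to_charge (pushforward mu h).

Lemma pushE h mu A : measurable_fun setT h -> measurable A ->
  push h mu A = mu (h @^-1` A).
Proof.
move=> mh mA; apply: (@to_chargeP (pushforward mu h)) => //.
by exists (measure_function_pushforward__canonical__charge_Charge mu mh).
Qed.

Lemma pairing_push h mu phi : measurable_fun setT h -> bounded_measurable phi ->
  pairing (push h mu) phi = pairing mu (phi \o h).
Proof.
move=> mh; apply: (@functional_eq _ (fun phi => pairing mu (phi \o h)) (tv mu)).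
- by move=> c f g mf mg; rewrite -pairing_lin//; exact: bounded_measurable_comp.
- move=> f a mf fa; apply: pairing_bound; first exact: bounded_measurable_comp.
  by move=> x /=.
- move=> A mA; rewrite pushE// -pairing_indic//.
  by rewrite -[X in measurable X]setTI; exact: mh.
Qed.

(** The extremal test function is [\1_P - \1_N] for a Hahn decomposition; its pairing with [mu] is
    the total variation. *)
Lemma TVnorm_le mu (C : R) :
  (forall phi, bounded_measurable phi -> sup_le phi 1 -> `|pairing mu phi| <= C) ->
  (TVnorm mu <= C%:E)%E.
Proof.
move=> H; have [[mP posP] [mN negN] PN PN0] := hahn_setsP mu.
set P := (hahn_sets mu).1 in mP posP PN PN0; set N := (hahn_sets mu).2 in mN negN PN PN0.
pose phi : I01 R -> R := fun x => -1 * \1_N x + \1_P x.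
have iP := bounded_measurable_indic mP; have iN := bounded_measurable_indic mN.
have mphi : bounded_measurable phi by exact: bounded_measurable_lin.
have phi1 : sup_le phi 1.
  move=> x; rewrite /phi !indicE.
  case xP : (x \in P); case xN : (x \in N) => /=;
    rewrite ?mulr1 ?mulr0 ?add0r ?addr0 ?normrN1 ?normr1 ?normr0//.
  by rewrite addrC subrr normr0.
have := H _ mphi phi1; rewrite pairing_lin// !pairing_indic//.
move=> /(le_trans (ler_norm _)) h.
rewrite TVnormE lee_fin; apply: le_trans h.
rewrite /tv /TVnorm /charge_variation fineD//; try exact: fin_num_measure.
rewrite jordan_posE jordan_negE cjordan_posE cjordan_negE /crestr0 mem_set// /crestr !setTI.
by rewrite fineN; lra.
Qed.

(** On the negative Hahn set a positive charge is both nonnegative and nonpositive, so its negative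
    Jordan part vanishes. *)
Lemma pairing_ge0 mu phi : mu.-positive_set setT -> bounded_measurable phi ->
  (forall x, 0 <= phi x) -> 0 <= pairing mu phi.
Proof.
move=> [_ mu0] mp p0; have [[mP posP] [mN negN] PN PN0] := hahn_setsP mu.
rewrite pairingE// (_ : \int[mneg mu]_x phi x = 0); last first.
  have null A : measurable A -> mneg mu A = 0%E.
    move=> mA; rewrite jordan_negE cjordan_negE /crestr0 mem_set// /crestr.
    have mAN := measurableI _ _ mA mN.
    apply/eqP; rewrite oppe_eq0 eq_le mu0// andbT.
    by apply: negN => //; exact: subIsetr.
  have [_ [a pa]] := mp.
  apply/eqP; rewrite -normr_le0.
  apply: le_trans (le_normr_Rintegral _ (bounded_measurable_integrable _ mp)) _ => //.
  apply: (@le_trans _ _ (\int[mneg mu]_x a)).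
    apply: le_Rintegral => //; last exact: bounded_measurable_integrable (bounded_measurable_cst a).
    have mabs : bounded_measurable (fun x => `|phi x|).
      by split; [apply: measurableT_comp => //; exact: mp.1|exists a => x; rewrite normr_id].
    exact: bounded_measurable_integrable mabs.
  by rewrite Rintegral_cst// [X in fine X](null _ measurableT) mulr0.
by rewrite subr0; exact: Rintegral_ge0.
Qed.

Lemma pairing_dominated mu (phi_ : nat -> I01 R -> R) phi (a : R) :
  (forall n, bounded_measurable (phi_ n)) -> bounded_measurable phi ->
  (forall n, sup_le (phi_ n) a) ->
  (forall x, phi_ n x @[n --> \oo] --> phi x) ->
  pairing mu (phi_ n) @[n --> \oo] --> pairing mu phi.
Proof.
move=> mn mp na lim.
rewrite pairingE// (_ : (fun n => pairing mu (phi_ n)) = (fun n =>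
  \int[mpos mu]_x phi_ n x - \int[mneg mu]_x phi_ n x)); last first.
  by apply/funext => n; rewrite pairingE.
have H (m : {finite_measure set (I01 R) -> \bar R}) :
    \int[m]_x phi_ n x @[n --> \oo] --> \int[m]_x phi x.
  have im n := bounded_measurable_integrable m (mn n).
  have ip := bounded_measurable_integrable m mp.
  have ia := bounded_measurable_integrable m (bounded_measurable_cst a).
  have [|||||_ _ h] := @dominated_convergence _ _ _ m setT measurableT
    (fun n => EFin \o phi_ n) (EFin \o phi) (EFin \o (fun=> a)).
  - by move=> n; apply/measurable_EFinP; exact: (mn n).1.
  - by apply/measurable_EFinP; exact: mp.1.
  - by apply: aeW => x _; apply: cvg_EFin; [exact: nearW|exact: lim].
  - exact: ia.
  - by apply: aeW => x n _ /=; rewrite lee_fin; exact: na.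
  have fi : (\int[m]_x (phi x)%:E)%E \is a fin_num by exact: integrable_fin_num.
  by apply: fine_cvg; rewrite /Rintegral fineK.
by apply: cvgB; exact: H.
Qed.

Lemma dual_normP (L : functional R) (c : R) :
  (dual_norm L <= c%:E)%E <-> forall phi, (BLnorm phi <= 1)%E -> `|L phi| <= c.
Proof.
split=> [h phi p1|h].
  by rewrite -lee_fin; apply: le_trans h; apply: ereal_sup_ubound; exists phi.
by apply: ge_ereal_sup => _ [phi p1 <-]; rewrite lee_fin h.
Qed.

Lemma BLdist_bound mu nu (d a b : R) phi : (BLdist mu nu <= d%:E)%E ->
  0 <= a -> 0 <= b -> sup_le phi a -> lip_le phi b ->
    `|pairing mu phi - pairing nu phi| <= d * (a + b).
Proof.
move=> /dual_normP H a0 b0 pa pb.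
have mp : bounded_measurable phi by apply: BL_bounded_measurable; apply/BLP; exists a, b.
have [ab|ab] := leP (a + b) 0.
  have p0 : phi = (fun=> 0).
    apply/funext => x; apply/eqP; rewrite -normr_le0; apply: le_trans (pa x) _; lra.
  have -> : a + b = 0 by lra.
  by rewrite p0 !pairing0 subrr normr0 mulr0.
pose psi := fun x => (a + b)^-1 * phi x + 0.
have mz := bounded_measurable_cst 0.
have k0 : 0 < (a + b)^-1 by rewrite invr_gt0.
have psi1 : (BLnorm psi <= 1)%E.
  apply: le_trans (@BLnorm_le R psi ((a + b)^-1 * a) ((a + b)^-1 * b) _ _) _.
  - by move=> x; rewrite /psi addr0 normrM gtr0_norm// ler_pM2l.
  - move=> x y; rewrite /psi !addr0 -mulrBr normrM gtr0_norm// -mulrA ler_pM2l//.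
  - by rewrite lee_fin -mulrDr mulVf// gt_eqF.
have := H psi psi1; rewrite /= /psi !pairing_lin//.
by rewrite !pairing0 !addr0 -mulrBr normrM gtr0_norm// ler_pdivrMl// mulrC.
Qed.

(** The half-lines [[x, +oo[] are stable under intersection and generate the Borel sets. Their
    indicators are pointwise limits of the ramps [phi_ n], which are 1 on the half-line and drop to
    0 with slope [n] on its left; Dynkin's lemma does the rest. *)
Lemma eqM_of_BL mu nu : (forall phi, BL phi -> pairing mu phi = pairing nu phi) -> eqM mu nu.
Proof.
move=> H A [B mB <-]; rewrite setTI.
have mv C : measurable C -> measurable (@I01val R @^-1` C).
  by move=> mC; rewrite -[X in measurable X]setTI; exact: measurable_I01val.
pose P (C : set R) := mu (@I01val R @^-1` C) = nu (@I01val R @^-1` C).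
have fin (m : Meas R) C : measurable C -> m C \is a fin_num by move=> mC; exact: fin_num_measure.
suff : P B by [].
have BT : BL (fun=> 1 : R).
  apply/BLP; exists 1, 0; split; first by move=> x; rewrite normr1.
  by move=> x y; rewrite subrr normr0 mul0r.
have muT : mu setT = nu setT.
  rewrite -[LHS]fineK ?fin// -[RHS]fineK ?fin//; congr EFin.
  by rewrite -!pairing_indic// indicT; exact: H.
have mB' : <<s @RGenCInfty.G R >> B.
  exact: (eq_ind _ (fun M : set (set R) => M B) mB _ (RGenCInfty.measurableE R)).
move: B mB' {mB}; apply: (@dynkin_induction _ (measurableTypeR R) (@RGenCInfty.G R) P) => //.
- exact: RGenCInfty.measurableE.
- move=> _ _ [x ->] [y ->]; exists (Num.max x y).
  apply/seteqP; split=> z /=; rewrite !in_itv/= !andbT ge_max; first by move=> [-> ->].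
  by move=> /andP[].
- move=> _ [x ->]; rewrite /P.
  have mx : measurable (@I01val R @^-1` `[x, +oo[) by apply: mv.
  rewrite -[LHS]fineK ?fin// -[RHS]fineK ?fin//; congr EFin.
  rewrite -!pairing_indic//.
  pose phi_ (n : nat) (z : I01 R) := I01val (clamp (1 - n%:R * (x - I01val z))).
  have bl n : BL (phi_ n).
    apply/BLP; exists 1, n%:R; split.
      by move=> z; rewrite ger0_norm ?I01val_ge0// I01val_le1.
    move=> y z; apply: le_trans (clamp_lip _ _) _.
    rewrite (_ : _ - _ = n%:R * (I01val y - I01val z)); last by ring.
    by rewrite normrM ger0_norm.
  have lim z : phi_ n z @[n --> \oo] --> (\1_(@I01val R @^-1` `[x, +oo[) z : R).
    rewrite indicE; have [xz|zx] := leP x (I01val z).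
      rewrite mem_set; last by rewrite /= in_itv/= andbT.
      rewrite (_ : (fun n => phi_ n z) = fun=> 1); first exact: cvg_cst.
      apply/funext => n; apply: clamp_eq1; rewrite lerDl oppr_ge0.
      by apply: mulr_ge0_le0 => //; rewrite subr_le0.
    rewrite memNset; last by rewrite /= in_itv/= andbT leNgt zx.
    apply/cvgrPdist_le => e e0; near=> n.
    have xz : 0 < x - I01val z by rewrite subr_gt0.
    rewrite sub0r normrN /phi_ clamp_eq0 ?normr0 ?(ltW e0)//.
    rewrite subr_le0 -ler_pdivrMr//.
    near: n; exact: nbhs_infty_ger.
  have bd n : sup_le (phi_ n) 1.
    by move=> z; rewrite ger0_norm ?I01val_ge0// I01val_le1.
  have mm n := BL_bounded_measurable (bl n).
  have h1 := pairing_dominated (mu := mu) mm (bounded_measurable_indic mx) bd lim.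
  have h2 := pairing_dominated (mu := nu) mm (bounded_measurable_indic mx) bd lim.
  have E : (fun n => pairing mu (phi_ n)) = (fun n => pairing nu (phi_ n)).
    by apply/funext => n; exact: H.
  rewrite E in h1; exact: (cvg_unique _ h1 h2).
- move=> S mS; rewrite /P => PS; rewrite preimage_setC -!setTD !chargeD//; try exact: mv.
  by rewrite !setTI PS muT.
- move=> F mF tF PF; rewrite /P preimage_bigcup.
  have t' : trivIset setT (fun n => @I01val R @^-1` F n).
    apply/trivIsetP => i j _ _ ij; rewrite -preimage_setI.
    by move/trivIsetP : tF => /(_ _ _ _ _ ij) ->//; rewrite preimage_set0.
  have m' n : measurable (@I01val R @^-1` F n) by apply: mv; exact: mF.
  have mU : measurable (\bigcup_n (@I01val R @^-1` F n)).
    by apply: bigcup_measurable => k _; exact: m'.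
  have h1 := @charge_semi_sigma_additive _ _ _ mu _ m' t' mU.
  have h2 := @charge_semi_sigma_additive _ _ _ nu _ m' t' mU.
  have E : (fun n => \sum_(0 <= i < n) mu (@I01val R @^-1` F i))%E =
           (fun n => \sum_(0 <= i < n) nu (@I01val R @^-1` F i))%E.
    by apply/funext => n; apply: eq_bigr => i _; exact: PF.
  rewrite E in h1; exact: (cvg_unique _ h1 h2).
Unshelve. all: by end_near.
Qed.

End measures.

(** * The equation with fixed velocity *)

Section growth.
Context {R : realType}.
Implicit Types (phi w f : I01 R -> R) (x : I01 R).
Let nonneg := [set s : R | 0 <= s].

(* The exponent of the growth factor accumulated along a trajectory. *)
Definition growth f w (t : R) x : R := prim (fun s => f (flow w s x)) t.

Section fixed_velocity.
Variables (f w : I01 R -> R) (F l : R).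
Hypotheses (fF : sup_le f F) (fl : lip_le f l) (bw : BL w).

Let F0 := sup_le_ge0 fF.
Let l0 := lip_le_ge0 fl.

Lemma growthP x : growth f w 0 x = 0 /\ forall t : R, 0 <= t ->
  rel_deriv nonneg (fun s => growth f w s x) t (f (flow w t x)).
Proof.
have /BLP[K [L [wK wL]]] := bw.
apply: (@primP R _ (l * K)); first by rewrite mulr_ge0// (sup_le_ge0 wK).
move=> s t s0 t0; apply: le_trans (fl _ _) _; rewrite -mulrA ler_wpM2l//.
exact: flow_lip_time.
Qed.

Lemma growth0 x : growth f w 0 x = 0. Proof. by have [] := growthP x. Qed.

Lemma growth_deriv x (a b : R) : 0 <= a -> forall t : R, a <= t <= b ->
  rel_deriv `[a, b] (fun s => growth f w s x) t (f (flow w t x)).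
Proof.
move=> a0 t /andP[a_t _]; have [_ H] := growthP x.
by apply: rel_derivS (H t (le_trans a0 a_t)); exact: itv_nonneg.
Qed.

Lemma growth_lip_time x (s t : R) : 0 <= s -> 0 <= t ->
  `|growth f w s x - growth f w t x| <= F * `|s - t|.
Proof.
move=> s0 t0; apply: (rel_deriv_Lip (dy := fun t => f (flow w t x))) => //.
by have [] := growthP x.
Qed.

Lemma growth_le x (t : R) : 0 <= t -> `|growth f w t x| <= F * t.
Proof.
by move=> t0; have := growth_lip_time x t0 (lexx 0); rewrite growth0 !subr0 (ger0_norm t0).
Qed.

(** The cocycle relation: by [flowD] both sides have the same derivative in [t]. *)
Lemma growthD x (s t : R) : 0 <= s -> 0 <= t ->
  growth f w (s + t) x = growth f w s x + growth f w t (flow w s x).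
Proof.
move=> s0 t0.
pose u r := growth f w (r + s) x - growth f w r (flow w s x).
have : `|u t - u 0| <= 0 * (t - 0).
  apply: (@rel_deriv_le R u (fun r => f (flow w (r + s) x) - f (flow w r (flow w s x)))) => //.
    move=> r /andP[r0 rt]; apply: rel_derivB; last first.
      by apply: growth_deriv => //; rewrite r0.
    have [_ /(_ (r + s) (addr_ge0 r0 s0)) /rel_deriv_shift] := growthP x.
    by apply: rel_derivS => q /(itv_nonneg (lexx _)) q0; exact: addr_ge0.
  by move=> r /andP[r0 rt]; rewrite flowD// (addrC r) subrr normr0.
rewrite mul0r normr_le0 subr_eq0 /u add0r growth0 subr0 (addrC s) => /eqP <-.
by rewrite subrK.
Qed.

End fixed_velocity.

Lemma growth_dist f w w' (F l L c t : R) x x' : sup_le f F -> lip_le f l ->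
  BL w -> BL w' -> lip_le w L ->
  0 <= t -> (forall z, `|w z - w' z| <= c) ->
  `|growth f w t x - growth f w' t x'| <=
    l * t * expR (L * t) * (`|I01val x - I01val x'| + c * t).
Proof.
move=> fF fl bw bw' wL t0 wc.
have c0 : 0 <= c by apply: le_trans (wc (clamp 0)).
have L0 := lip_le_ge0 wL; have l0 := lip_le_ge0 fl.
pose u s := growth f w s x - growth f w' s x'.
have := @rel_deriv_le R u (fun r => f (flow w r x) - f (flow w' r x')) 0 t
  (l * (expR (L * t) * (`|I01val x - I01val x'| + c * t))) t0.
rewrite /u (growth0 fl bw) (growth0 fl bw') subrr !subr0 => /(_ _ _ _)/le_trans; apply.
- by rewrite !mulr_ge0 ?expR_ge0// addr_ge0// mulr_ge0.
- move=> r rt; apply: rel_derivB.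
    exact: (growth_deriv fl bw x (lexx 0) rt).
  exact: (growth_deriv fl bw' x' (lexx 0) rt).
- move=> r /andP[r0 rt]; apply: le_trans (fl _ _) _; rewrite ler_wpM2l//.
  apply: le_trans (flow_dist x x' bw bw' wL r0 wc) _.
  apply: ler_pM; rewrite ?expR_ge0 ?addr_ge0 ?mulr_ge0//.
    by rewrite ler_expR ler_wpM2l.
  by rewrite lerD2l ler_wpM2l.
- by rewrite -subr_ge0 (_ : _ - _ = 0)//; ring.
Qed.

Lemma expR_lip (B a b : R) : a <= B -> b <= B -> `|expR a - expR b| <= expR B * `|a - b|.
Proof.
wlog ab : a b / a <= b.
  move=> W aB bB; have [ab|/ltW ab] := leP a b; first exact: W.
  by rewrite distrC (distrC a); exact: W.
move=> aB bB; rewrite distrC (distrC a) !ger0_norm ?subr_ge0 ?ler_expR//.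
apply: (@le_trans _ _ (expR b * (b - a))); last first.
  by rewrite ler_wpM2r ?subr_ge0// ler_expR.
rewrite (_ : expR a = expR b * expR (a - b)); last by rewrite -expRD addrC subrK.
have := expR_ge1Dx (a - b) => /(ler_wpM2l (expR_ge0 b)); lra.
Qed.

Lemma rel_deriv_expR_comp (J : set R) (y : R -> R) (t v : R) : rel_deriv J y t v ->
  rel_deriv J (fun s => expR (y s)) t (expR (y t) * v).
Proof.
move=> H e e0.
pose k := `|v| + 1; have k0 : 0 < k by rewrite ltr_wpDl.
pose m := expR (y t); have m0 : 0 < m by exact: expR_gt0.
have [d1 d10 H1] := @is_derive_rel_deriv R setT expR (y t) _ (is_derive_expR _) (e / 2 / k)
  ltac:(by rewrite !divr_gt0).
have [d2 d20 H2] := H (e / 2 / m) ltac:(by rewrite !divr_gt0).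
have [d3 d30 H3] := H 1 ltr01.
have [d4 d40 H4] := rel_deriv_cont H (divr_gt0 d10 (ltr0Sn R 1)).
exists (Num.min (Num.min d2 d3) d4) => [|s Js].
  by rewrite !lt_min d20 d30 d40.
rewrite !lt_min => /andP[/andP[s2 s3] s4].
have y1 : `|y s - y t| <= k * `|s - t|.
  have := H3 s Js s3; rewrite mul1r => h3.
  have := ler_normD (y s - y t - (s - t) * v) ((s - t) * v); rewrite subrK => h4.
  by apply: le_trans h4 _; rewrite normrM /k; lra.
have y2 : `|y s - y t| < d1 by have := H4 s Js s4; lra.
have h1 := H1 (y s) I y2.
have h2 := H2 s Js s2.
rewrite (_ : _ - _ - _ = (expR (y s) - expR (y t) - (y s - y t) * expR (y t)) +
  m * (y s - y t - (s - t) * v)); last by rewrite /m; ring.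
apply: le_trans (ler_normD _ _) _; rewrite (normrM m) (gtr0_norm m0).
have h3 := ler_wpM2l (ltW m0) h2.
have h4 := ler_wpM2l (ltW (divr_gt0 (divr_gt0 e0 (ltr0Sn _ 1)) k0)) y1.
have e1 : m * (e / 2 / m * `|s - t|) = e / 2 * `|s - t|.
  by field; rewrite gt_eqF.
have e2 : e / 2 / k * (k * `|s - t|) = e / 2 * `|s - t|.
  by field; rewrite gt_eqF.
by move: h1 h3 h4; rewrite e1 e2; lra.
Qed.

End growth.

(** * Push-forwards of reweighted measures *)

Section weighted_push.
Context {R : realType}.
Implicit Types (mu nu : Meas R) (phi ell : I01 R -> R) (h : I01 R -> I01 R).

Definition wpush h ell mu : Meas R := push h (density (fun x => expR (ell x)) mu).

(** An upper bound on the exponent is all that bounding the weight [expR (ell x)] takes, and it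
    survives pointwise limits. *)
Definition bounded_above_measurable ell (B : R) := measurable_fun setT ell /\ forall x, ell x <= B.

Lemma bounded_measurable_expR ell B : bounded_above_measurable ell B ->
  bounded_measurable (fun x => expR (ell x)).
Proof.
move=> [ml lB]; split; first exact: measurableT_comp.
by exists (expR B) => x; rewrite gtr0_norm ?expR_gt0// ler_expR.
Qed.

Lemma pairing_wpush h ell B mu phi : measurable_fun setT h ->
  bounded_above_measurable ell B -> bounded_measurable phi ->
  pairing (wpush h ell mu) phi = pairing mu (fun x => expR (ell x) * phi (h x)).
Proof.
move=> mh ml mp; rewrite /wpush pairing_push// pairing_density//.
  exact: bounded_measurable_expR ml.
exact: bounded_measurable_comp.
Qed.

Lemma bounded_measurable_wpush h ell B phi : measurable_fun setT h ->
  bounded_above_measurable ell B -> bounded_measurable phi ->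
  bounded_measurable (fun x => expR (ell x) * phi (h x)).
Proof.
move=> mh ml mp; apply: bounded_measurableM; first exact: bounded_measurable_expR ml.
exact: bounded_measurable_comp.
Qed.

Lemma wpush_TVnorm h ell B mu : measurable_fun setT h -> bounded_above_measurable ell B ->
  (TVnorm (wpush h ell mu) <= (expR B * tv mu)%:E)%E.
Proof.
move=> mh ml; apply: TVnorm_le => phi mp p1; rewrite (pairing_wpush _ mh ml mp).
apply: pairing_bound; first exact: bounded_measurable_wpush ml mp.
move=> x; rewrite normrM gtr0_norm ?expR_gt0// -[leRHS]mulr1.
by rewrite ler_pM ?expR_ge0// ler_expR; exact: ml.2.
Qed.

Lemma pairing_dist mu phi psi (c : R) : bounded_measurable phi -> bounded_measurable psi ->
  (forall x, `|phi x - psi x| <= c) -> `|pairing mu phi - pairing mu psi| <= c * tv mu.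
Proof.
move=> mp mq pc.
have -> : pairing mu phi - pairing mu psi = pairing mu (fun x => -1 * psi x + phi x).
  by rewrite pairing_lin//; ring.
apply: pairing_bound; first exact: bounded_measurable_lin.
by move=> x; rewrite mulN1r addrC.
Qed.

Lemma BLnorm1P phi : (BLnorm phi <= 1)%E ->
  exists a b : R, [/\ 0 <= a, 0 <= b, a + b <= 1, sup_le phi a & lip_le phi b].
Proof. exact: (@BLnorm_leP R phi 1). Qed.

(** A test function of BL norm at most 1 has both supremum and Lipschitz constant at most 1. Moving
    the mass costs [expR B * d1] through the latter, changing its weight costs [expR B * d2] through
    the former. *)
Lemma wpush_dist h ell h' ell' (B d1 d2 : R) mu : measurable_fun setT h -> measurable_fun setT h' ->
  bounded_above_measurable ell B -> bounded_above_measurable ell' B ->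
  (forall x, `|I01val (h x) - I01val (h' x)| <= d1) -> (forall x, `|ell x - ell' x| <= d2) ->
  (BLdist (wpush h ell mu) (wpush h' ell' mu) <= (expR B * (d1 + d2) * tv mu)%:E)%E.
Proof.
move=> mh mh' ml ml' hd ld; apply/dual_normP => phi /BLnorm1P[a [b [a0 b0 ab pa pb]]] /=.
have mp : bounded_measurable phi by apply: BL_bounded_measurable; apply/BLP; exists a, b.
rewrite (pairing_wpush _ mh ml)// (pairing_wpush _ mh' ml')//.
apply: pairing_dist; [exact: bounded_measurable_wpush ml mp|exact: bounded_measurable_wpush ml'
  mp|].
move=> x; rewrite (_ : _ - _ = expR (ell x) * (phi (h x) - phi (h' x)) +
  (expR (ell x) - expR (ell' x)) * phi (h' x)); last by ring.
have d10 : 0 <= d1 by apply: le_trans (hd x).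
have d20 : 0 <= d2 by apply: le_trans (ld x).
apply: le_trans (ler_normD _ _) _; rewrite !normrM mulrDr; apply: lerD.
  rewrite gtr0_norm ?expR_gt0//; apply: ler_pM => //; first by rewrite ler_expR; exact: ml.2.
  apply: le_trans (pb _ _) _; rewrite -[leRHS]mul1r; apply: ler_pM => //; lra.
rewrite -[leRHS]mulr1; apply: ler_pM => //; last by apply: le_trans (pa _) _; lra.
apply: le_trans (expR_lip (ml.2 x) (ml'.2 x)) _.
by rewrite ler_wpM2l ?expR_ge0.
Qed.

End weighted_push.

Section dual_norm_convergence.
Context {R : realType}.

Lemma dual_norm_ge0 (L : functional R) : (0 <= dual_norm L)%E.
Proof.
apply: le_trans (_ : `|L (fun=> 0)|%:E <= _)%E; first by rewrite lee_fin.
apply: ereal_sup_ubound; exists (fun=> 0) => //=.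
apply: le_trans (@BLnorm_le R (fun=> 0) 0 0 _ _) _.
- by move=> x; rewrite normr0.
- by move=> x y; rewrite subrr normr0 mul0r.
- by rewrite addr0 lee_fin.
Qed.

Lemma squeeze_cvge0 (T : Type) (G : set_system T) (FG : Filter G) (u : T -> \bar R)
    (v : T -> R) : (forall x, (0 <= u x)%E) -> (\forall x \near G, (u x <= (v x)%:E)%E) ->
  v x @[x --> G] --> 0 -> u x @[x --> G] --> 0%E.
Proof.
move=> u0 uv v0; apply: (squeeze_cvge (f := fun=> 0%E) (h := fun x => (v x)%:E)).
- by near=> x; rewrite u0/=; near: x.
- exact: cvg_cst.
- by apply: cvg_EFin; [exact: nearW|exact: v0].
Unshelve. all: by end_near.
Qed.

Lemma BL_continuous_lip (C T : R) (mu : R -> Meas R) :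
  (forall s t, 0 <= s <= T -> 0 <= t <= T -> (BLdist (mu s) (mu t) <= (C * `|s - t|)%:E)%E) ->
  BL_continuous T mu.
Proof.
move=> H t tT; apply: (@squeeze_cvge0 R _ _ _ (fun s => C * `|s - t|)).
- by move=> s; exact: dual_norm_ge0.
- rewrite near_withinE; apply: nearW => s sT.
  have sT' : 0 <= s <= T by move: sT; rewrite /= in_itv.
  exact: H.
- rewrite -[X in _ --> X](mulr0 C); apply: cvgMr.
  rewrite -[X in _ --> X](normr0 R); apply: cvg_norm.
  rewrite -[X in _ --> X](subrr t); apply: cvgB; last exact: cvg_cst.
  by apply: cvg_within.
Qed.

(* [integral] is a lower integral, hence monotone without measurability. *)
Lemma ge0_le_integral_nonmeasurable d (T : measurableType d)
    (m : {measure set T -> \bar R}) (D : set T) (g1 g2 : T -> \bar R) :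
  (forall x, D x -> (0 <= g1 x)%E) -> (forall x, D x -> (g1 x <= g2 x)%E) ->
  (\int[m]_(x in D) g1 x <= \int[m]_(x in D) g2 x)%E.
Proof.
move=> g10 g12; have g20 x : D x -> (0 <= g2 x)%E by move=> Dx;
  exact: le_trans (g10 x Dx) (g12 x Dx).
rewrite !ge0_integralE//; apply: ereal_sup_le => _ [h hg <-]; exists h => //= x.
apply: le_trans (hg x) _; rewrite /patch; case: ifPn => // xD.
by apply: g12; exact: set_mem.
Qed.

End dual_norm_convergence.

(** * Bochner integrals by duality and by Riemann sums *)

Section bochner.
Context {R : realType}.

(** Testing commutes with the integral of simple functions, and both approximation errors are
    controlled by dual norms. In this way the variation of constants formula becomes a family of
    scalar identities. *)
Lemma bochner_scalar (t : R) (F : R -> functional R) (L : functional R) (phi : I01 R -> R) (c : R) :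
  is_bochner_integral `[0, t] F L -> (BLnorm phi <= 1)%E ->
  measurable_fun `[0, t] (fun r => F r phi) ->
  (forall r : R, 0 <= r <= t -> `|F r phi| <= c) ->
  L phi = \int[lebesgue_measure]_(r in `[0, t]) F r phi.
Proof.
move=> [s [_ s2 s3]] p1 mF Fc.
have finD : (@lebesgue_measure R `[0%R, t]%classic < +oo)%E.
  by rewrite lebesgue_measure_itv/=; case: ifPn => // _; rewrite -EFinB ltry.
have mD : measurable (`[0, t] : set R) by exact: measurable_itv.
have iF : lebesgue_measure.-integrable `[0, t] (EFin \o (fun r => F r phi)).
  apply: measurable_bounded_integrable => //.
  exists c; split; first by rewrite num_real.
  by move=> b cb r /= rt; apply: le_trans (ltW cb); apply: Fc; move: rt; rewrite in_itv.
have ind (A : set R) (k : R) : measurable A -> A `<=` `[0, t] ->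
    lebesgue_measure.-integrable `[0, t] (EFin \o (fun r => \1_A r * k)) /\
    \int[lebesgue_measure]_(r in `[0, t]) (\1_A r * k) = fine (lebesgue_measure A) * k.
  move=> mA AD.
  have i1 : lebesgue_measure.-integrable `[0, t] (EFin \o (\1_A : R -> R)).
    apply: measurable_bounded_integrable => //.
    exists 1; split; first by rewrite num_real.
    move=> b b1 r _ /=; rewrite indicE; case: (_ \in _); rewrite ?normr1 ?normr0 ?(ltW b1)//.
    by rewrite ltW// (lt_trans ltr01).
  split; last first.
    rewrite RintegralZr//; congr (_ * _).
    by rewrite /Rintegral integral_indic// setIidl.
  rewrite (_ : _ \o _ = (fun r => (EFin \o (\1_A : R -> R)) r * k%:E)%E); last exact/funext.
  exact: integrableZr.
pose P (g : R -> R) (v : R) := lebesgue_measure.-integrable `[0, t] (EFin \o g) /\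
  \int[lebesgue_measure]_(r in `[0, t]) g r = v.
have Psum (I : Type) (r : seq I) (g : I -> R -> R) (v : I -> R) : (forall i, P (g i) (v i)) ->
    P (fun x => \sum_(i <- r) g i x) (\sum_(i <- r) v i).
  move=> Pg; elim: r => [|i r [IH1 IH2]].
    rewrite big_nil; under eq_fun do rewrite big_nil.
    by split; [exact: integrable0|rewrite Rintegral_cst// mul0r].
  rewrite big_cons; under eq_fun do rewrite big_cons.
  have [g1 g2] := Pg i; pose G x := \sum_(i <- r) g i x; split.
    rewrite (_ : _ \o _ = ((EFin \o g i) \+ (EFin \o G))%E).
      exact: integrableD.
    exact/funext.
  by rewrite RintegralD// g2 IH2.
have int_s n : P (fun r => sf_fun (s n) r phi) (sf_integral (s n) phi).
  apply: Psum => i.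
  exact: ind (sf_measurable i) (@sf_sub _ _ _ i).
pose e n := (\int[lebesgue_measure]_(r in `[0%R, t]) dual_norm (F r \- sf_fun (s n) r)%R)%E.
pose d n := dual_norm (L \- sf_integral (s n)).
(* Compare through the simple function: [d n] bounds the error of its integral as an approximation
   of [L], and [e n] the integrated error of its values. *)
have key n : (`|L phi - \int[lebesgue_measure]_(r in `[0%R, t]) F r phi|%R%:E <= d n + e n)%E.
  have [i1 i2] := int_s n.
  apply: (@le_trans _ _ (`|L phi - sf_integral (s n) phi|%:E +
    `|sf_integral (s n) phi - \int[lebesgue_measure]_(r in `[0%R, t]) F r phi|%R%:E)%E).
    by rewrite -EFinD lee_fin ler_distD.
  apply: leeD; first by apply: ereal_sup_ubound; exists phi.
  rewrite distrC -i2 -RintegralB//.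
  pose F1 r := F r phi; pose F2 r := sf_fun (s n) r phi.
  have iB : lebesgue_measure.-integrable `[0, t] (EFin \o (fun r => F r phi - sf_fun (s n) r phi)).
    rewrite (_ : _ \o _ = ((EFin \o F1) \- (EFin \o F2))%E).
      exact: integrableB.
    exact/funext.
  apply: le_trans (_ : (\int[lebesgue_measure]_(r in `[0%R, t]) `|(F r phi - sf_fun (s n) r
    phi)%:E| <= _)%E).
    rewrite EFin_normr_Rintegral//; apply: le_abse_integral => //.
    by case/integrableP : iB.
  apply: ge0_le_integral_nonmeasurable => [r _|r _]; first exact: abse_ge0.
  by apply: ereal_sup_ubound; exists phi.
apply/eqP; rewrite -subr_eq0 -normr_le0 -lee_fin.
have lim : d n + e n @[n --> \oo] --> (0 + 0)%E by apply: cvgeD.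
rewrite adde0 in lim.
by apply: cvge_ge lim; apply: nearW => n; exact: key.
Qed.

End bochner.

Section grid.
Context {R : realType}.
Variable t : R.
Hypothesis t0 : 0 <= t.

Definition grid (n i : nat) : R := i%:R * t / n.+1%:R.

Lemma grid0 n : grid n 0 = 0. Proof. by rewrite /grid !mul0r. Qed.

Lemma grid_last n : grid n n.+1 = t.
Proof. by rewrite /grid mulrC mulKf. Qed.

Lemma gridS n i : grid n i.+1 = grid n i + t / n.+1%:R.
Proof. by rewrite /grid -natr1; ring. Qed.

Lemma grid_le n i j : (i <= j)%N -> grid n i <= grid n j.
Proof. by move=> ij; rewrite /grid !ler_wpM2r// ?invr_ge0// ler_nat. Qed.

Lemma grid_ge0 n i : 0 <= grid n i.
Proof. by rewrite /grid divr_ge0// mulr_ge0. Qed.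

Lemma grid_le_last n i : (i <= n.+1)%N -> grid n i <= t.
Proof. by move=> h; rewrite -[leRHS](grid_last n); exact: grid_le. Qed.

(** Only the first cell contains its left end point, so that the cells partition [[0, t]], also when
    [t = 0]. *)
Definition cell (n i : nat) : set R :=
  [set` Interval (BSide (i == 0%N) (grid n i)) (BRight (grid n i.+1))].

Lemma cellE n i r : cell n i r = ((if i == 0%N then grid n i <= r else grid n i < r) && (r <=
  grid n i.+1)) :> Prop.
Proof. by rewrite /cell /= in_itv/=; case: (i == 0%N). Qed.

Lemma cell_le n i r : cell n i r -> grid n i <= r <= grid n i.+1.
Proof. by rewrite cellE; case: (i == 0%N) => /andP[h ->]; rewrite ?h ?(ltW h). Qed.

Lemma cell_sub n i : (i < n.+1)%N -> cell n i `<=` `[0, t].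
Proof.
move=> ni r /cell_le/andP[h1 h2]; rewrite /= in_itv/=.
by rewrite (le_trans (grid_ge0 n i) h1) (le_trans h2)// grid_le_last.
Qed.

Lemma cell_disjoint n i j r : cell n i r -> cell n j r -> i = j.
Proof.
wlog ij : i j / (i < j)%N.
  move=> W hi hj; have [/W|/W/(_ hj hi)->//|//] := ltngtP i j; exact.
move=> /cell_le/andP[_ h1]; rewrite cellE (_ : (j == 0%N) = false); last by case: j ij.
move=> /andP[h2 _]; have := grid_le n ij; rewrite leNgt => /negP[].
exact: lt_le_trans h2 h1.
Qed.

Lemma cell_cover n r : 0 <= r <= t -> exists2 i, (i < n.+1)%N & cell n i r.
Proof.
move=> /andP[r0 rt].
have ex : exists i, r <= grid n i.+1 by exists n; rewrite grid_last.
case: (ex_minnP ex) => i ri imin.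
exists i; first by rewrite ltnS; apply: imin; rewrite grid_last.
rewrite cellE ri andbT; case: i ri imin => [|i] ri imin /=; first by rewrite grid0.
by rewrite ltNge; apply/negP => /imin; rewrite ltnn.
Qed.

Lemma cell_measure n i : fine (lebesgue_measure (cell n i)) = t / n.+1%:R.
Proof.
rewrite /cell lebesgue_measure_itv/= lte_fin; have h := gridS n i.
have h0 : 0 <= t / n.+1%:R by rewrite divr_ge0.
case: ifPn => [_|]; first by rewrite h -EFinB/= addrC addKr.
by rewrite -leNgt h => /= h1; apply/eqP; rewrite eq_le h0 /=; move: h1; rewrite gerDl.
Qed.

Lemma cell_sum n i r (v : nat -> R) : (i < n.+1)%N -> cell n i r ->
  \sum_(j < n.+1) \1_(cell n j) r * v j = v i.
Proof.
move=> ni ci; rewrite (bigD1 (Ordinal ni))//= big1 ?addr0.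
  by rewrite indicE mem_set// mul1r.
move=> j ji; rewrite indicE memNset ?mul0r// => cj.
by move/eqP : ji; apply; apply: val_inj; exact: cell_disjoint cj ci.
Qed.

Lemma cvg_divn (c : R) : c / n.+1%:R @[n --> \oo] --> (0 : R).
Proof. by rewrite -[0](mulr0 c); apply: cvgMr; exact: cvg_harmonic. Qed.

(* [E] plays the role of an antiderivative of [F]. *)
Lemma bochner_of_antiderivative (F E : R -> functional R) (Lim : functional R) (C : R) :
  0 <= C ->
  (forall r : R, 0 <= r <= t -> completion (F r)) ->
  (forall phi, (BLnorm phi <= 1)%E -> Lim phi = E t phi - E 0 phi) ->
  (forall phi (r s : R), (BLnorm phi <= 1)%E -> 0 <= r <= t -> 0 <= s <= t ->
    `|F r phi - F s phi| <= C * `|r - s|) ->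
  (forall phi (r h : R), (BLnorm phi <= 1)%E -> 0 <= r -> 0 <= h -> r + h <= t ->
    `|E (r + h) phi - E r phi - h * F r phi| <= C * h ^+ 2) ->
  is_bochner_integral `[0, t] F Lim.
Proof.
move=> C0 Fc LimE Flip Eder.
have Fg n (i : 'I_n.+1) : completion (F (grid n i)).
  by apply: Fc; rewrite grid_ge0 grid_le_last// ltnW.
have mc n (i : 'I_n.+1) : measurable (cell n i) by exact: measurable_itv.
pose s n : simple_function `[0, t] := @SimpleFunction R `[0, t] n.+1 (fun i => cell n i)
  (fun i => F (grid n i)) (@mc n) (fun i => @cell_sub n i (ltn_ord i)) (@Fg n).
have est n (r : R) : `[0, t]%classic r ->
  (dual_norm (F r \- sf_fun (s n) r)%R <= (C * t / n.+1%:R)%:E)%E.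
  rewrite /= in_itv/= => rt; have [i ni ci] := cell_cover n rt.
  apply/dual_normP => phi p1 /=.
  rewrite /sf_fun /= (@cell_sum n i r (fun j => F (grid n j) phi) ni ci).
  have /andP[g1 g2] := cell_le ci.
  apply: le_trans (Flip phi r _ p1 rt _) _; first by rewrite grid_ge0 grid_le_last// ltnW.
  rewrite -mulrA ler_wpM2l// ger0_norm ?subr_ge0//.
  by rewrite lerBlDl -gridS.
exists s; split.
- apply: aeW => r rt; apply: (@squeeze_cvge0 R _ _ _ _ (fun n => C * t / n.+1%:R)).
  + by move=> n; exact: dual_norm_ge0.
  + by apply: nearW => n; exact: est.
  + exact: cvg_divn.
- apply: (@squeeze_cvge0 R _ _ _ _ (fun n => C * t * t / n.+1%:R)).
  + by move=> n; apply: integral_ge0 => r _; exact: dual_norm_ge0.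
  + apply: nearW => n.
    apply: (@le_trans _ _ (\int[lebesgue_measure]_(r in `[0%R, t]) (C * t / n.+1%:R)%:E)%E).
      apply: ge0_le_integral_nonmeasurable => r rt; first exact: dual_norm_ge0.
      exact: est.
    rewrite integral_cst//= lebesgue_measure_itv/=; case: ifPn => _.
      by rewrite -EFinB -EFinM lee_fin subr0 mulrAC.
    by rewrite mule0 lee_fin divr_ge0// !mulr_ge0.
  + exact: cvg_divn.
- apply: (@squeeze_cvge0 R _ _ _ _ (fun n => C * t * t / n.+1%:R)).
  + by move=> n; exact: dual_norm_ge0.
  + apply: nearW => n; apply/dual_normP => phi p1 /=.
    rewrite LimE// (_ : E t phi - E 0 phi =
      \sum_(0 <= i < n.+1) (E (grid n i.+1) phi - E (grid n i) phi)); last first.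
      by rewrite (telescope_sumr (fun i => E (grid n i) phi))// grid_last grid0.
    rewrite big_mkord.
    rewrite /sf_integral /= -sumrB.
    apply: le_trans (ler_norm_sum _ _ _) _.
    (* Each cell contributes an error of second order in its length; there are [n.+1] of them, so
       the total is [C * t ^+ 2 / n.+1%:R]. *)
    apply: (@le_trans _ _ (\sum_(i < n.+1) C * (t / n.+1%:R) ^+ 2)).
      apply: ler_sum => i _; rewrite cell_measure gridS.
      apply: Eder => //; first exact: grid_ge0.
      - by rewrite divr_ge0.
      - by rewrite -gridS grid_le_last.
    rewrite sumr_const card_ord -[leLHS]mulr_natl.
    have k0 : n.+1%:R != 0 :> R by rewrite pnatr_eq0.
    by move: k0; set k := n.+1%:R => k0; rewrite [leLHS](_ : _ = C * t * t / k)//; field.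
  + exact: cvg_divn.
Qed.

End grid.

(** * The explicit solution for fixed velocity *)

Section evolve.
Context {R : realType}.
Implicit Types (phi w f : I01 R -> R) (x : I01 R) (mu nu : Meas R).

Lemma flow_lip w (L t : R) x x' : BL w -> lip_le w L -> 0 <= t ->
  `|I01val (flow w t x) - I01val (flow w t x')| <= expR (L * t) * `|I01val x - I01val x'|.
Proof.
move=> bw wL t0; have := @flow_dist R w w L 0 x x' t bw bw wL t0.
by rewrite mul0r addr0; apply => z; rewrite subrr normr0.
Qed.

Lemma flow_measurable w (t : R) : BL w -> 0 <= t -> measurable_fun setT (flow w t).
Proof.
move=> bw t0; have /BLP[K [L [wK wL]]] := bw.
by apply: (@lip_I01_measurable R _ (expR (L * t))) => x y; exact: flow_lip.
Qed.

Lemma growth_measurable f w (t : R) : BL f -> BL w -> 0 <= t ->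
  measurable_fun setT (growth f w t).
Proof.
move=> /BLP[F [l [fF fl]]] bw t0; have /BLP[K [L [wK wL]]] := bw.
apply: (@lip_measurable R _ (l * t * expR (L * t))) => x y.
have := @growth_dist R f w w F l L 0 t x y fF fl bw bw wL t0.
by rewrite mul0r addr0; apply => z; rewrite subrr normr0.
Qed.

Definition evolve f w (t : R) nu : Meas R := wpush (flow w t) (growth f w t) nu.

Lemma completion_pairing mu : completion (pairing mu).
Proof.
split=> [a phi psi bp bq|e e0].
  by apply: pairing_lin; exact: BL_bounded_measurable.
exists mu; apply/dual_normP => phi _ /=.
by rewrite subrr normr0 ltW.
Qed.

Lemma pairing_transport w (t : R) mu phi : BL w -> 0 <= t -> bounded_measurable phi ->
  pairing (transport w t mu) phi = pairing mu (phi \o flow w t).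
Proof.
move=> bw t0 mp; rewrite -(pairing_push mu (flow_measurable bw t0) mp).
rewrite /transport /push (_ : stopped_flow w t = flow w t)//.
by apply/funext => x; exact: stopped_flowE.
Qed.

Section fixed.
Variables (f w : I01 R -> R) (F l K L : R).
Hypotheses (fF : sup_le f F) (fl : lip_le f l) (wK : sup_le w K) (wL : lip_le w L).

Let bf : BL f. Proof. by apply/BLP; exists F, l. Qed.
Let bw : BL w. Proof. by apply/BLP; exists K, L. Qed.
Let F0 := sup_le_ge0 fF.
Let l0 := lip_le_ge0 fl.
Let K0 := sup_le_ge0 wK.

Lemma growth_bounded (t T : R) : 0 <= t <= T -> bounded_above_measurable (growth f w t) (F * T).
Proof.
move=> /andP[t0 tT]; split; first exact: growth_measurable.
move=> x; apply: le_trans (ler_norm _) _.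
apply: le_trans (growth_le fF fl bw x t0) _; exact: ler_wpM2l.
Qed.

Lemma pairing_evolve (t : R) nu phi : 0 <= t -> bounded_measurable phi ->
  pairing (evolve f w t nu) phi =
  pairing nu (fun x => expR (growth f w t x) * phi (flow w t x)).
Proof.
move=> t0 mp; apply: (@pairing_wpush R _ _ (F * t)) => //.
  exact: flow_measurable.
by apply: growth_bounded; rewrite t0 lexx.
Qed.

Lemma bounded_measurable_evolve (s t T : R) phi : 0 <= s <= T -> 0 <= t -> bounded_measurable phi ->
  bounded_measurable (fun x => expR (growth f w s x) * phi (flow w t x)).
Proof.
move=> sT t0 mp; apply: (@bounded_measurable_wpush R _ _ (F * T)) => //.
  exact: flow_measurable.
exact: growth_bounded.
Qed.

Lemma evolve_TVnorm (t T : R) nu : 0 <= t <= T ->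
  (TVnorm (evolve f w t nu) <= (expR (F * T) * tv nu)%:E)%E.
Proof.
move=> tT; apply: wpush_TVnorm; last exact: growth_bounded.
by apply: flow_measurable => //; have /andP[] := tT.
Qed.

Lemma evolve_lip_time (s t T : R) nu : 0 <= s <= T -> 0 <= t <= T ->
  (BLdist (evolve f w s nu) (evolve f w t nu) <=
    (expR (F * T) * (K + F) * tv nu * `|s - t|)%:E)%E.
Proof.
move=> sT tT; have /andP[s0 _] := sT; have /andP[t0 _] := tT.
rewrite (_ : _ * `|_| = expR (F * T) * (K * `|s - t| + F * `|s - t|) * tv nu); last by ring.
apply: wpush_dist; [exact: flow_measurable|exact: flow_measurable|exact: growth_bounded|exact:
  growth_bounded| |].
- by move=> x; exact: flow_lip_time.
- by move=> x; exact: growth_lip_time.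
Qed.

(** The function is the time derivative of [expR (growth f w t x)], so this is the second-order
    control behind [expR_growth_taylor]. *)
Lemma weighted_source_lip x (s t T : R) : 0 <= s <= T -> 0 <= t <= T ->
  `|expR (growth f w s x) * f (flow w s x) - expR (growth f w t x) * f (flow w t x)| <=
    expR (F * T) * (F * F + l * K) * `|s - t|.
Proof.
move=> sT tT; have /andP[s0 _] := sT; have /andP[t0 _] := tT.
rewrite (_ : _ - _ = expR (growth f w s x) * (f (flow w s x) - f (flow w t x)) +
  (expR (growth f w s x) - expR (growth f w t x)) * f (flow w t x)); last by ring.
apply: le_trans (ler_normD _ _) _; rewrite !normrM gtr0_norm ?expR_gt0//.
rewrite [leRHS](_ : _ = expR (F * T) * (l * (K * `|s - t|)) + expR (F * T) * (F * `|s - t|) *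
  F); last by ring.
have bs := growth_bounded sT; have bt := growth_bounded tT.
apply: lerD; apply: ler_pM; rewrite ?expR_ge0//.
- by rewrite ler_expR; exact: bs.2.
- apply: le_trans (fl _ _) _; rewrite ler_wpM2l//; exact: flow_lip_time.
- apply: le_trans (expR_lip (bs.2 x) (bt.2 x)) _; rewrite ler_wpM2l ?expR_ge0//.
  exact: growth_lip_time.
Qed.

Lemma expR_growth_taylor x (r h T : R) : 0 <= r -> 0 <= h -> r + h <= T ->
  `|expR (growth f w (r + h) x) - expR (growth f w r x) -
    h * (expR (growth f w r x) * f (flow w r x))| <=
  expR (F * T) * (F * F + l * K) * h ^+ 2.
Proof.
move=> r0 h0 rhT; pose c := expR (growth f w r x) * f (flow w r x).
pose u s := expR (growth f w s x) - (0 + (s - r) * c).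
pose M := expR (F * T) * (F * F + l * K).
have M0 : 0 <= M by rewrite mulr_ge0 ?expR_ge0// addr_ge0// mulr_ge0.
have rrh : r <= r + h by rewrite lerDl.
rewrite [leRHS](_ : _ = M * h * (r + h - r)); last by rewrite /M; ring.
rewrite (_ : _ - _ - _ = u (r + h) - u r); last by rewrite /u /c; ring.
apply: (@rel_deriv_le R u (fun s => expR (growth f w s x) * f (flow w s x) - c)) => //.
- exact: mulr_ge0.
- move=> s /andP[rs sh]; apply: rel_derivB; last exact: rel_deriv_affine.
  by apply: rel_deriv_expR_comp; apply: (growth_deriv fl bw) => //; rewrite rs.
- move=> s /andP[rs sh].
  have rT : 0 <= r <= T by rewrite r0 (le_trans _ rhT)// lerDl.
  have sT : 0 <= s <= T by rewrite (le_trans r0 rs) (le_trans sh).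
  apply: le_trans (weighted_source_lip x sT rT) _; rewrite -/M ler_wpM2l//.
  by rewrite ger0_norm ?subr_ge0// lerBlDl.
Qed.

(** A particle moved up to time [r], multiplied by [f] and transported for [t - r] ends at its
    position at time [t], whatever [r] is, by [flowD]. Tested against [phi], the integrand at time
    [r] is therefore the derivative in [r] of [E r phi], in which only the weight depends on [r],
    and the variation of constants formula is the fundamental theorem of calculus. *)
Lemma evolve_linear_solution (T : R) nu : 0 <= T ->
  is_linear_solution f w nu T (fun t => evolve f w t nu).
Proof.
move=> T0; split.
- apply: BL_continuous_lip => s t; exact: evolve_lip_time.
- by exists (expR (F * T) * tv nu) => t; exact: evolve_TVnorm.
- move=> t /andP[t0 tT]; have tt : 0 <= t <= t by rewrite t0 lexx.
  have mf := BL_bounded_measurable bf.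
  pose E r phi := pairing nu (fun x => expR (growth f w r x) * phi (flow w t x)).
  have FE r phi : 0 <= r <= t -> bounded_measurable phi ->
      pairing (transport w (t - r) (density f (evolve f w r nu))) phi =
      pairing nu (fun x => (expR (growth f w r x) * f (flow w r x)) * phi (flow w t x)).
    move=> /andP[r0 rt] mp; have tr0 : 0 <= t - r by rewrite subr_ge0.
    have mpt : bounded_measurable (phi \o flow w (t - r)).
      by apply: bounded_measurable_comp => //; exact: flow_measurable.
    rewrite pairing_transport// pairing_density// pairing_evolve//; last exact: bounded_measurableM.
    congr pairing; apply/funext => x /=.
    by rewrite flowD// (addrC r) subrK mulrA.
  pose C := expR (F * t) * (F * F + l * K).
  have C0 : 0 <= C by rewrite mulr_ge0 ?expR_ge0// addr_ge0// mulr_ge0.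
  have mE r phi : 0 <= r <= t -> bounded_measurable phi ->
      bounded_measurable (fun x => expR (growth f w r x) * phi (flow w t x)).
    by move=> rt; exact: (@bounded_measurable_evolve r t t).
  have mG r phi : 0 <= r <= t -> bounded_measurable phi ->
      bounded_measurable (fun x => (expR (growth f w r x) * f (flow w r x)) * phi (flow w t x)).
    move=> rt mp; apply: bounded_measurableM; last by apply: bounded_measurable_comp => //;
      exact: flow_measurable.
    have /andP[r0 _] := rt.
    exact: (@bounded_measurable_evolve r r t).
  have p1m phi : (BLnorm phi <= 1)%E -> bounded_measurable phi /\ sup_le phi 1.
    move=> /BLnorm1P[a [b [a0 b0 ab pa pb]]]; split.
      by apply: BL_bounded_measurable; apply/BLP; exists a, b.
    by move=> x; apply: le_trans (pa x) _; lra.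
  apply: (@bochner_of_antiderivative R t t0 _ E _ (C * tv nu)).
  + by rewrite mulr_ge0// tv_ge0.
  + by move=> r rt; exact: completion_pairing.
  + move=> phi /p1m[mp _] /=.
    rewrite pairing_evolve// pairing_transport//; congr (_ - _).
    by congr pairing; apply/funext => x; rewrite (growth0 fl bw) expR0 mul1r.
  + move=> phi r s /p1m[mp p1] rt st; rewrite !FE// mulrAC; apply: pairing_dist;
    [exact: mG|exact: mG|].
    move=> x; rewrite -mulrBl normrM -[leRHS]mulr1; apply: ler_pM => //.
    exact: weighted_source_lip.
  + move=> phi r h /p1m[mp p1] r0 h0 rht.
    have rt : 0 <= r <= t by rewrite r0 (le_trans _ rht)// lerDl.
    have rht' : 0 <= r + h <= t by rewrite rht addr_ge0.
    rewrite FE// /E mulrAC.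
    rewrite (_ : _ - _ - _ = pairing nu (fun x => expR (growth f w (r + h) x) * phi (flow w t x)) -
      pairing nu (fun x => h * (expR (growth f w r x) * f (flow w r x) * phi (flow w t x)) +
        expR (growth f w r x) * phi (flow w t x))); last first.
      by rewrite pairing_lin; [ring|exact: mG|exact: mE].
    apply: pairing_dist; first exact: mE.
      by apply: bounded_measurable_lin; [exact: mG|exact: mE].
    move=> x; rewrite (_ : _ - _ = (expR (growth f w (r + h) x) - expR (growth f w r x) -
      h * (expR (growth f w r x) * f (flow w r x))) * phi (flow w t x)); last by ring.
    rewrite normrM -[leRHS]mulr1; apply: ler_pM => //.
    exact: expR_growth_taylor.
Qed.

End fixed.
End evolve.

(** * Uniqueness for fixed velocity *)

Section unique.
Context {R : realType}.
Implicit Types (phi w f : I01 R -> R) (x : I01 R) (nu : Meas R) (mu : R -> Meas R).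

Lemma cvge0_near (T : Type) (G : set_system T) (FG : Filter G) (u : T -> \bar R) (e : R) :
  0 < e -> u x @[x --> G] --> 0%E -> \forall x \near G, (u x <= e%:E)%E.
Proof.
move=> e0 /fine_cvgP[fin /cvgrPdist_le /(_ e e0) h].
near=> x; have ux : u x \is a fin_num by near: x.
rewrite -(fineK ux) lee_fin; apply: le_trans (ler_norm _) _.
by rewrite -normrN -sub0r; near: x.
Unshelve. all: by end_near.
Qed.

Lemma integral_expR (c t : R) : 0 < c -> 0 <= t ->
  \int[lebesgue_measure]_(s in `[0, t]) expR (c * s) = (expR (c * t) - 1) / c.
Proof.
move=> c0; rewrite le_eqVlt => /orP[/eqP<-|t0].
  by rewrite set_itv1 Rintegral_set1 mulr0 expR0 subrr mul0r.
have dE (r : R) : is_derive r 1 (fun s => expR (c * s) / c) (expR (c * r)).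
  have h : is_derive r 1 ( *%R c) c.
    have := @is_deriveZ R R R id c r 1 1 (is_derive_id _ _).
    by rewrite [_ *: 1]mulr1.
  have h1 := is_derive1_comp (is_derive_expR (c * r)) h.
  have := @is_deriveZ R R R _ c^-1 r 1 _ h1.
  rewrite (_ : _ *: (_ * c) = expR (c * r)); last first.
    by rewrite [_ *: _]mulrC mulfK// gt_eqF.
  rewrite (_ : _ \*: _ = (fun s => expR (c * s) / c))//.
  by apply/funext => s /=; rewrite [_ *: _]mulrC.
have cE : continuous (fun s => expR (c * s) / c).
  by move=> r; apply: differentiable_continuous; apply/derivable1_diffP;
    exact: (@ex_derive _ _ _ _ _ _ _ (dE r)).
have cE' : continuous (fun s : R => expR (c * s)).
  move=> r; apply: continuous_comp; last exact: continuous_expR.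
  exact: mulrl_continuous.
have := @continuous_FTC2 R (fun s => expR (c * s)) (fun s => expR (c * s) / c) 0 t t0.
rewrite /Rintegral => -> //=.
- by rewrite mulr0 expR0; ring.
- exact: continuous_subspaceT.
- split.
  + by move=> r _; exact: (@ex_derive _ _ _ _ _ _ _ (dE r)).
  + by apply: cvg_at_right_filter; exact: cE.
  + by apply: cvg_at_left_filter; exact: cE.
- by move=> r _; rewrite derive1E; exact: (@derive_val _ _ _ _ _ _ _ (dE r)).
Qed.

Section fixed.
Variables (f w : I01 R -> R) (F l K L : R) (nu : Meas R) (T : R).
Hypotheses (fF : sup_le f F) (fl : lip_le f l) (wK : sup_le w K) (wL : lip_le w L).
Hypothesis T0 : 0 <= T.

Let bf : BL f. Proof. by apply/BLP; exists F, l. Qed.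
Let bw : BL w. Proof. by apply/BLP; exists K, L. Qed.
Let F0 := sup_le_ge0 fF.
Let l0 := lip_le_ge0 fl.
Let K0 := sup_le_ge0 wK.
Let L0 := lip_le_ge0 wL.
(** A bound for [test phi s] in the BL norm when [phi] has BL norm at most 1 and [s <= T]; the
    summand 1 makes it positive. *)
Let A := F * expR (L * T) + l + 1.
Let A0 : 0 < A.
Proof. by rewrite ltr_wpDl// addr_ge0// mulr_ge0// expR_ge0. Qed.

(* By duality, applying [P_s (f . _)] to a measure amounts to testing it against
   [test phi s]. *)
Definition test phi (s : R) x := f x * phi (flow w s x).

Lemma test_BL phi (a b s : R) : 0 <= a -> 0 <= b -> a + b <= 1 -> sup_le phi a -> lip_le phi b ->
  0 <= s <= T -> exists a' b' : R, [/\ 0 <= a', 0 <= b', a' + b' <= A,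
    sup_le (test phi s) a' & lip_le (test phi s) b'].
Proof.
move=> a0 b0 ab pa pb /andP[s0 sT].
have E1 : 1 <= expR (L * T) by rewrite -expR0 ler_expR mulr_ge0.
have EF := ler_wpM2l F0 E1.
have b'0 : 0 <= F * (b * expR (L * T)) + l * a.
  by rewrite addr_ge0// !mulr_ge0// expR_ge0.
exists (F * a), (F * (b * expR (L * T)) + l * a); split => //.
- exact: mulr_ge0.
- have h1 : F * a <= F * expR (L * T) * a by rewrite ler_wpM2r// -[leLHS]mulr1.
  have h2 : F * expR (L * T) * (a + b) <= F * expR (L * T).
    by rewrite ler_piMr// mulr_ge0// expR_ge0.
  have h3 : l * a <= l by rewrite ler_piMr//; lra.
  by rewrite /A; move: h1 h2 h3; set E := expR _; lra.
- by move=> x; rewrite /test normrM ler_pM.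
- move=> x y; rewrite /test (_ : _ - _ = f x * (phi (flow w s x) - phi (flow w s y)) +
    (f x - f y) * phi (flow w s y)); last by ring.
  apply: le_trans (ler_normD _ _) _; rewrite !normrM mulrDl; apply: lerD.
    rewrite -mulrA; apply: ler_pM => //; rewrite -mulrA.
    apply: le_trans (pb _ _) _; rewrite ler_wpM2l//.
    apply: le_trans (flow_lip _ _ bw wL s0) _; rewrite ler_wpM2r// ler_expR.
    exact: ler_wpM2l.
  by rewrite mulrAC; apply: ler_pM.
Qed.

Lemma test_bounded_measurable phi (s : R) : bounded_measurable phi -> 0 <= s ->
  bounded_measurable (test phi s).
Proof.
move=> mp s0; apply: bounded_measurableM; first exact: BL_bounded_measurable.
by apply: bounded_measurable_comp => //; exact: flow_measurable.
Qed.

(** The measure and the test function both move with [s]. The first is handled by the continuity of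
    [mu], since the test functions stay in a ball of BL, the second by the total variation of the
    fixed measure [mu s0]. This provides the measurability that [bochner_scalar] asks for. *)
Lemma test_continuous mu phi (t : R) : BL_continuous T mu -> (BLnorm phi <= 1)%E ->
  0 <= t <= T -> {within `[0, t], continuous (fun s => pairing (mu s) (test phi (t - s)))}.
Proof.
move=> cmu p1 /andP[t0 tT]; have [a [b [a0 b0 ab pa pb]]] := BLnorm1P p1.
have mp : bounded_measurable phi by apply: BL_bounded_measurable; apply/BLP; exists a, b.
apply/subspace_continuousP => s0 /=; rewrite in_itv/= => /andP[s00 s0t].
apply/cvgrPdist_le => e e0.
have s0T : 0 <= s0 <= T by rewrite s00 (le_trans s0t).
have e2 : 0 < e / 2 / A by rewrite !divr_gt0.
pose k := F * (b * K) * tv (mu s0) + 1.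
have k0 : 0 < k by rewrite ltr_wpDl// !mulr_ge0// tv_ge0.
have := cvge0_near _ e2 (cmu s0 s0T); rewrite near_withinE => h1.
have h2 : \forall s \near s0, `|s0 - s| < e / 2 / k.
  by exists (e / 2 / k) => [|s] /=; first by rewrite !divr_gt0.
near=> s; rewrite /= /from_subspace in_itv/= => /andP[ss st].
have sT : `[0, T]%classic s by rewrite /= in_itv/= ss (le_trans st).
have d1 : (BLdist (mu s) (mu s0) <= (e / 2 / A)%:E)%E by move: sT; near: s; exact: h1.
have d2 : `|s0 - s| < e / 2 / k by near: s.
have ts0 : 0 <= t - s by rewrite subr_ge0.
have ts00 : 0 <= t - s0 by rewrite subr_ge0.
have tsT : 0 <= t - s <= T by rewrite ts0/= lerBlDr (le_trans tT)// lerDl.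
have [a' [b' [a'0 b'0 ab' ta tb]]] := test_BL a0 b0 ab pa pb tsT.
have h3 := BLdist_bound d1 a'0 b'0 ta tb.
have h4 : `|pairing (mu s0) (test phi (t - s)) - pairing (mu s0) (test phi (t - s0))| <=
    F * (b * K) * `|s0 - s| * tv (mu s0).
  apply: pairing_dist; [exact: test_bounded_measurable|exact: test_bounded_measurable|].
  move=> x; rewrite /test -mulrBr normrM -mulrA; apply: ler_pM => //.
  apply: le_trans (pb _ _) _; rewrite -mulrA ler_wpM2l//.
  apply: le_trans (flow_lip_time x bw wK ts0 ts00) _.
  by rewrite (_ : t - s - (t - s0) = s0 - s)//; ring.
have h5 : e / 2 / A * (a' + b') <= e / 2.
  apply: (@le_trans _ _ (e / 2 / A * A)); first by rewrite ler_wpM2l// ltW.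
  by rewrite divfK// gt_eqF.
have h6 : F * (b * K) * `|s0 - s| * tv (mu s0) <= e / 2.
  rewrite mulrAC; apply: (@le_trans _ _ (k * `|s0 - s|)).
    by rewrite ler_wpM2r// /k lerDl.
  by rewrite mulrC -ler_pdivlMr// ltW.
rewrite distrC.
apply: le_trans (ler_distD (pairing (mu s0) (test phi (t - s))) _ _) _.
by move: h3 h4 h5 h6; lra.
Unshelve. all: by end_near.
Qed.

Lemma linear_solution_scalar mu phi (t C : R) : is_linear_solution f w nu T mu ->
  (forall s, 0 <= s <= T -> (TVnorm (mu s) <= C%:E)%E) ->
  (BLnorm phi <= 1)%E -> 0 <= t <= T ->
  lebesgue_measure.-integrable `[0, t] (EFin \o (fun s => pairing (mu s) (test phi (t - s)))) /\
  pairing (mu t) phi - pairing (transport w t nu) phi =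
  \int[lebesgue_measure]_(s in `[0, t]) pairing (mu s) (test phi (t - s)).
Proof.
move=> [cmu _ smu] muC p1 tT; have /andP[t0 tleT] := tT.
have [a [b [a0 b0 ab pa pb]]] := BLnorm1P p1.
have mp : bounded_measurable phi by apply: BL_bounded_measurable; apply/BLP; exists a, b.
have mD : measurable (`[0, t]%classic : set R) by exact: measurable_itv.
have mg : measurable_fun `[0, t] (fun s => pairing (mu s) (test phi (t - s))).
  by apply: subspace_continuous_measurable_fun => //; exact: test_continuous.
have bd s : 0 <= s <= t -> `|pairing (mu s) (test phi (t - s))| <= A * C.
  move=> /andP[s0 st]; have ts0 : 0 <= t - s by rewrite subr_ge0.
  have tsT : 0 <= t - s <= T by rewrite ts0/= lerBlDr (le_trans tleT)// lerDl.
  have [a' [b' [a'0 b'0 ab' ta tb]]] := test_BL a0 b0 ab pa pb tsT.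
  apply: le_trans (pairing_bound (mu s) (test_bounded_measurable mp ts0) ta) _.
  apply: ler_pM => //; first exact: tv_ge0.
    by move: ab' b'0; lra.
  by rewrite -lee_fin -TVnormE; apply: muC; rewrite s0 (le_trans st).
have finD : (@lebesgue_measure R `[0%R, t]%classic < +oo)%E.
  by rewrite lebesgue_measure_itv/=; case: ifPn => // _; rewrite -EFinB ltry.
split.
  apply: measurable_bounded_integrable => //.
  exists (A * C); split; first by rewrite num_real.
  by move=> b' cb r /= rt; apply: le_trans (ltW cb); apply: bd; move: rt; rewrite in_itv.
have E s : `[0, t]%classic s -> pairing (transport w (t - s) (density f (mu s))) phi =
    pairing (mu s) (test phi (t - s)).
  rewrite /= in_itv/= => /andP[s0 st]; have ts0 : 0 <= t - s by rewrite subr_ge0.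
  have mpt : bounded_measurable (phi \o flow w (t - s)).
    by apply: bounded_measurable_comp => //; exact: flow_measurable.
  by rewrite pairing_transport// pairing_density//; exact: BL_bounded_measurable.
transitivity ((pairing (mu t) \- pairing (transport w t nu)) phi) => //.
rewrite (@bochner_scalar R t _ _ phi (A * C) (smu t tT) p1).
- by apply: eq_Rintegral => s /set_mem; exact: E.
- by apply: eq_measurable_fun mg => s /set_mem /E.
- by move=> s st; rewrite E ?bd// /= in_itv.
Qed.

(* The weight [expR (2 A t)] makes the Duhamel map a contraction, as in [picard_contract]. *)
Lemma linear_solution_unique mu mu' : is_linear_solution f w nu T mu ->
  is_linear_solution f w nu T mu' -> forall t, 0 <= t <= T -> eqM (mu t) (mu' t).
Proof.
move=> smu smu'; have [_ [C muC] _] := smu; have [_ [C' muC'] _] := smu'.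
pose c := C + C'.
have TVC m B : (TVnorm m <= B%:E)%E -> forall phi, (BLnorm phi <= 1)%E -> `|pairing m phi| <= B.
  move=> mB phi /BLnorm1P[a [b [a0 b0 ab pa pb]]].
  have mp : bounded_measurable phi by apply: BL_bounded_measurable; apply/BLP; exists a, b.
  apply: le_trans (pairing_bound m mp pa) _.
  have := tv_ge0 m; rewrite TVnormE lee_fin in mB => m0.
  apply: le_trans mB; rewrite ler_piMl//; lra.
have c0 : 0 <= c.
  have h1 := tv_ge0 (mu 0); have h2 := tv_ge0 (mu' 0).
  have := muC 0; have := muC' 0; rewrite lexx T0 !TVnormE !lee_fin => /(_ isT) h3 /(_ isT) h4.
  by rewrite /c; lra.
have key n : forall t phi, 0 <= t <= T -> (BLnorm phi <= 1)%E ->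
    `|pairing (mu t) phi - pairing (mu' t) phi| <= c * (1 / 2) ^+ n * expR (2 * A * t).
  elim: n => [|n IH] t phi tT p1.
    have /andP[t0 _] := tT.
    have E1 : 1 <= expR (2 * A * t) by rewrite -expR0 ler_expR !mulr_ge0// ltW.
    apply: le_trans (ler_normB _ _) _; rewrite expr0 mulr1.
    apply: le_trans (lerD (TVC _ _ (muC t tT) _ p1) (TVC _ _ (muC' t tT) _ p1)) _.
    by rewrite ler_peMr.
  have /andP[t0 tleT] := tT.
  have [a [b [a0 b0 ab pa pb]]] := BLnorm1P p1.
  have [i1 e1] := linear_solution_scalar smu muC p1 tT.
  have [i2 e2] := linear_solution_scalar smu' muC' p1 tT.
  rewrite (_ : _ - _ = (pairing (mu t) phi - pairing (transport w t nu) phi) -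
    (pairing (mu' t) phi - pairing (transport w t nu) phi)); last by ring.
  have mD : measurable (`[0, t]%classic : set R) by exact: measurable_itv.
  rewrite e1 e2 -RintegralB//.
  pose g s := pairing (mu s) (test phi (t - s)); pose g' s := pairing (mu' s) (test phi (t - s)).
  have iB : lebesgue_measure.-integrable `[0, t] (EFin \o (fun s => g s - g' s)).
    rewrite (_ : _ \o _ = ((EFin \o g) \- (EFin \o g'))%E); first exact: integrableB.
    exact/funext.
  apply: le_trans (le_normr_Rintegral _ iB) _; first exact: mD.
  pose k := c * (1 / 2) ^+ n * A.
  have iE : lebesgue_measure.-integrable `[0, t] (EFin \o (fun s => expR (2 * A * s))).
    apply: continuous_compact_integrable; first exact: segment_compact.
    apply: continuous_subspaceT => r; apply: continuous_comp; last exact: continuous_expR.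
    exact: mulrl_continuous.
  have ikE : lebesgue_measure.-integrable `[0, t] (EFin \o (fun s => k * expR (2 * A * s))).
    rewrite (_ : _ \o _ = (fun s => k%:E * (EFin \o (fun s => expR (2 * A * s))) s)%E);
      last exact/funext.
    exact: integrableZl.
  apply: (@le_trans _ _ (\int[lebesgue_measure]_(s in `[0, t]) (k * expR (2 * A * s)))).
    apply: le_Rintegral => //.
      exact: (integrable_norm iB).
    move=> s; rewrite /= in_itv/= => /andP[s0 st].
    have ts0 : 0 <= t - s by rewrite subr_ge0.
    have tsT : 0 <= t - s <= T by rewrite ts0/= lerBlDr (le_trans tleT)// lerDl.
    have sT : 0 <= s <= T by rewrite s0 (le_trans st).
    have [a' [b' [a'0 b'0 ab' ta tb]]] := test_BL a0 b0 ab pa pb tsT.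
    have d : (BLdist (mu s) (mu' s) <= (c * (1 / 2) ^+ n * expR (2 * A * s))%:E)%E.
      by apply/dual_normP => psi q1; exact: IH.
    apply: le_trans (BLdist_bound d a'0 b'0 ta tb) _.
    rewrite /k (mulrAC _ A (expR (2 * A * s))) ler_wpM2l // ?mulr_ge0 ?expR_ge0 ?exprn_ge0 //.
  have A20 : 0 < 2 * A by rewrite mulr_gt0.
  (* Integrating the weight gains a factor [1 / (2 * A)] against the [A] lost to the test functions,
     so each iteration halves the bound. *)
  rewrite RintegralZl// integral_expR// /k exprS.
  rewrite (_ : _ * A * _ = c * (1 / 2 * (1 / 2) ^+ n) * (expR (2 * A * t) - 1)); last first.
    by field; rewrite gt_eqF.
  rewrite ler_wpM2l//; last by lra.
  by rewrite mulr_ge0// mulr_ge0 ?divr_ge0//; apply: exprn_ge0; lra.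
move=> t tT; apply: eqM_of_BL => phi bp.
have d : (BLdist (mu t) (mu' t) <= 0%:E)%E.
  apply/dual_normP => psi p1 /=.
  apply: (@le_cvg0 R _ _ (fun n => c * expR (2 * A * t) * (1 / 2) ^+ n)); last exact: cvg_geo0.
  by move=> n; rewrite add0r mulrAC; exact: key.
have /BLP[a [b [pa pb]]] := bp.
have := BLdist_bound d (sup_le_ge0 pa) (lip_le_ge0 pb) pa pb.
by rewrite mul0r normr_le0 subr_eq0 => /eqP.
Qed.

End fixed.

(** [linear_operator] chooses some solution on [[0, t]]; uniqueness makes its value at [t] that of
    the explicit one. *)
Lemma linear_operatorE f w (t : R) nu : BL f -> BL w -> 0 <= t ->
  eqM (linear_operator f w t nu) (evolve f w t nu).
Proof.
move=> /BLP[F [l [fF fl]]] /BLP[K [L [wK wL]]] t0.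
have sol := evolve_linear_solution fF fl wK wL nu t0.
have := @choose_orP _ (fun=> czero : Meas R) [set mu | is_linear_solution f w nu t mu] (ex_intro
  _ _ sol).
move=> h; apply: (linear_solution_unique fF fl wK wL t0 h sol).
by rewrite t0 lexx.
Qed.

End unique.

(** * Euler schemes on the space of states *)

Section euler.
Context {R : realType}.
Variables (f : I01 R -> R) (mu0 : Meas R) (v : Meas R -> I01 R -> R).
Hypotheses (bf : BL f) (hv : velocity_assumption v).
Implicit Types (w phi : I01 R -> R) (x : I01 R).

Lemma velocity_BL m : BL (v m). Proof. exact: hv.1. Qed.

(** The sign of [M] is not prescribed; with [|M|] any upper bound [d] of the distance can be
    inserted. *)
Lemma velocity_constants (r : R) : 0 < r -> exists K L M : R, 0 <= M /\
  forall m n, (TVnorm m <= r%:E)%E -> (TVnorm n <= r%:E)%E ->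
  [/\ sup_le (v m) K, lip_le (v m) L &
    forall d : R, (BLdist m n <= d%:E)%E -> forall x, `|v m x - v n x| <= M * d].
Proof.
move=> /hv.2[K [L [M H]]]; exists K, L, `|M|; split => // m n mr nr.
have [/supnormP hK /lip_constP hL hM] := H m n mr nr; split => // d md.
apply/supnormP; apply: le_trans hM _; rewrite EFinM.
apply: (@le_trans _ _ (`|M|%:E * BLdist m n)%E).
  by apply: lee_wpmul2r; [exact: dual_norm_ge0|rewrite lee_fin ler_norm].
by apply: lee_wpmul2l.
Qed.

Lemma eqM_BLdist (m n : Meas R) : eqM m n -> (BLdist m n <= 0%:E)%E.
Proof.
move=> mn; apply/dual_normP => phi p1 /=.
have mp : bounded_measurable phi.
  have [a [b [_ _ _ pa pb]]] := BLnorm1P p1.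
  by apply: BL_bounded_measurable; apply/BLP; exists a, b.
by rewrite (eqM_pairing mn mp) subrr normr0.
Qed.

(** Charges equal on measurable sets may still differ as functions. The Lipschitz condition on [v]
    does not see the difference, since their [BLdist] is 0. *)
Lemma velocity_eqM (m n : Meas R) : eqM m n -> v m = v n.
Proof.
move=> mn; pose r := tv m + tv n + 1.
have r0 : 0 < r by rewrite ltr_wpDl// addr_ge0// tv_ge0.
have [K [L [M [M0 H]]]] := velocity_constants r0.
have mr : (TVnorm m <= r%:E)%E by rewrite TVnormE lee_fin /r; have := tv_ge0 n; lra.
have nr : (TVnorm n <= r%:E)%E by rewrite TVnormE lee_fin /r; have := tv_ge0 m; lra.
have [_ _ /(_ 0 (eqM_BLdist mn)) h] := H m n mr nr.
by apply/funext => x; apply/eqP; rewrite -subr_eq0 -normr_le0 -(mulr0 M).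
Qed.

(* [X x] records the current position of the particle started at [x] and the
   logarithm of its mass; the measures of the scheme are [mu_of X]. *)
Definition state : Type := I01 R -> (I01 R * R)%type.

Definition initial : state := fun x => (x, 0).

Definition step w (t : R) (X : state) : state :=
  fun x => (flow w t (X x).1, (X x).2 + growth f w t (X x).1).

Definition mu_of (X : state) : Meas R := wpush (fun x => (X x).1) (fun x => (X x).2) mu0.

Definition sdist (X Y : state) x : R :=
  `|I01val (X x).1 - I01val (Y x).1| + `|((X x).2 : R) - ((Y x).2 : R)|.

Definition admissible_state (B : R) (X : state) :=
  measurable_fun setT (fun x => (X x).1) /\ bounded_above_measurable (fun x => (X x).2) B.

Lemma sdist_fst X Y x : `|I01val (X x).1 - I01val (Y x).1| <= sdist X Y x.
Proof. by rewrite lerDl. Qed.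

Lemma sdist_snd X Y x : `|((X x).2 : R) - ((Y x).2 : R)| <= sdist X Y x.
Proof. by rewrite lerDr. Qed.

Lemma sdistC X Y x : sdist X Y x = sdist Y X x.
Proof. by rewrite /sdist distrC (distrC (X x).2). Qed.

Lemma sdist_triangle Y X Z x : sdist X Z x <= sdist X Y x + sdist Y Z x.
Proof.
rewrite /sdist; have := ler_distD (I01val (Y x).1) (I01val (X x).1) (I01val (Z x).1).
by have := ler_distD (Y x).2 (X x).2 (Z x).2; lra.
Qed.

Lemma step0 w X : BL w -> step w 0 X = X.
Proof.
move=> bw; have /BLP[F [l [fF fl]]] := bf.
by apply/funext => x; rewrite /step flow0// (growth0 fl bw) addr0; case: (X x).
Qed.

Lemma stepD w (s t : R) X : BL w -> 0 <= s -> 0 <= t ->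
  step w t (step w s X) = step w (s + t) X.
Proof.
move=> bw s0 t0; have /BLP[F [l [fF fl]]] := bf.
by apply/funext => x; rewrite /step /= flowD// (growthD fl bw _ s0 t0) addrA.
Qed.

Lemma pairing_mu_of B X phi : admissible_state B X -> bounded_measurable phi ->
  pairing (mu_of X) phi = pairing mu0 (fun x => expR (X x).2 * phi (X x).1).
Proof. by move=> [m1 m2] mp; exact: pairing_wpush m2 mp. Qed.

Lemma mu_of_TVnorm B X : admissible_state B X ->
  (TVnorm (mu_of X) <= (expR B * tv mu0)%:E)%E.
Proof. by move=> [m1 m2]; exact: wpush_TVnorm. Qed.

Lemma mu_of_dist B X Y (r : R) : admissible_state B X -> admissible_state B Y ->
  (forall x, sdist X Y x <= r) ->
  (BLdist (mu_of X) (mu_of Y) <= (expR B * 2 * tv mu0 * r)%:E)%E.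
Proof.
move=> [m1 m2] [n1 n2] XY.
rewrite (_ : _ * r = expR B * (r + r) * tv mu0); last by ring.
apply: wpush_dist => // x; apply: le_trans (XY x); rewrite /sdist; first by rewrite lerDl.
by rewrite lerDr.
Qed.

Lemma mu_of_initial : eqM mu0 (mu_of initial).
Proof.
have a0 : admissible_state 0 initial by split; [exact: measurable_id|split;
  [exact: measurable_cst|]].
apply: eqM_of_BL => phi /BL_bounded_measurable mp; rewrite (pairing_mu_of a0 mp).
by congr pairing; apply/funext => x /=; rewrite expR0 mul1r.
Qed.

Lemma mu_of_positive B X : mu0.-positive_set setT -> admissible_state B X ->
  (mu_of X).-positive_set setT.
Proof.
move=> p0 aX; split => // A mA _.
have fin : mu_of X A \is a fin_num by exact: fin_num_measure.
rewrite -(fineK fin) lee_fin -pairing_indic// (pairing_mu_of aX);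
  last exact: bounded_measurable_indic.
have [m1 m2] := aX.
apply: pairing_ge0 => //.
  by apply: bounded_measurable_wpush m2 _ => //; exact: bounded_measurable_indic.
Qed.

Section constants.
Variables (F l : R).
Hypotheses (fF : sup_le f F) (fl : lip_le f l).
Let F0 := sup_le_ge0 fF.
Let l0 := lip_le_ge0 fl.

Lemma admissible_step B X w (t : R) : BL w -> 0 <= t -> admissible_state B X ->
  admissible_state (B + F * t) (step w t X).
Proof.
move=> bw t0 [m1 [m2 m3]]; split.
  by apply: measurableT_comp m1; exact: flow_measurable.
split.
  apply: measurable_funD => //; apply: measurableT_comp m1.
  exact: growth_measurable.
move=> x; apply: lerD => //; apply: le_trans (ler_norm _) _.
exact: growth_le.
Qed.

(** Lifts the linear evolution to states: weights multiply, so exponents add, which is what [step]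
    does. The equality is [eqM] because an Euler approximation is determined only up to it. *)
Lemma linear_operator_mu_of B X w (t : R) nu : admissible_state B X -> BL w -> 0 <= t ->
  eqM nu (mu_of X) -> eqM (linear_operator f w t nu) (mu_of (step w t X)).
Proof.
move=> aX bw t0 nuX A mA; rewrite (linear_operatorE nu bf bw t0 mA); move: A mA.
have aS := admissible_step bw t0 aX.
apply: eqM_of_BL => phi /BL_bounded_measurable mp.
have /BLP[K [L [wK wL]]] := bw.
have mE : bounded_measurable (fun x => expR (growth f w t x) * phi (flow w t x)).
  by apply: (bounded_measurable_evolve fF fl wK wL (T := t)) => //; rewrite t0 lexx.
rewrite (pairing_evolve fF fl wK wL)// (eqM_pairing nuX mE) (pairing_mu_of aX mE) (pairing_mu_of
  aS mp).
by congr pairing; apply/funext => x; rewrite mulrA -expRD.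
Qed.

(** Positions separate at rate [L]. The exponents separate by at most [l * t] times the resulting
    bound on the positions, and [1 + l * t <= expR (l * t)] merges the two rates into [L + l]. *)
Lemma step_dist w w' (L c t : R) X Y x : BL w -> BL w' -> lip_le w L -> 0 <= t ->
  (forall z, `|w z - w' z| <= c) ->
  sdist (step w t X) (step w' t Y) x <= expR ((L + l) * t) * (sdist X Y x + c * t).
Proof.
move=> bw bw' wL t0 wc; have L0 := lip_le_ge0 wL.
have c0 : 0 <= c by apply: le_trans (wc (clamp 0)).
rewrite /sdist /step /=.
have h1 := flow_dist (X x).1 (Y x).1 bw bw' wL t0 wc.
have h2 := growth_dist (X x).1 (Y x).1 fF fl bw bw' wL t0 wc.
set d1 := `|I01val (X x).1 - I01val (Y x).1| in h1 h2 *.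
set d2 := `|((X x).2 : R) - ((Y x).2 : R)|.
have h3 : `|(X x).2 + growth f w t (X x).1 - ((Y x).2 + growth f w' t (Y x).1)| <=
    d2 + `|growth f w t (X x).1 - growth f w' t (Y x).1|.
  by rewrite opprD addrACA; exact: ler_normD.
have E1 : 1 <= expR (L * t) by rewrite -expR0 ler_expR mulr_ge0.
have E2 : 1 + l * t <= expR (l * t) by exact: expR_ge1Dx.
have lt0 : 0 <= l * t by rewrite mulr_ge0.
have ct0 : 0 <= c * t by rewrite mulr_ge0.
have dc : 0 <= d1 + c * t by apply: addr_ge0 => //; exact: normr_ge0.
rewrite (mulrDl L) expRD; set EL := expR (L * t) in h1 h2 E1 *; set El := expR (l * t) in E2 *.
have h4 : EL * (1 + l * t) * (d1 + c * t) <= EL * El * (d1 + c * t).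
  by rewrite ler_wpM2r// ler_wpM2l// (le_trans ler01).
have h5 : d2 <= EL * El * d2.
  apply: ler_peMl; first exact: normr_ge0.
  by rewrite -[leLHS]mulr1; apply: ler_pM => //; lra.
by lra.
Qed.

Lemma step_lip w (K t : R) X x : BL w -> sup_le w K -> 0 <= t ->
  sdist (step w t X) X x <= (K + F) * t.
Proof.
move=> bw wK t0; rewrite /sdist /step /= mulrDl; apply: lerD.
  have := flow_lip_time (X x).1 bw wK t0 (lexx 0).
  by rewrite flow0// subr0 (ger0_norm t0).
by rewrite addrC addKr; exact: growth_le.
Qed.

End constants.
End euler.
Arguments state : clear implicits.

(** * Comparison of Euler schemes *)

Section scheme.
Context {R : realType}.
Variables (f : I01 R -> R) (mu0 : Meas R) (v : Meas R -> I01 R -> R).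
Hypotheses (bf : BL f) (hv : velocity_assumption v).
Implicit Types (X Y : R -> state R) (x : I01 R).

Definition frozen_velocity (X : state R) := v (mu_of mu0 X).

Let bv (X : state R) : BL (frozen_velocity X). Proof. exact: velocity_BL. Qed.

(* On a piece, the velocity is frozen at its value at the left end point. *)
Definition piece X (p q : R) := [/\ 0 <= p, p < q &
  forall r s, p <= r -> r <= s -> s <= q ->
    X s = step f (frozen_velocity (X p)) (s - r) (X r)].

(** The partition is hidden: every time lies in a piece of length at most [h], available to its
    right and to its left, as continuous induction demands. Two schemes can thus be compared without
    a common refinement. *)
Definition euler_scheme (T h : R) X := [/\ X 0 = @initial R,
  (forall t, 0 <= t < T -> exists p q, [/\ piece X p q, p <= t < q & q - p <= h]) &
  (forall t, 0 < t <= T -> exists p q, [/\ piece X p q, p < t <= q & q - p <= h])].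

Lemma euler_schemeW (T T' h : R) X : T' <= T -> euler_scheme T h X -> euler_scheme T' h X.
Proof.
move=> TT' [X0 right left]; split => // t /andP[t0 tT].
  by apply: right; rewrite t0 (lt_le_trans tT).
by apply: left; rewrite t0 (le_trans tT).
Qed.

Lemma admissible_stateW (B B' : R) (X : state R) : B <= B' ->
  admissible_state B X -> admissible_state B' X.
Proof. by move=> BB' [m1 [m2 m3]]; split => //; split => // x; exact: le_trans (m3 x) BB'. Qed.

Section horizon.
Variables (T F l K L M : R).
Hypotheses (T0 : 0 <= T) (fF : sup_le f F) (fl : lip_le f l) (M0 : 0 <= M).
Let F0 := sup_le_ge0 fF.
Let l0 := lip_le_ge0 fl.

(** An a priori bound for the total variation of all measures of a scheme on [[0, T]]; the summand 1
    makes it an admissible radius in the velocity assumption when [mu0 = 0]. *)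
Definition mass_bound := expR (F * T) * tv mu0 + 1.

Hypothesis vR : forall m n, (TVnorm m <= mass_bound%:E)%E -> (TVnorm n <= mass_bound%:E)%E ->
  [/\ sup_le (v m) K, lip_le (v m) L &
    forall d : R, (BLdist m n <= d%:E)%E -> forall x, `|v m x - v n x| <= M * d].

Lemma euler_admissible h X : euler_scheme T h X ->
  forall t, 0 <= t <= T -> admissible_state (F * t) (X t).
Proof.
move=> [X0 right left]; apply: real_induction.
- rewrite X0 mulr0; split; first exact: measurable_id.
  by split; [exact: measurable_cst|].
- move=> t tT IH; have [p [q [[p0 pq pX] /andP[pt tq] _]]] := right t tT.
  exists (q - t); first by rewrite subr_gt0.
  move=> s /andP[ts sq] sT; have {sq}sq : s <= q by lra.
  rewrite (pX t s pt (ltW ts) sq) (_ : F * s = F * t + F * (s - t)); last by ring.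
  apply: (admissible_step bf fF fl) => //; first by rewrite subr_ge0 ltW.
  by apply: IH; have /andP[-> _] := tT; rewrite lexx.
- move=> t tT IH; have [p [q [[p0 pq pX] /andP[pt tq] _]]] := left t tT.
  rewrite (pX p t (lexx p) (ltW pt) tq) (_ : F * t = F * p + F * (t - p)); last by ring.
  apply: (admissible_step bf fF fl) => //; first by rewrite subr_ge0 ltW.
  by apply: IH; rewrite p0.
Qed.

Lemma euler_admissibleT h X t : euler_scheme T h X -> 0 <= t <= T ->
  admissible_state (F * T) (X t).
Proof.
move=> eX tT; apply: admissible_stateW (euler_admissible eX tT).
by rewrite ler_wpM2l//; case/andP: tT.
Qed.

Lemma admissible_TVnorm (X : state R) : admissible_state (F * T) X ->
  (TVnorm (mu_of mu0 X) <= mass_bound%:E)%E.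
Proof.
move=> aX; apply: le_trans (mu_of_TVnorm mu0 aX) _.
by rewrite lee_fin lerDl.
Qed.

Lemma K_ge0 (X : state R) : admissible_state (F * T) X -> 0 <= K.
Proof.
by move=> /admissible_TVnorm h; have [hK _ _] := vR h h; exact: sup_le_ge0 hK.
Qed.

Lemma piece_lip h X p q : euler_scheme T h X -> piece X p q -> p <= T ->
  forall r s x, p <= r -> r <= s -> s <= q -> sdist (X s) (X r) x <= (K + F) * (s - r).
Proof.
move=> eX [p0 pq pX] pT r s x pr rs sq.
have pT' : 0 <= p <= T by rewrite p0.
have h1 := admissible_TVnorm (euler_admissibleT eX pT').
have [hK _ _] := vR h1 h1.
rewrite (pX r s pr rs sq); apply: (step_lip fF fl) => //.
by rewrite subr_ge0.
Qed.

(** [gronwall] with rate 0 passes from one piece to the next without counting pieces. *)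
Lemma euler_lip h X (s t : R) x : euler_scheme T h X -> 0 <= s -> s <= t -> t <= T ->
  sdist (X t) (X s) x <= (K + F) * (t - s).
Proof.
move=> eX s0 st tT.
have a0 := euler_admissibleT eX (_ : 0 <= 0 <= T).
have K0 : 0 <= K by apply: K_ge0; apply: a0; rewrite lexx.
have c0 : 0 <= K + F by rewrite addr_ge0.
have [_ right left] := eX.
have := @gronwall R (I01 R) (fun x t => sdist (X t) (X s) x) s T 0 (K + F) 0 (lexx _) c0 (lexx
  _) _ _ _ t _ x.
rewrite mul0r expR0 mul1r add0r; apply; last by rewrite st.
- move=> y r /andP[sr rT] e e0.
  have [p [q [pXq /andP[pr rq] _]]] := left r ltac:(by rewrite (le_lt_trans s0 sr)).
  have k0 : 0 < K + F + 1 by rewrite ltr_wpDl.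
  exists (Num.min (r - p) (e / (K + F + 1))); first by rewrite lt_min subr_gt0 pr divr_gt0.
  move=> u su /andP[ur ur'].
  have h1 : r - u < r - p by apply: lt_le_trans (_ : Num.min (r - p) (e / (K + F + 1)) <= _);
    [lra|rewrite ge_min lexx].
  have h2 : r - u < e / (K + F + 1) by apply: lt_le_trans (_ : Num.min (r - p) (e / (K + F + 1))
    <= _); [lra|rewrite ge_min lexx orbT].
  have pu : p <= u by lra.
  have h3 := piece_lip eX pXq (le_trans (ltW pr) rT) y pu (ltW ur') rq.
  have h4 := sdist_triangle (X u) (X r) (X s) y.
  rewrite ltr_pdivlMr// in h2.
  have h5 : (K + F) * (r - u) <= (r - u) * (K + F + 1) by lra.
  by lra.
- by move=> y; rewrite /sdist !subrr normr0 addr0.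
- move=> r g /andP[sr rT] g0 hg e e0.
  have [p [q [pXq /andP[pr rq] _]]] := right r ltac:(by rewrite (le_trans s0 sr)).
  exists (q - r); first by rewrite subr_gt0.
  move=> u /andP[ru uq] uT y; have uq' : u <= q by lra.
  rewrite mul0r expR0 mul1r.
  have h3 := piece_lip eX pXq (le_trans pr (ltW rT)) y pr (ltW ru) uq'.
  have h4 := sdist_triangle (X r) (X u) (X s) y.
  have := hg y; have h5 : 0 <= e * (u - r) by rewrite mulr_ge0 ?(ltW e0)// subr_ge0 ltW.
  by lra.
Qed.

(** The Lipschitz constant of [mu_of] from the uniform distance of states to [BLdist], as given by
    [mu_of_dist]. *)
Definition mu_of_lip := expR (F * T) * 2 * tv mu0.

Definition euler_constant := expR ((L + l + M * mu_of_lip) * T) * (M * mu_of_lip * (K + F) * T).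

Lemma mu_of_lip_ge0 : 0 <= mu_of_lip.
Proof. by rewrite !mulr_ge0 ?expR_ge0// tv_ge0. Qed.

(** The two velocities depend on whole states, so [gronwall] is applied to the family indexed by all
    starting points. At time [r] they were frozen at [p] and [p'], at most [h] and [h'] earlier; by
    [euler_lip] this delay only adds the source [c], and the present distance feeds back at rate
    [M * mu_of_lip]. *)
Lemma euler_compare h h' X Y : 0 <= h -> 0 <= h' -> euler_scheme T h X -> euler_scheme T h' Y ->
  forall t x, 0 <= t <= T -> sdist (X t) (Y t) x <= euler_constant * (h + h').
Proof.
move=> h0 h'0 eX eY t x tT; have /andP[t0 tleT] := tT.
have z0 : 0 <= (0 : R) <= T by rewrite lexx.
have a0 := euler_admissibleT eX z0.
have K0 : 0 <= K := K_ge0 a0.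
have L0 : 0 <= L.
  by have hX := admissible_TVnorm a0; have [_ hL _] := vR hX hX; exact: lip_le_ge0 hL.
pose c := M * mu_of_lip * ((K + F) * (h + h')).
have KF0 : 0 <= K + F by rewrite addr_ge0.
have C0 := mu_of_lip_ge0.
have c0 : 0 <= c.
  apply: mulr_ge0; first exact: mulr_ge0.
  by apply: mulr_ge0 => //; exact: addr_ge0.
have MC0 : 0 <= M * mu_of_lip by rewrite mulr_ge0.
pose LL := L + l + M * mu_of_lip.
have LL0 : 0 <= LL by rewrite !addr_ge0.
suff main : sdist (X t) (Y t) x <= expR (LL * (t - 0)) * (0 + c * (t - 0)).
  apply: le_trans main _; rewrite !subr0 add0r.
  rewrite (_ : euler_constant * (h + h') = expR (LL * T) * (c * T)); last first.
    by rewrite /euler_constant /c /LL; ring.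
  apply: ler_pM; [exact: expR_ge0|exact: mulr_ge0| |exact: ler_wpM2l].
  by rewrite ler_expR ler_wpM2l.
have [X0 rightX leftX] := eX; have [Y0 rightY leftY] := eY.
apply: (@gronwall R (I01 R) (fun x t => sdist (X t) (Y t) x) 0 T LL c 0) => //.
- move=> y r /andP[r0 rT] e e0.
  have k0 : 0 < 2 * (K + F) + 1 by rewrite ltr_wpDl// mulr_ge0.
  exists (e / (2 * (K + F) + 1)); first by rewrite divr_gt0.
  move=> s s0 /andP[sr sr'].
  have h1 := euler_lip y eX s0 (ltW sr') rT.
  have h2 := euler_lip y eY s0 (ltW sr') rT.
  have h3 := sdist_triangle (X s) (X r) (Y r) y.
  have h4 := sdist_triangle (Y s) (X s) (Y r) y.
  rewrite (sdistC (Y s) (Y r)) in h4.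
  have h5 : r - s < e / (2 * (K + F) + 1) by lra.
  rewrite ltr_pdivlMr// in h5.
  by lra.
- by move=> y; rewrite X0 Y0 /sdist !subrr normr0 addr0.
- move=> r g /andP[r0 rT] g0 hg e e0.
  have rT' : 0 <= r < T by rewrite r0.
  have [p [q [pXq /andP[pr rq] pqh]]] := rightX r rT'.
  have [p' [q' [pYq /andP[pr' rq'] pqh']]] := rightY r rT'.
  exists (Num.min (q - r) (q' - r)); first by rewrite lt_min !subr_gt0 rq.
  move=> s /andP[rs sq] sT y.
  have sq1 : s <= q.
    have : s - r < q - r by apply: lt_le_trans (_ : Num.min (q - r) (q' - r) <= _);
      [lra|rewrite ge_min lexx].
    lra.
  have sq2 : s <= q'.
    have : s - r < q' - r by apply: lt_le_trans (_ : Num.min (q - r) (q' - r) <= _);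
      [lra|rewrite ge_min lexx orbT].
    lra.
  have sr0 : 0 <= s - r by rewrite subr_ge0 ltW.
  have [p0 pq pX] := pXq; have [p'0 pq' pY] := pYq.
  have pT : 0 <= p <= T by rewrite p0 (le_trans pr (ltW rT)).
  have p'T : 0 <= p' <= T by rewrite p'0 (le_trans pr' (ltW rT)).
  have aX := euler_admissibleT eX pT; have aY := euler_admissibleT eY p'T.
  have [_ vL vM] := vR (admissible_TVnorm aX) (admissible_TVnorm aY).
  have dp z : sdist (X p) (Y p') z <= g + (K + F) * (h + h').
    have d1 := euler_lip z eX p0 pr (ltW rT).
    have d2 := euler_lip z eY p'0 pr' (ltW rT).
    have d3 := sdist_triangle (X r) (X p) (Y p') z.
    have d4 := sdist_triangle (Y r) (X r) (Y p') z.
    rewrite (sdistC (X p) (X r)) in d3.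
    have d5 : (K + F) * (r - p) <= (K + F) * h by rewrite ler_wpM2l//; lra.
    have d6 : (K + F) * (r - p') <= (K + F) * h' by rewrite ler_wpM2l//; lra.
    by have := hg z; lra.
  have dv := vM _ (mu_of_dist mu0 aX aY dp).
  rewrite (pX r s pr (ltW rs) sq1) (pY r s pr' (ltW rs) sq2).
  apply: le_trans (step_dist fF fl _ _ _ (bv (X p)) (bv (Y p')) vL sr0 dv) _.
  rewrite (_ : M * (_ * _) = M * mu_of_lip * g + c); last by rewrite /c /mu_of_lip; ring.
  (* The feedback [M * mu_of_lip * g] is absorbed by raising the rate from [L + l] to [LL], through
     [1 + x <= expR x]. *)
  rewrite /LL (mulrDl (L + l)) expRD -[leRHS]mulrA; apply: ler_wpM2l; first exact: expR_ge0.
  set b := M * mu_of_lip in MC0 *.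
  have E1 : 1 + b * (s - r) <= expR (b * (s - r)) by exact: expR_ge1Dx.
  have b0 : 0 <= b * (s - r) by rewrite mulr_ge0.
  have e1 : 0 <= (c + e) * (s - r) by rewrite mulr_ge0// addr_ge0// ltW.
  have e2 : 0 <= e * (s - r) by rewrite mulr_ge0// ltW.
  apply: (@le_trans _ _ ((1 + b * (s - r)) * (g + (c + e) * (s - r)))); last first.
    by rewrite ler_wpM2r// addr_ge0.
  have e3 : 0 <= b * (s - r) * ((c + e) * (s - r)) by rewrite mulr_ge0.
  by have := hg y; lra.
Qed.

End horizon.
End scheme.

(** * Partitions *)

Section partitions.
Context {R : realType}.

Section points.
Variables (T : R) (a : seq R).
Hypotheses (T0 : 0 < T) (aT : itv_partition 0 T a).
Let p := partition_point a.

Lemma partition_ltS j : (j < size a)%N -> p j < p j.+1.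
Proof. by move=> ja; have [/(pathP 0) h _] := aT; exact: h. Qed.

Lemma partition_le i j : (i <= j)%N -> (j <= size a)%N -> p i <= p j.
Proof.
elim: j => [|j IH]; first by rewrite leqn0 => /eqP ->.
rewrite leq_eqVlt => /orP[/eqP->//|]; rewrite ltnS => ij ja.
by apply: le_trans (IH ij (ltnW ja)) _; exact: ltW (partition_ltS ja).
Qed.

Lemma partition_last : p (size a) = T.
Proof.
have [_ /eqP <-] := aT.
by rewrite /p /partition_point -(last_nth 0 0 a) .
Qed.

Lemma partition_itv j : (j <= size a)%N -> 0 <= p j <= T.
Proof.
move=> ja; rewrite -partition_last !partition_le// andbT.
exact: (@partition_le 0 j).
Qed.

Lemma partition_right t : 0 <= t < T -> exists2 j, (j < size a)%N & p j <= t < p j.+1.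
Proof.
move=> /andP[t0 tT].
have a0 : (0 < size a)%N.
  by case: (posnP (size a)) => // s0; have := partition_last; rewrite s0 => h; move: T0;
    rewrite -h ltxx.
have ex : exists j, t < p j.+1 by exists (size a).-1; rewrite prednK// partition_last.
case: (ex_minnP ex) => j tj jmin; exists j.
  by rewrite -(prednK a0) ltnS; apply: jmin; rewrite prednK// partition_last.
rewrite tj andbT; case: j tj jmin => [|j] tj jmin; first exact: t0.
by rewrite leNgt; apply/negP => /jmin; rewrite ltnn.
Qed.

Lemma partition_left t : 0 < t <= T -> exists2 j, (j < size a)%N & p j < t <= p j.+1.
Proof.
move=> /andP[t0 tT].
have a0 : (0 < size a)%N.
  by case: (posnP (size a)) => // s0; have := partition_last; rewrite s0 => h; move: T0;
    rewrite -h ltxx.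
have ex : exists j, t <= p j.+1 by exists (size a).-1; rewrite prednK// partition_last.
case: (ex_minnP ex) => j tj jmin; exists j.
  by rewrite -(prednK a0) ltnS; apply: jmin; rewrite prednK// partition_last.
rewrite tj andbT; case: j tj jmin => [|j] tj jmin; first exact: t0.
by rewrite ltNge; apply/negP => /jmin; rewrite ltnn.
Qed.

Lemma partition_mesh j : (j < size a)%N -> p j.+1 - p j <= mesh a.
Proof.
move=> ja; apply: (@le_bigmax _ _ _ 0 (fun i : 'I_(size a) => p i.+1 - p i) (Ordinal ja)).
Qed.

Lemma mesh_ge0 : 0 <= mesh a.
Proof. by rewrite /mesh; apply: bigmax_ge_id. Qed.

Lemma partition_find t j : (j < size a)%N -> p j < t <= p j.+1 ->
  find (fun s => t <= s) a = j.
Proof.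
move=> ja /andP[jt tj]; apply/eqP; rewrite eqn_leq; apply/andP; split; rewrite leqNgt;
  apply/negP => h.
  by have := before_find 0 h; rewrite tj.
have hs : has (fun s => t <= s) a by rewrite has_find (ltn_trans h).
have := nth_find 0 hs; rewrite leNgt => /negP[].
by apply: le_lt_trans jt; apply: (@partition_le _.+1 j) => //; exact: ltnW.
Qed.

End points.

Definition uniform_partition (T : R) (k : nat) : seq R := mkseq (fun i => grid T k i.+1) k.+1.

Lemma uniform_point T k j : (j <= k.+1)%N -> partition_point (uniform_partition T k) j = grid T k j.
Proof.
case: j => [_|j jk]; first by rewrite /partition_point /= grid0.
by rewrite /partition_point /= nth_mkseq.
Qed.

Lemma uniform_itv_partition (T : R) k : 0 < T -> itv_partition 0 T (uniform_partition T k).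
Proof.
move=> T0; split.
  apply/(pathP 0) => i; rewrite size_mkseq => ik.
  have h := @uniform_point T k i (ltnW ik); rewrite /partition_point in h.
  by rewrite h nth_mkseq// gridS ltrDl divr_gt0.
apply/eqP; rewrite (last_nth 0) size_mkseq.
have h := @uniform_point T k k.+1 (leqnn _); rewrite /partition_point in h.
by rewrite h grid_last.
Qed.

Lemma uniform_mesh (T : R) k : 0 < T -> mesh (uniform_partition T k) = T / k.+1%:R.
Proof.
move=> T0; have Tk : 0 <= T / k.+1%:R by rewrite divr_ge0// ltW.
have E j : (j < k.+1)%N -> partition_point (uniform_partition T k) j.+1 -
    partition_point (uniform_partition T k) j = T / k.+1%:R.
  by move=> jk; rewrite !uniform_point//; [rewrite gridS addrC addKr|exact: ltnW].
apply/eqP; rewrite eq_le; apply/andP; split.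
  apply/bigmax_leP; split => // i _; rewrite E//.
  by have := ltn_ord i; rewrite [X in (_ < X)%N]size_mkseq.
rewrite -(E 0%N)//; apply: partition_mesh.
by rewrite size_mkseq.
Qed.

(** * The Euler scheme of a partition, on states and on measures *)

Section euler_scheme_partition.
Variables (f : I01 R -> R) (mu0 : Meas R) (v : Meas R -> I01 R -> R).
Hypotheses (bf : BL f) (hv : velocity_assumption v).
Local Notation fv := (frozen_velocity mu0 v).

Let bv (X : state R) : BL (fv X). Proof. exact: velocity_BL. Qed.

Lemma horizon_constants (T : R) : exists F l K L M : R,
  [/\ sup_le f F, lip_le f l, 0 <= M &
   forall m n, (TVnorm m <= (mass_bound mu0 T F)%:E)%E -> (TVnorm n <= (mass_bound mu0 T F)%:E)%E ->
    [/\ sup_le (v m) K, lip_le (v m) L &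
    forall d : R, (BLdist m n <= d%:E)%E -> forall x, `|v m x - v n x| <= M * d]].
Proof.
have /BLP[F [l [fF fl]]] := bf.
have r0 : 0 < mass_bound mu0 T F.
  by rewrite /mass_bound ltr_wpDl// mulr_ge0 ?expR_ge0// tv_ge0.
by have [K [L [M [M0 H]]]] := velocity_constants hv r0; exists F, l, K, L, M.
Qed.

Fixpoint node (a : seq R) (j : nat) : state R :=
  if j is k.+1 then
    step f (fv (node a k)) (partition_point a k.+1 - partition_point a k) (node a k)
  else @initial R.

(** As [a] lists t_1, ..., t_N, the first index [j] whose entry is at least [t] is that of the piece
    ]t_j, t_(j+1)]; time 0 falls to [j = 0]. *)
Definition euler (a : seq R) (t : R) : state R :=
  let j := find (fun s => t <= s) a in
  step f (fv (node a j)) (t - partition_point a j) (node a j).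

(** The left end point is included: when [0 < j], [find] selects the preceding piece there, whose
    final state is [node a j]. *)
Lemma euler_eq T a j t : itv_partition 0 T a -> (j < size a)%N ->
  partition_point a j <= t <= partition_point a j.+1 ->
  euler a t = step f (fv (node a j)) (t - partition_point a j) (node a j).
Proof.
move=> aT ja /andP[]; rewrite le_eqVlt => /orP[/eqP<- _|jt tj]; last first.
  by rewrite /euler (partition_find aT ja)// jt.
rewrite subrr step0//; case: j ja => [|j] ja.
  have -> : euler a (partition_point a 0) = step f (fv (node a 0)) 0 (node a 0).
    rewrite /euler (_ : find _ a = 0%N) ?subrr//.
    have := partition_ltS aT ja; rewrite /partition_point /=.
    by case: (a) => //= s s' /ltW ->.
  by rewrite step0.
rewrite /euler (partition_find aT (ltnW ja))// lexx andbT.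
by exact: (partition_ltS aT (ltnW ja)).
Qed.

Lemma euler_node T a j : itv_partition 0 T a -> (j < size a)%N ->
  euler a (partition_point a j) = node a j.
Proof.
move=> aT ja; rewrite (euler_eq aT ja) ?lexx ?(ltW (partition_ltS aT ja))//.
by rewrite subrr step0.
Qed.

Lemma euler_pieceP T a j : 0 < T -> itv_partition 0 T a -> (j < size a)%N ->
  piece f mu0 v (euler a) (partition_point a j) (partition_point a j.+1).
Proof.
move=> T0 aT ja; split.
- by have /andP[] := partition_itv aT (ltnW ja).
- exact: (partition_ltS aT ja).
- move=> r s pr rs sq; rewrite (euler_node aT ja).
  rewrite (euler_eq (t := s) aT ja); last by rewrite (le_trans pr).
  rewrite (euler_eq (t := r) aT ja); last by rewrite pr (le_trans rs).
  rewrite stepD ?subr_ge0//; congr step; ring.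
Qed.

Lemma euler_scheme_euler T a h : 0 < T -> itv_partition 0 T a -> mesh a <= h ->
  euler_scheme f mu0 v T h (euler a).
Proof.
move=> T0 aT ah; split.
- have T0' : 0 <= (0 : R) < T by rewrite lexx.
  have [j ja _] := partition_right T0 aT T0'.
  exact: (euler_node aT (leq_ltn_trans (leq0n j) ja)).
- move=> t tT; have [j ja jt] := partition_right T0 aT tT.
  exists (partition_point a j), (partition_point a j.+1); split => //.
    exact: (euler_pieceP T0 aT ja).
  by apply: le_trans ah; exact: partition_mesh.
- move=> t tT; have [j ja jt] := partition_left T0 aT tT.
  exists (partition_point a j), (partition_point a j.+1); split => //.
    exact: (euler_pieceP T0 aT ja).
  by apply: le_trans ah; exact: partition_mesh.
Qed.

Lemma scheme_admissible T h X : 0 <= T -> euler_scheme f mu0 v T h X ->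
  exists B, forall t, 0 <= t <= T -> admissible_state B (X t).
Proof.
move=> T0 eX; have /BLP[F [l [fF fl]]] := bf.
by exists (F * T) => t tT; exact: (euler_admissibleT bf hv fF fl eX tT).
Qed.

Lemma sdist_lip_BL_continuous T B C X : (forall t, 0 <= t <= T -> admissible_state B (X t)) ->
  (forall (s t : R) x, 0 <= s -> s <= t -> t <= T -> sdist (X t) (X s) x <= C * (t - s)) ->
  BL_continuous T (fun t => mu_of mu0 (X t)).
Proof.
move=> aX hX; apply: (@BL_continuous_lip R (expR B * 2 * tv mu0 * C)) => s t sT tT.
rewrite -mulrA; apply: mu_of_dist; [exact: aX|exact: aX|].
move=> x; have /andP[s0 s1] := sT; have /andP[t0 t1] := tT.
have [st|/ltW ts] := leP s t.
  by rewrite sdistC ler0_norm ?subr_le0// opprB; exact: hX.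
by rewrite ger0_norm ?subr_ge0//; exact: hX.
Qed.

Lemma scheme_BL_continuous T h X : 0 <= T -> euler_scheme f mu0 v T h X ->
  BL_continuous T (fun t => mu_of mu0 (X t)).
Proof.
move=> T0 eX; have [B aX] := scheme_admissible T0 eX.
have [F [l [K [L [M [fF fl M0 vR]]]]]] := horizon_constants T.
apply: (sdist_lip_BL_continuous (C := K + F) aX) => s t x.
exact: (euler_lip bf hv T0 fF fl vR x eX).
Qed.

Lemma euler_is_euler_approximation T a : 0 < T -> itv_partition 0 T a ->
  is_euler_approximation f v T mu0 a (fun t => mu_of mu0 (euler a t)).
Proof.
move=> T0 aT; have eX := euler_scheme_euler T0 aT (lexx _).
have [B aX] := scheme_admissible (ltW T0) eX.
have /BLP[F [l [fF fl]]] := bf.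
split.
- exact: (scheme_BL_continuous (ltW T0) eX).
- have [-> _ _] := eX; move=> A mA; symmetry; exact: mu_of_initial.
- move=> j t ja /andP[jt tj].
  have pj : 0 <= partition_point a j <= T := partition_itv aT (ltnW ja).
  rewrite (euler_eq aT ja) ?(ltW jt)// (euler_node aT ja).
  have aN : admissible_state B (node a j) by rewrite -(euler_node aT ja); exact: aX.
  move=> A mA; symmetry; apply: (linear_operator_mu_of bf fF fl aN (bv _)) => //.
  by rewrite subr_ge0 ltW.
Qed.

Lemma euler_approximation_eq T a muk : 0 < T -> itv_partition 0 T a ->
  is_euler_approximation f v T mu0 a muk ->
  forall t, 0 <= t <= T -> eqM (muk t) (mu_of mu0 (euler a t)).
Proof.
move=> T0 aT [_ muk0 muk_step]; have eX := euler_scheme_euler T0 aT (lexx _).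
have [B aX] := scheme_admissible (ltW T0) eX.
have /BLP[F [l [fF fl]]] := bf.
have one j t : (j < size a)%N -> partition_point a j < t <= partition_point a j.+1 ->
    eqM (muk (partition_point a j)) (mu_of mu0 (node a j)) -> eqM (muk t) (mu_of mu0 (euler a t)).
  move=> ja jt IH; have /andP[jt1 jt2] := jt.
  have pj : 0 <= partition_point a j <= T := partition_itv aT (ltnW ja).
  have aN : admissible_state B (node a j) by rewrite -(euler_node aT ja); exact: aX.
  rewrite (euler_eq aT ja) ?(ltW jt1)// => A mA.
  rewrite (muk_step j t ja jt A mA) (velocity_eqM hv IH).
  by apply: (linear_operator_mu_of bf fF fl aN (bv _)) => //; rewrite subr_ge0 ltW.
have nodes j : (j < size a)%N -> eqM (muk (partition_point a j)) (mu_of mu0 (node a j)).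
  elim: j => [_|j IH ja].
    by move=> A mA; rewrite (muk0 A mA); exact: mu_of_initial.
  rewrite -(euler_node aT ja); apply: (one j) => //; first exact: ltnW.
    by rewrite lexx andbT; exact: (partition_ltS aT (ltnW ja)).
  by apply: IH; exact: ltnW.
move=> t /andP[]; rewrite le_eqVlt => /orP[/eqP<- _|t0 tT].
  have T0' : 0 <= (0 : R) < T by rewrite lexx.
  have [j ja _] := partition_right T0 aT T0'.
  have a0 := leq_ltn_trans (leq0n j) ja.
  by have := nodes 0%N a0; rewrite -(euler_node aT a0).
have tT' : 0 < t <= T by rewrite t0.
have [j ja jt] := partition_left T0 aT tT'.
by apply: (one j) => //; exact: nodes.
Qed.

End euler_scheme_partition.
End partitions.

(** * The limit *)

Section limit.
Context {R : realType}.
Variables (f : I01 R -> R) (mu0 : Meas R) (v : Meas R -> I01 R -> R).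
Hypotheses (bf : BL f) (hv : velocity_assumption v).
Local Notation scheme := (euler_scheme f mu0 v).

Lemma scheme_compare (T : R) : 0 <= T -> exists2 C : R, 0 <= C & forall h h' X Y,
  0 <= h -> 0 <= h' -> scheme T h X -> scheme T h' Y ->
  forall t x, 0 <= t <= T -> sdist (X t) (Y t) x <= C * (h + h').
Proof.
move=> T0; have [F [l [K [L [M [fF fl M0 vR]]]]]] := horizon_constants mu0 bf hv T.
pose C := euler_constant mu0 T F l K L M.
exists `|C| => // h h' X Y h0 h'0 eX eY t x tT.
apply: le_trans (euler_compare bf hv T0 fF fl M0 vR h0 h'0 eX eY x tT) _.
by apply: ler_wpM2r; [exact: addr_ge0|exact: ler_norm].
Qed.

(* An Euler scheme on [[0, n+1]] with step [1/(n+1)]. *)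
Definition approx (n : nat) : R -> state R :=
  euler f mu0 v (uniform_partition n.+1%:R (n.+1 * n.+1).-1).

Lemma approx_scheme (T : R) n : T <= n.+1%:R -> scheme T (n.+1%:R^-1) (approx n).
Proof.
move=> Tn; have n0 : 0 < n.+1%:R :> R by [].
apply: euler_schemeW Tn _; apply: (euler_scheme_euler mu0 bf hv n0).
  exact: uniform_itv_partition.
(* [uniform_partition T k] has [k.+1] cells, so here there are [(n + 1) ^ 2] of them, each of length
   [1 / (n + 1)]. *)
rewrite uniform_mesh// prednK// natrM invfM mulrA divff ?mul1r//.
Qed.

(** The horizons of [approx] grow with [n], so a single sequence has a limit at every nonnegative
    time and no solutions need to be glued. [clamp] reads the limit of the positions as a point of
    [0, 1]. *)
Definition limit_state (t : R) : state R := fun x =>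
  (clamp (lim (I01val (approx n t x).1 @[n --> \oo])), lim ((approx n t x).2 @[n --> \oo])).

Lemma limit_rate (T : R) : 0 <= T -> exists2 C : R, 0 <= C & forall h X, 0 <= h ->
  scheme T h X -> forall t x, 0 <= t <= T -> sdist (X t) (limit_state t) x <= C * h.
Proof.
move=> T0; have [C C0 HC] := scheme_compare T0; exists C => // h X h0 eX t x tT.
pose N := Num.bound T.
have TN n : (N <= n)%N -> T <= n.+1%:R.
  move=> Nn; apply: le_trans (ltW (archi_boundP T0)) _; rewrite ler_nat.
  exact: leqW.
have inv_le n m : (n <= m)%N -> (m.+1%:R^-1 : R) <= n.+1%:R^-1.
  by move=> nm; rewrite lef_pV2 ?posrE// ler_nat.
pose e (n : nat) := 2 * C / n.+1%:R.
have e0 : e n @[n --> \oo] --> (0 : R) by exact: cvg_divn.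
have cauchy n m : (N <= n <= m)%N -> sdist (approx n t) (approx m t) x <= e n.
  move=> /andP[Nn nm].
  apply: le_trans (HC _ _ _ _ _ _ (approx_scheme (TN n Nn)) (approx_scheme (TN m (leq_trans Nn
    nm))) t x tT) _ => //.
  rewrite /e (mulrC 2) -mulrA ler_wpM2l// mulrDl mul1r lerD2l.
  exact: inv_le.
have near n : (N <= n)%N -> sdist (approx n t) (limit_state t) x <= e n + e n.
  move=> Nn; rewrite /sdist; apply: lerD.
    rewrite -[(approx n t x).1]clampK.
    apply: le_trans (clamp_lip _ _) _.
    apply: (@cauchy_lim R (fun n => I01val (approx n t x).1) e N) => // n' m' nm.
    by apply: le_trans (cauchy n' m' nm); exact: sdist_fst.
  apply: (@cauchy_lim R (fun n => (approx n t x).2) e N) => // n' m' nm.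
  by apply: le_trans (cauchy n' m' nm); exact: sdist_snd.
(* One [C] comes from comparing [X] with [approx], and [2 * C] from each of the two components of
   the distance from [approx] to its limit. *)
apply: (@le_cvg0 R _ _ (fun n => 5 * C / n.+1%:R)); last exact: cvg_divn.
move=> n; have Nn : (N <= N + n)%N by exact: leq_addr.
have h1 := HC h _ X _ h0 _ eX (approx_scheme (TN _ Nn)) t x tT.
have h2 := near _ Nn.
have h3 := sdist_triangle (approx (N + n) t) (X t) (limit_state t) x.
have h4 := inv_le n (N + n)%N (leq_addl _ _).
have i0 : 0 <= ((N + n).+1%:R^-1 : R) by [].
have {}h1 := h1 i0.
rewrite /e in h2.
have h5 := ler_wpM2l C0 h4.
move: h1 h2 h5; set i := (N + n).+1%:R^-1; set j := n.+1%:R^-1 => h1 h2 h5.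
by lra.
Qed.

Lemma limit_approx (T : R) : 0 <= T -> exists (C : R) (N : nat), forall n (t : R) x, 0 <= t <= T ->
  scheme T ((N + n).+1%:R^-1) (approx (N + n)) /\
  sdist (approx (N + n) t) (limit_state t) x <= C / n.+1%:R.
Proof.
move=> T0; have [C C0 HC] := limit_rate T0.
exists C, (Num.bound T) => n t x tT.
have TN : T <= (Num.bound T + n).+1%:R.
  apply: le_trans (ltW (archi_boundP T0)) _; rewrite ler_nat.
  by apply: leqW; exact: leq_addr.
split; first exact: approx_scheme.
apply: le_trans (HC _ _ _ (approx_scheme TN) t x tT) _ => //.
by rewrite ler_wpM2l// lef_pV2 ?posrE// ler_nat ltnS leq_addl.
Qed.

Lemma cvg_of_rate (u : nat -> R) (l C : R) : (forall n, `|u n - l| <= C / n.+1%:R) ->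
  u n @[n --> \oo] --> l.
Proof.
move=> uC; apply/cvgrPdist_le => e e0.
have /cvgrPdist_le/(_ e e0) : C / n.+1%:R @[n --> \oo] --> (0 : R) by exact: cvg_divn.
apply: filterS => n; rewrite sub0r normrN => h.
by rewrite distrC; apply: le_trans (uC n) (le_trans (ler_norm _) h).
Qed.

Lemma limit_admissible (T F : R) : 0 <= T -> sup_le f F ->
  forall t, 0 <= t <= T -> admissible_state (F * T) (limit_state t).
Proof.
move=> T0 fF t tT; have /BLP[_ [l [_ fl]]] := bf.
have [C [N H]] := limit_approx T0.
have aN n : admissible_state (F * T) (approx (N + n) t).
  have [eN _] := H n t (clamp 0) tT; exact: (euler_admissibleT bf hv fF fl eN tT).
have c1 x : I01val (approx (N + n) t x).1 @[n --> \oo] --> I01val (limit_state t x).1.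
  apply: (@cvg_of_rate _ _ C) => n; have [_] := H n t x tT.
  by apply: le_trans; exact: sdist_fst.
have c2 x : (approx (N + n) t x).2 @[n --> \oo] --> (limit_state t x).2.
  apply: (@cvg_of_rate _ _ C) => n; have [_] := H n t x tT.
  by apply: le_trans; exact: sdist_snd.
split.
- have m1 : measurable_fun setT (fun x => I01val (limit_state t x).1).
    apply: (@measurable_fun_cvg _ _ _ setT (fun n x => I01val (approx (N + n) t x).1)).
      by move=> n; apply: measurableT_comp measurable_I01val _; exact: (aN n).1.
    by move=> x _; exact: c1.
  move=> _ _ [B mB <-]; have := m1 measurableT B mB.
  by rewrite !setTI.
- split.
    apply: (@measurable_fun_cvg _ _ _ setT (fun n x => (approx (N + n) t x).2)).
      by move=> n; exact: (aN n).2.1.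
    by move=> x _; exact: c2.
  move=> x; apply: (@le_cvg0 R _ _ (fun n => C / n.+1%:R)); last exact: cvg_divn.
  move=> n; have d : sdist (approx (N + n) t) (limit_state t) x <= C / n.+1%:R := (H n t x tT).2.
  pose z : R := (limit_state t x).2; pose y : R := (approx (N + n) t x).2.
  have h1 : z - y <= sdist (limit_state t) (approx (N + n) t) x.
    exact: le_trans (ler_norm _) (sdist_snd _ _ x).
  rewrite sdistC in h1; have h2 : y <= F * T := (aN n).2.2 x.
  by move: h1; rewrite lerBlDl => /le_trans; apply; exact: lerD.
Qed.

Lemma limit_lip (T : R) : 0 <= T -> exists C : R, forall (s t : R) x, 0 <= s -> s <= t -> t <= T ->
  sdist (limit_state t) (limit_state s) x <= C * (t - s).
Proof.
move=> T0; have [F [l [K [L [M [fF fl M0 vR]]]]]] := horizon_constants mu0 bf hv T.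
have [C [N H]] := limit_approx T0.
exists (K + F) => s t x s0 st tT.
have sT' : 0 <= s <= T by rewrite s0 (le_trans st).
have tT' : 0 <= t <= T by rewrite (le_trans s0 st).
apply: (@le_cvg0 R _ _ (fun n => 2 * C / n.+1%:R)); last exact: cvg_divn.
move=> n; have [eN _] := H n t x tT'.
have h1 : sdist (approx (N + n) t) (limit_state t) x <= C / n.+1%:R := (H n t x tT').2.
have h2 : sdist (approx (N + n) s) (limit_state s) x <= C / n.+1%:R := (H n s x sT').2.
have h3 := euler_lip bf hv T0 fF fl vR x eN s0 st tT.
have h4 := sdist_triangle (approx (N + n) t) (limit_state t) (limit_state s) x.
have h5 := sdist_triangle (approx (N + n) s) (approx (N + n) t) (limit_state s) x.
rewrite (sdistC (limit_state t) (approx (N + n) t)) in h4.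
by move: h1 h2; set q := n.+1%:R^-1 => h1 h2; lra.
Qed.

Definition limit_measure (t : R) : Meas R := mu_of mu0 (limit_state t).

Lemma limit_measure_continuous (T : R) : 0 <= T -> BL_continuous T limit_measure.
Proof.
move=> T0; have /BLP[F [l [fF fl]]] := bf; have [C HC] := limit_lip T0.
apply: (@sdist_lip_BL_continuous R mu0 T (F * T) C limit_state) => //.
by move=> t; exact: limit_admissible.
Qed.

(** One constant for all partitions: this yields existence along uniform partitions and uniqueness
    along any admissible sequence. *)
Lemma euler_limit_rate (T : R) : 0 < T -> exists2 C : R, 0 <= C & forall a, itv_partition 0 T a ->
  forall t, 0 <= t <= T ->
  (BLdist (mu_of mu0 (euler f mu0 v a t)) (limit_measure t) <= (C * mesh a)%:E)%E.
Proof.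
move=> T0; have /BLP[F [l [fF fl]]] := bf; have [C C0 HC] := limit_rate (ltW T0).
exists (expR (F * T) * 2 * tv mu0 * C); first by rewrite !mulr_ge0 ?expR_ge0 ?tv_ge0.
move=> a aT t tT; have eX := euler_scheme_euler mu0 bf hv T0 aT (lexx _).
rewrite -mulrA; apply: mu_of_dist.
- exact: (euler_admissibleT bf hv fF fl eX tT).
- exact: limit_admissible (ltW T0) fF t tT.
- by move=> x; apply: (HC _ _ _ eX t x tT); exact: mesh_ge0.
Qed.

Lemma limit_measure_mild (T : R) : 0 < T -> is_mild_solution f v T mu0 limit_measure.
Proof.
move=> T0; split; first exact: limit_measure_continuous (ltW T0).
have [C C0 HC] := euler_limit_rate T0.
exists (uniform_partition T), (fun k t => mu_of mu0 (euler f mu0 v (uniform_partition T k) t)), id.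
have aT k := uniform_itv_partition k T0.
split => //.
- split => //.
    move=> n m nm /=; rewrite !uniform_mesh//.
    by rewrite ler_wpM2l ?(ltW T0)// lef_pV2 ?posrE// ler_nat.
  under eq_fun do rewrite uniform_mesh//.
  exact: cvg_divn.
- by move=> k; exact: euler_is_euler_approximation.
- apply: (@squeeze_cvge0 R _ _ _ _ (fun k => C * T / k.+1%:R)); last exact: cvg_divn.
    move=> k; apply: le_trans (_ : BLdist (mu_of mu0 (euler f mu0 v (uniform_partition T k) 0))
      (limit_measure 0) <= _)%E; first exact: dual_norm_ge0.
    by apply: ereal_sup_ubound; exists 0 => //; rewrite /= in_itv/= lexx ltW.
  apply: nearW => k; apply: ge_ereal_sup => _ [t /= tT <-].
  rewrite in_itv/= in tT.
  by apply: le_trans (HC _ (aT k) t tT) _; rewrite uniform_mesh// mulrA.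
Qed.

(** At a late index [nu t] and the limit are both within [e / 2] of the same Euler approximation,
    the former by definition of a mild solution, the latter by the rate. *)
Lemma mild_solution_unique (T : R) nu : 0 < T -> is_mild_solution f v T mu0 nu ->
  forall t, 0 <= t <= T -> eqM (nu t) (limit_measure t).
Proof.
move=> T0 [_ [a [muk [sigma [[aT _ a0] eul incr lim]]]]] t tT.
have [C C0 HC] := euler_limit_rate T0.
have sge n : (n <= sigma n)%N.
  elim: n => // n IH; apply: leq_ltn_trans IH _.
  by have := leW_mono incr n n.+1; rewrite !ltEnat /= => ->.
have mesh0 : C * mesh (a (sigma k)) @[k --> \oo] --> (0 : R).
  rewrite -[0](mulr0 C); apply: cvgMr.
  apply/cvgrPdist_le => e e0; move/cvgrPdist_le : a0 => /(_ e e0) [N _ HN].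
  by exists N => // n /= Nn; apply: HN => /=; exact: leq_trans Nn (sge n).
suff d : (BLdist (nu t) (limit_measure t) <= 0%:E)%E.
  apply: eqM_of_BL => phi /BLP[p [q [hp hq]]].
  have := BLdist_bound d (sup_le_ge0 hp) (lip_le_ge0 hq) hp hq.
  by rewrite mul0r normr_le0 subr_eq0 => /eqP.
apply/dual_normP => phi p1; apply/ler_addgt0Pr => e e0; rewrite add0r.
have e2 : 0 < e / 2 by rewrite divr_gt0.
have [N1 _ H1] := cvge0_near _ e2 lim.
move/cvgrPdist_le : mesh0 => /(_ _ e2) [N2 _ H2].
pose n := maxn N1 N2.
have {}H1 := H1 n (leq_maxl _ _); have {}H2 := H2 n (leq_maxr _ _).
have d1 : (BLdist (muk (sigma n) t) (nu t) <= (e / 2)%:E)%E.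
  by apply: le_trans H1; apply: ereal_sup_ubound; exists t.
have d2 : (BLdist (mu_of mu0 (euler f mu0 v (a (sigma n)) t)) (limit_measure t) <= (e / 2)%:E)%E.
  apply: le_trans (HC _ (aT _) t tT) _; rewrite lee_fin.
  by move: H2; rewrite /= sub0r normrN; apply: le_trans; exact: ler_norm.
have E := euler_approximation_eq bf hv T0 (aT _) (eul (sigma n)) tT.
have mp : bounded_measurable phi.
  have [p [q [_ _ _ hp hq]]] := BLnorm1P p1.
  by apply: BL_bounded_measurable; apply/BLP; exists p, q.
move/dual_normP : d1 => /(_ phi p1) /=; move/dual_normP : d2 => /(_ phi p1) /=.
rewrite (eqM_pairing E mp); set P := pairing (mu_of _ _) phi.
have := ler_distD P (pairing (nu t) phi) (pairing (limit_measure t) phi).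
by rewrite (distrC _ P); lra.
Qed.

End limit.

Theorem corollary3p11 (R : realType) (f : I01 R -> R) (hf : BL f)
    (mu0 : Meas R) (hmu0 : mu0.-positive_set [set: I01 R])
    (v : Meas R -> I01 R -> R) (hv : velocity_assumption v) :
  exists mu : R -> Meas R,
    is_global_mild_solution f v mu0 mu /\
    forall nu : R -> Meas R, is_global_mild_solution f v mu0 nu ->
      forall t, 0 <= t -> eqM (nu t) (mu t).
Proof.
exists (limit_measure f mu0 v); split.
  split=> [t t0|T T0].
    have /BLP[F [l [fF fl]]] := hf.
    have tt : 0 <= t <= t by rewrite t0 lexx.
    exact: mu_of_positive hmu0 (limit_admissible mu0 hf hv t0 fF tt).
  split; first exact: limit_measure_mild.
  by move=> nu hnu t tT; exact: mild_solution_unique hnu t tT.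
(* The horizon has to be positive while [t] may be 0, hence [t + 1]. *)
move=> nu [_ hnu] t t0; have t1 : 0 < t + 1 by rewrite ltr_wpDl.
have [mild _] := hnu _ t1.
by apply: (mild_solution_unique hf hv t1 mild); rewrite t0 lerDl ler01.
Qed.
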